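(* Let $W$ be a Weyl group acting linearly on an algebraic torus $T$ as a reflection group. A hypertoric variety with structure torus $T$ is $W$-invariant if and only if its integral multiarrangement $(\mathcal A,m)$ is $W$-invariant and the class $\mathfrak o(\mathcal A,m)\in H^2(W;T)$ is trivial.
   Context: Hypertoric varieties. Let $T$ be an algebraic torus over $\mathbb C$ with Lie algebra $\mathfrak h$ and cocharacter lattice $\mathcal X_\ast(T)\subset\mathfrak h$. Given $\alpha_1,\dots,\alpha_d\in\mathcal X_\ast(T)$ and $\lambda_1,\dots,\lambda_d\in\mathbb C$, let $T^d=(\mathbb C^\ast)^d$ act on $\mathbb C^{2d}=T^\ast\mathbb C^d$ (coordinates $u_k,v_k$, weights $+1,-1$, symplectic form $\sum du_k\wedge dv_k$) and on $T^\ast T=T\times\mathfrak h^\ast$ through the homomorphism $T^d\to T$ given on cocharacters by $e_k\mapsto\alpha_k$. With $Z_\lambda=\{u_kv_k+\lambda_k=\langle\alpha_k,z\rangle\ \forall k\}\subset\mathbb C^{2d}\times T\times\mathfrak h^\ast$, the affine hypertoric variety with structure torus $T$ is the symplectic quotient $X=\operatorname{Spec}\mathbb C[Z_\lambda]^{T^d}$, a Poisson variety with Hamiltonian $T$-action and moment map $\mu:X\to\mathfrak h^\ast$ induced by projection. $X$ is $W$-invariant if the action of $T$ on $X$ extends to a Hamiltonian action of $T\rtimes W$ (i.e. $W$ acts preserving the Poisson structure and $\mu$ is $W$-equivariant). Integral multiarrangements. An affine hyperplane in $\mathfrak h^\ast$ is integral if some nonzero element of $\mathcal X_\ast(T)$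 is normal to it. An integral multiarrangement is a finite multiset of integral hyperplanes, written $(\mathcal A,m)$ with $\mathcal A=\{H_1,\dots,H_d\}$ a set of distinct hyperplanes and $m:\mathcal A\to\mathbb N$ the multiplicity. The integral multiarrangement of $X$ is obtained by letting each $(\alpha_k,\lambda_k)$ with $\alpha_k\neq0$ contribute the hyperplane $\{\langle\alpha_k,z\rangle=\lambda_k\}$ with multiplicity equal to the divisibility of $\alpha_k$ in $\mathcal X_\ast(T)$ (and omitting $\alpha_k=0$); it depends only on the isomorphism class of $X$. The class $\mathfrak o(\mathcal A,m)$. Let $(\mathcal A,m)$ be $W$-invariant, $\mathcal A=\{H_1,\dots,H_d\}$. Choose a primitive normal $\omega_k\in\mathcal X_\ast(T)$ to each $H_k$ and let $\alpha:(\mathbb C^\ast)^d\to T$ be the homomorphism given on cocharacters by $\alpha(e_k)=m(H_k)\omega_k$. Let $W_d=(\mathbb Z_2)^d\rtimes\Sigma_d$ be the group of signed permutations of $e_1,\dots,e_d$ and let $\phi:W\to W_d$ be given by $\phi(w)e_k=\varepsilon e_j$ if $w.H_k=H_j$ and $w.\omega_k=\varepsilon\omega_j$, $\varepsilon=\pm1$. Let $\tilde W_d\simeq(\mathbb Z_4)^d\rtimes\Sigma_d$ be the subgroup of $\mathrm{Sp}_{2d}(\mathbb C)$ generated by permutations of the $d$ $\mathbb C^2$-factors and by the transformations acting on the $j$-th $\mathbb C^2$ by $(u,v)\mapsto(-v,u)$ and trivially on the other factors; it is an extension $1\to(\mathbb Z_2)^d\to\tilde W_d\to W_d\to1$, with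 $(\mathbb Z_2)^d=\{\pm1\}^d\subset(\mathbb C^\ast)^d$, and $[c_d]\in H^2(W_d;(\mathbb Z_2)^d)$ denotes its class. Then $\mathfrak o(\mathcal A,m)\in H^2(W;T)$ is the image of $\phi^\ast[c_d]\in H^2(W;(\mathbb Z_2)^d)$ under the map induced by the ($W$-equivariant) homomorphism $\alpha|_{(\mathbb Z_2)^d}:(\mathbb Z_2)^d\to T$; it does not depend on the choice of the $\omega_k$. *)

(* Defs.v *)
From HB Require Import structures.
From mathcomp Require Import all_boot all_order all_algebra all_fingroup all_character.
From mathcomp Require Import boolp classical_sets functions reals complex mpoly.

Set Implicit Arguments.
Unset Strict Implicit.
Unset Printing Implicit Defensive.

Import Order.TTheory GRing.Theory Num.Theory.
Local Open Scope ring_scope.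

Section Weyl.

Variable R : realType.

Definition dotv r (x y : 'rV[R]_r) : R := (x *m y^T) 0 0.

(* x *m reflection_mx a = x - 2 <x, a> / <a, a> a *)
Definition reflection_mx r (a : 'rV[R]_r) : 'M[R]_r :=
  1%:M - (2 / dotv a a) *: (a^T *m a).

Record root_system r (Phi : seq 'rV[R]_r) : Prop := RootSystem {
  root_span : <<Phi>>%VS = fullv;
  root_neq0 : 0 \notin Phi;
  root_refl : {in Phi &, forall a b, b *m reflection_mx a \in Phi};
  root_int : {in Phi &, forall a b, 2 * dotv b a / dotv a a \is a Num.int};
  root_reduced : forall a c, a \in Phi -> c *: a \in Phi -> c = 1 \/ c = -1 }.

Definition is_weyl_group (W : finGroupType) : Prop :=
  exists r (Phi : seq 'rV[R]_r) (f : mx_representation R [set: W] r),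
    [/\ root_system Phi, mx_faithful f,
        (forall a, a \in Phi -> exists w, f w = reflection_mx a) &
        <<[set w | has (fun a => f w == reflection_mx a) Phi]>>%g = [set: W]].

(* g acts on the cocharacter lattice Z^n (column vectors), hence on
   h = C (x) Z^n. *)
Definition is_reflection n (g : 'M[int]_n) : bool :=
  (g *m g == 1%:M) && (\rank (map_mx intr g - 1%:M : 'M[R[i]]_n) == 1%N).

Definition is_reflection_group (W : finGroupType) n
    (rho : mx_representation int [set: W] n) : Prop :=
  mx_faithful rho /\ <<[set w | is_reflection (rho w)]>>%g = [set: W].

End Weyl.

Section Tori.

Variable F : fieldType.

Record Gm := MkGm { Gm_val : F; Gm_neq0 : Gm_val != 0 }.
HB.instance Definition _ := [isSub for Gm_val].
HB.instance Definition _ := [Choice of Gm by <:].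

Definition Gm_one := MkGm (oner_neq0 F).
Definition Gm_mul (x y : Gm) := MkGm (mulf_neq0 (Gm_neq0 x) (Gm_neq0 y)).
Lemma Gm_inv_subproof (x : Gm) : (Gm_val x)^-1 != 0.
Proof. by rewrite invr_eq0 Gm_neq0. Qed.
Definition Gm_inv (x : Gm) := MkGm (Gm_inv_subproof x).

Lemma Gm_mulA : associative Gm_mul.
Proof. by move=> x y z; apply: val_inj; rewrite /= mulrA. Qed.
Lemma Gm_mul1 : left_id Gm_one Gm_mul.
Proof. by move=> x; apply: val_inj; rewrite /= mul1r. Qed.
Lemma Gm_mulr1 : right_id Gm_one Gm_mul.
Proof. by move=> x; apply: val_inj; rewrite /= mulr1. Qed.
Lemma Gm_mulV : left_inverse Gm_one Gm_inv Gm_mul.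
Proof. by move=> x; apply: val_inj; rewrite /= mulVf ?Gm_neq0. Qed.
Lemma Gm_mulVr : right_inverse Gm_one Gm_inv Gm_mul.
Proof. by move=> x; apply: val_inj; rewrite /= divff ?Gm_neq0. Qed.

HB.instance Definition _ :=
  isGroup.Build Gm Gm_mulA Gm_mul1 Gm_mulr1 Gm_mulV Gm_mulVr.

(* The torus with cocharacter lattice Z^n. *)
Definition torus n := {ffun 'I_n -> Gm}.

Lemma torus_hom_subproof m n (M : 'M[int]_(n, m)) (t : torus m) i :
  \prod_j Gm_val (t j) ^ M i j != 0.
Proof. by apply/prodf_neq0 => j _; rewrite expfz_neq0 // Gm_neq0. Qed.

(* The homomorphism of tori which is M on cocharacters. *)
Definition torus_hom m n (M : 'M[int]_(n, m)) (t : torus m) : torus n :=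
  [ffun i => MkGm (torus_hom_subproof M t i)].

Definition torus_row n (t : torus n) : 'rV[F]_n := \row_i Gm_val (t i).

End Tori.

HB.instance Definition _ (F : fieldType) n := Group.on (torus F n).

(* The k-th column of hd_alpha is the cocharacter alpha_k. *)
Record hypertoric_data (F : fieldType) n := HypertoricData {
  hd_size : nat;
  hd_alpha : 'M[int]_(n, hd_size);
  hd_lambda : 'rV[F]_hd_size }.

Section Hypertoric.

Variables (R : realType) (n : nat).
Local Notation C := R[i].

(* Points of C^{2d} x T x h^*; h^* consists of row vectors, paired with the
   column vectors of h by matrix multiplication. *)
Record ambient d := Ambient {
  a_u : 'rV[C]_d; a_v : 'rV[C]_d; a_t : torus C n; a_z : 'rV[C]_n }.

(* Regular functions on C^{2d} x T x h^* are written as polynomials in the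
   variables u_k, v_k, t_i, t_i^-1, z_i. *)
Definition nvars d := (d + d + (n + n + n))%N.
Definition ix_u d (k : 'I_d) : 'I_(nvars d) := lshift _ (lshift _ k).
Definition ix_v d (k : 'I_d) : 'I_(nvars d) := lshift _ (rshift _ k).
Definition ix_t d (i : 'I_n) : 'I_(nvars d) := rshift _ (lshift _ (lshift _ i)).
Definition ix_tV d (i : 'I_n) : 'I_(nvars d) := rshift _ (lshift _ (rshift _ i)).
Definition ix_z d (i : 'I_n) : 'I_(nvars d) := rshift _ (rshift _ i).

Definition coords d (x : ambient d) : 'I_(nvars d) -> C :=
  row_mx (row_mx (a_u x) (a_v x))
    (row_mx (row_mx (torus_row (a_t x)) (torus_row (a_t x)^-1%g)) (a_z x)) 0.

(* t_i d/dt_i, as a derivation of the polynomial ring above *)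
Definition euler d i (p : {mpoly C[nvars d]}) : {mpoly C[nvars d]} :=
  'X_(ix_t d i) * p^`M(ix_t d i) - 'X_(ix_tV d i) * p^`M(ix_tV d i).

(* The Poisson bracket of the symplectic form
   sum_k du_k /\ dv_k + sum_i dz_i /\ dt_i / t_i. The sign of the second term
   is the one for which u_k v_k - <alpha_k, z> is a moment map for the k-th
   factor of T^d acting as in bigact below. *)
Definition ambient_bracket d (p q : {mpoly C[nvars d]}) : {mpoly C[nvars d]} :=
  \sum_(k < d) (p^`M(ix_u k) * q^`M(ix_v k) - p^`M(ix_v k) * q^`M(ix_u k))
  + \sum_(i < n) (p^`M(ix_z d i) * euler i q - euler i p * q^`M(ix_z d i)).

Variable X : hypertoric_data C n.
Local Notation d := (hd_size X).

Definition pairing (z : 'rV[C]_n) (a : 'cV[C]_n) : C := (z *m a) 0 0.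
Definition hd_coch (k : 'I_d) : 'cV[int]_n := col k (hd_alpha X).

Definition bigact (s : torus C d) (x : ambient d) : ambient d :=
  Ambient (\row_k (Gm_val (s k) * a_u x 0 k))
    (\row_k ((Gm_val (s k))^-1 * a_v x 0 k))
    (torus_hom (hd_alpha X) s * a_t x)%g (a_z x).

Definition translate (tau : torus C n) (x : ambient d) : ambient d :=
  Ambient (a_u x) (a_v x) (tau * a_t x)%g (a_z x).

Definition in_level (x : ambient d) : Prop :=
  forall k, a_u x 0 k * a_v x 0 k + hd_lambda X 0 k
            = pairing (a_z x) (map_mx intr (hd_coch k)).

Record level := Level { level_val :> ambient d; levelP : in_level level_val }.

Lemma bigact_subproof s (x : level) : in_level (bigact s x).
Proof.
by move=> k; rewrite !mxE mulrACA divff ?Gm_neq0 // mul1r (levelP x).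
Qed.
Definition level_bigact s x : level := Level (bigact_subproof s x).

Lemma translate_subproof tau (x : level) : in_level (translate tau x).
Proof. exact: (levelP x). Qed.
Definition level_translate tau x : level := Level (translate_subproof tau x).

(* C[X] = C[Z_lambda]^{T^d}, as an algebra of functions on Z_lambda (which is
   a reduced scheme, so its coordinate ring embeds in functions on its points) *)
Definition regular (f : level -> C) : Prop :=
  exists p : {mpoly C[nvars d]}, forall x : level, f x = p.@[coords x].
Definition invariant (f : level -> C) : Prop :=
  forall s x, f (level_bigact s x) = f x.
Definition coord_pred : {pred level -> C} :=
  fun f => `[< regular f /\ invariant f >].

Lemma coord_subring : subring_closed coord_pred.
Proof.
split.
- apply/asboolP; split=> //; by exists 1 => x; rewrite rmorph1.
- move=> f g /asboolP[[p hp] hf] /asboolP[[q hq] hg]; apply/asboolP; split.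
    by exists (p - q) => x; rewrite rmorphB /= -hp -hq.
  by move=> s x; rewrite /= -[LHS]/(f _ - g _) hf hg.
- move=> f g /asboolP[[p hp] hf] /asboolP[[q hq] hg]; apply/asboolP; split.
    by exists (p * q) => x; rewrite rmorphM /= -hp -hq.
  by move=> s x; rewrite /= -[LHS]/(f _ * g _) hf hg.
Qed.

Record coord_ring := CoordRing { cr_val :> level -> C; _ : coord_pred cr_val }.
HB.instance Definition _ := [isSub for cr_val].
HB.instance Definition _ := [Choice of coord_ring by <:].
HB.instance Definition _ := GRing.SubChoice_isSubComPzRing.Build
  (level -> C) coord_pred coord_ring coord_subring.

Lemma level_point_subproof :
  in_level (Ambient (const_mx 1) (- hd_lambda X) 1%g 0).
Proof. by move=> k; rewrite /pairing mul0mx !mxE mul1r addNr. Qed.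
Lemma coord_ring_oner_neq0 : 1 != 0 :> coord_ring.
Proof.
apply/eqP => /(congr1 (fun f : coord_ring => f (Level level_point_subproof))).
by move/eqP; rewrite -[X in X == _]/(1 : C) -[X in _ == X]/(0 : C) oner_eq0.
Qed.
HB.instance Definition _ :=
  GRing.PzSemiRing_isNonZero.Build coord_ring coord_ring_oner_neq0.

Lemma coord_scale_subproof (c : C) (f : coord_ring) :
  coord_pred (fun x => c * f x).
Proof.
case: f => f /= /asboolP[[p hp] hf]; apply/asboolP; split.
  by exists (c *: p) => x; rewrite mevalZ -hp.
by move=> s x; rewrite hf.
Qed.
Definition coord_scale c f := CoordRing (coord_scale_subproof c f).

Lemma coord_scaleA a b f : coord_scale a (coord_scale b f) = coord_scale (a * b) f.
Proof. by apply: val_inj; apply/funext => x /=; rewrite mulrA. Qed.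
Lemma coord_scale1 : left_id 1 coord_scale.
Proof. by move=> f; apply: val_inj; apply/funext => x /=; rewrite mul1r. Qed.
Lemma coord_scaleDr : right_distributive coord_scale +%R.
Proof. by move=> a f g; apply: val_inj; apply/funext => x; exact: mulrDr. Qed.
Lemma coord_scaleDl f : {morph coord_scale^~ f : a b / a + b}.
Proof. by move=> a b; apply: val_inj; apply/funext => x; exact: mulrDl. Qed.
HB.instance Definition _ := GRing.Zmodule_isLmodule.Build C coord_ring
  coord_scaleA coord_scale1 coord_scaleDr coord_scaleDl.
Lemma coord_scaleAl (a : C) (f g : coord_ring) : a *: (f * g) = a *: f * g.
Proof. by apply: val_inj; apply/funext => x; exact: mulrA. Qed.
HB.instance Definition _ :=
  GRing.LSemiModule_isLSemiAlgebra.Build C coord_ring coord_scaleAl.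
HB.instance Definition _ := GRing.Lalgebra_isComAlgebra.Build C coord_ring.

(* h is the bracket of f and g: the bracket of T^d-invariant functions
   p and q on the ambient space which extend f and g, restricted to Z_lambda.
   Such extensions exist and h does not depend on them. *)
Definition is_poisson_bracket (f g h : coord_ring) : Prop :=
  exists p q : {mpoly C[nvars d]},
    [/\ (forall s x, p.@[coords (bigact s x)] = p.@[coords x]),
        (forall s x, q.@[coords (bigact s x)] = q.@[coords x]),
        (forall x : level, f x = p.@[coords x]),
        (forall x : level, g x = q.@[coords x]) &
        forall x : level, h x = (ambient_bracket p q).@[coords x]].

Definition preserves_poisson (phi : coord_ring -> coord_ring) : Prop :=
  forall f g h, is_poisson_bracket f g h ->
    is_poisson_bracket (phi f) (phi g) (phi h).

Lemma moment_subproof (a : 'cV[C]_n) :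
  coord_pred (fun x : level => pairing (a_z x) a).
Proof.
apply/asboolP; split=> [|s x //].
exists (\sum_i a i 0 *: 'X_(ix_z d i)) => x.
rewrite /pairing mxE raddf_sum; apply: eq_bigr => i _.
by rewrite /= mevalZ mevalXU /coords /ix_z !row_mxEr mulrC.
Qed.
(* z |-> <a, z>, i.e. the pullback by mu of the linear function a in h *)
Definition moment (a : 'cV[C]_n) : coord_ring := CoordRing (moment_subproof a).

(* An action of T x| W on X is encoded by the action (x . f) y = f (x^-1 . y)
   on the coordinate ring. As mu (w y) = w (mu y), the function <a, mu> is sent
   by w to <a, w^-1 mu> = <w a, mu>. *)
Definition W_invariant (W : finGroupType)
    (rho : mx_representation int [set: W] n) : Prop :=
  exists act : torus C n -> W -> {lrmorphism coord_ring -> coord_ring},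
    [/\ (forall tau f x, act tau 1%g f x = f (level_translate tau^-1%g x)),
        (forall tau tau' w w' f,
            act (tau * torus_hom (rho w) tau')%g (w * w')%g f
            = act tau w (act tau' w' f)),
        (forall w, preserves_poisson (act 1%g w)) &
        forall w a, act 1%g w (moment a) = moment (map_mx intr (rho w) *m a)].

End Hypertoric.

Section Multiarrangements.

Variables (R : realType) (n : nat).
Local Notation C := R[i].

(* For a != 0, the largest integer dividing a in Z^n. *)
Definition divisibility (a : 'cV[int]_n) : nat := \big[gcdn/0%N]_i `|a i 0%R|%N.
Definition primitive (a : 'cV[int]_n) : Prop := divisibility a = 1%N.

Definition hyperplane (a : 'cV[int]_n) (c : C) : set 'rV[C]_n :=
  [set z | pairing z (map_mx intr a) = c]%classic.
Definition normal_to (H : set 'rV[C]_n) (a : 'cV[int]_n) : Prop :=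
  a != 0 /\ exists c, H = hyperplane a c.

Record multiarrangement := Multiarrangement {
  ma_size : nat;
  ma_hyp : 'I_ma_size -> set 'rV[C]_n;
  ma_mult : 'I_ma_size -> nat;
  ma_integral : forall k, exists a, normal_to (ma_hyp k) a;
  ma_distinct : injective ma_hyp;
  ma_mult_gt0 : forall k, (0 < ma_mult k)%N }.

Definition multiplicity (A : multiarrangement) (H : set 'rV[C]_n) : nat :=
  (\sum_(k < ma_size A | `[< ma_hyp k = H >]) ma_mult k)%N.

Definition is_multiarrangement_of (X : hypertoric_data C n)
    (A : multiarrangement) : Prop :=
  forall H, multiplicity A H =
    (\sum_(k < hd_size X | (hd_coch k != 0%R) &&
              `[< hyperplane (hd_coch k) (hd_lambda X 0%R k) = H >])
       divisibility (hd_coch k))%N.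

Variables (W : finGroupType) (rho : mx_representation int [set: W] n).

(* The dual action on h^*: <a, w z> = <w^-1 a, z>. *)
Definition dual_act (w : W) (z : 'rV[C]_n) : 'rV[C]_n :=
  z *m map_mx intr (rho w^-1%g).

Definition multiarrangement_invariant (A : multiarrangement) : Prop :=
  forall w H, multiplicity A (dual_act w @` H)%classic = multiplicity A H.

End Multiarrangements.

Section Cohomology.

Variables (G : finGroupType) (A : groupType) (act : G -> A -> A).
Local Open Scope group_scope.

Definition cohomologous (f f' : G -> G -> A) : Prop :=
  exists b : G -> A, forall x y,
    f x y = b x * act x (b y) * (b (x * y))^-1 * f' x y.

(* Cohomology classes are sets of 2-cocycles. *)
Definition H2_class (f : G -> G -> A) : set (G -> G -> A) :=
  [set f' | cohomologous f' f]%classic.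
Definition H2_trivial : set (G -> G -> A) := H2_class (fun _ _ => 1).

End Cohomology.

Section SignedPermutations.

Variables (R : realType) (d : nat).
Local Notation C := R[i].

(* W_d, acting on the cocharacter lattice Z^d of (C^* )^d *)
Definition signed_perm (g : 'M[int]_d) : Prop :=
  exists (sigma : 'S_d) (e : 'I_d -> bool),
    g = \matrix_(j, k) ((-1) ^+ e k *+ (j == sigma k)).

(* (C^* )^d as a subgroup of Sp_{2d}(C), acting on column vectors (u; v) *)
Definition torus_mx (s : torus C d) : 'M[C]_(d + d) :=
  block_mx (diag_mx (torus_row s)) 0 0 (diag_mx (torus_row s^-1%g)).

Inductive tildeW : 'M[C]_(d + d) -> Prop :=
| tildeW_perm (sigma : 'S_d) :
    tildeW (block_mx (perm_mx sigma) 0 0 (perm_mx sigma))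
| tildeW_rot (j : 'I_d) :
    tildeW (block_mx (1%:M - delta_mx j j) (- delta_mx j j)
                     (delta_mx j j) (1%:M - delta_mx j j))
| tildeW_one : tildeW 1%:M
| tildeW_mul M N : tildeW M -> tildeW N -> tildeW (M *m N)
| tildeW_inv M : tildeW M -> tildeW (invmx M).

(* The projection from tildeW to W_d: M maps to g when conjugation by M induces
   g on the cocharacter lattice of the torus. *)
Definition lies_over (M : 'M[C]_(d + d)) (g : 'M[int]_d) : Prop :=
  forall s, M *m torus_mx s = torus_mx (torus_hom g s) *m M.

(* c is the 2-cocycle of W_d with values in {+1, -1}^d attached to a section of
   tildeW -> W_d; these cocycles form the class [c_d]. *)
Definition represents_cd (c : 'M[int]_d -> 'M[int]_d -> torus C d) : Prop :=
  exists sec : 'M[int]_d -> 'M[C]_(d + d),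
    (forall g, signed_perm g -> tildeW (sec g) /\ lies_over (sec g) g) /\
    (forall g h, signed_perm g -> signed_perm h ->
       (c g h * c g h)%g = 1%g /\
       torus_mx (c g h) = sec g *m sec h *m invmx (sec (g *m h))).

End SignedPermutations.

Section Obstruction.

Variables (R : realType) (n : nat) (W : finGroupType).
Local Notation C := R[i].
Variables (rho : mx_representation int [set: W] n) (A : multiarrangement R n).
Variable omega : 'I_(ma_size A) -> 'cV[int]_n.
Local Notation d := (ma_size A).

Definition primitive_normals : Prop :=
  forall k, primitive (omega k) /\ normal_to (ma_hyp k) (omega k).

(* Column k is phi(w) e_k; it is a signed permutation when (A, m) is
   W-invariant. *)
Definition phi (w : W) : 'M[int]_d :=
  \matrix_(j, k)
    if `[< (dual_act rho w @` ma_hyp k)%classic = ma_hyp j >] then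
      if rho w *m omega k == omega j then 1
      else if rho w *m omega k == - omega j then -1 else 0
    else 0.

Definition arr_alpha : 'M[int]_(n, d) :=
  \matrix_(i, k) (omega k i 0 *+ ma_mult k).

Definition obstruction : set (W -> W -> torus C n) :=
  [set f | exists2 c, represents_cd c &
     H2_class (fun w => torus_hom (rho w))
       (fun x y => torus_hom arr_alpha (c (phi x) (phi y))) f]%classic.

Definition trivial_class : set (W -> W -> torus C n) :=
  H2_trivial (fun w => torus_hom (rho w)).

End Obstruction.

(* Main.v *)
From HB Require Import structures.
Require Import Defs.
From mathcomp Require Import all_boot all_order all_algebra all_fingroup all_character.
From mathcomp Require Import boolp classical_sets functions reals complex mpoly.
From mathcomp Require Import ring.

Set Implicit Arguments.
Unset Strict Implicit.
Unset Printing Implicit Defensive.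

Import Order.TTheory GRing.Theory Num.Theory.
Local Open Scope ring_scope.

(* Restriction to a slice of the T^d-orbits embeds C[X], as a Poisson algebra,
   in the functions on T x h^*, as the sums of terms t^xi g(z) Q_xi(z) with
   Q_xi = prod_H f_H^(m_H (xi_H)_+), f_H = <omega_H, z> - lambda_H,
   xi_H = <xi, omega_H>, a_+ = max(a, 0).
   An extension of the action to T x| W sends x_xi = t^xi Q_xi to a scalar
   multiple c_w(xi) of x_(w xi).  Comparing orders of vanishing in the image
   of x_xi x_(-xi) = prod_H f_H^(m_H |xi_H|) shows that the multiarrangement is
   invariant; then c_w(xi) times a sign is multiplicative in xi, hence given by
   a point b_w of T, and the composition law says that the b_w split the
   cocycle defining o(A, m).  Conversely, a splitting b defines the action by
   (t, z) |-> (b_w alpha(y_w(z)) w^-1 t, w^-1 z), where y_w(z) has H-component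
   1 / f_(wH)(z) if w omega_H = - omega_(wH) and 1 otherwise; this birational
   symplectic map preserves the image of C[X]. *)

(** * Characters of tori *)

(** Why the map is symplectic: in z' = w^-1 z the exponent of alpha(y_w) is the gradient of the sum
    of m_k (g_k log g_k - g_k), g_k = - f_k, over the k whose normal w reverses. So w is corrected
    by a fibre translation along a closed form, and [twist_log_sym] is the symmetry of the Hessian.
    Why signs obstruct: if w' reverses omega_H and w reverses omega_(w'H), the successive factors 1
    / f_(w'H)(w^-1 z) and f_(ww'H)(z) multiply to -1, as f_(w'H)(w^-1 z) = - f_(ww'H)(z), while
    y_(ww') has component 1. This -1 is the square of the rotation (u, v) -> (-v, u). What shapes
    the proof: functions on T x h^* are given by finite lists of terms, which are not unique.
    Independence of characters makes coefficients, derivatives and brackets depend on the function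
    alone. The twist has poles, so identities are checked where a nonzero polynomial does not vanish
    and are then extended by uniqueness. *)

(** Dedekind's argument: translating the relation by [y] and subtracting [ch i0 y] times the
    original removes the term of [i0] and multiplies that of [i] by [ch i y - ch i0 y], which is
    nonzero for a suitable [y]. *)
Lemma characters_independent (F : fieldType) (I : eqType) (T : Type)
    (mul : T -> T -> T) (one : T) (ch : I -> T -> F) (a : I -> F) (s : seq I) :
  (forall i x y, ch i (mul x y) = ch i x * ch i y) ->
  (forall i, ch i one = 1) ->
  {in s &, forall i j, i != j -> exists x, ch i x != ch j x} ->
  uniq s -> (forall x, \sum_(i <- s) a i * ch i x = 0) ->
  {in s, forall i, a i = 0}.
Proof.
move=> chM ch1; elim: s a => [|i0 s IH] a //= sep /andP[i0s us] Z.
have sepW : {in s &, forall i j, i != j -> exists x, ch i x != ch j x}.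
  by move=> i j si sj; apply: sep; rewrite inE ?si ?sj orbT.
have as0 : {in s, forall i, a i = 0}.
  move=> i si.
  have ne : i != i0 by apply: contraNneq i0s => <-.
  have [|y hy] := sep i i0 _ (mem_head _ _) ne; first by rewrite inE si orbT.
  have := IH (fun i => a i * (ch i y - ch i0 y)) sepW us.
  have Z' : forall x, \sum_(i <- s) a i * (ch i y - ch i0 y) * ch i x = 0.
    move=> x; transitivity (\sum_(i <- i0 :: s) a i * ch i (mul y x)
        - ch i0 y * \sum_(i <- i0 :: s) a i * ch i x); last first.
      by rewrite !Z mulr0 subrr.
    rewrite !big_cons /= mulrDr opprD addrACA chM.
    rewrite [X in _ = X + _](_ : _ = 0) ?add0r; last by ring.
    rewrite big_distrr -sumrB /=; apply: eq_bigr => j _; rewrite chM; ring.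
  by move=> /(_ Z' i si) /eqP; rewrite mulf_eq0 subr_eq0 (negbTE hy) orbF => /eqP.
move=> i; rewrite inE => /orP[/eqP->|]; last exact: as0.
have := Z one; rewrite big_cons big1_seq ?addr0 ?ch1 ?mulr1 // => j /= sj.
by rewrite as0 ?mul0r.
Qed.

Section Torus.

Variable F : fieldType.

Definition chi n (xi : 'rV[int]_n) (t : torus F n) : F :=
  \prod_i Gm_val (t i) ^ xi 0 i.

Lemma torus_eqP n (s t : torus F n) : (forall i, Gm_val (s i) = Gm_val (t i)) -> s = t.
Proof. by move=> h; apply/ffunP => i; apply: val_inj; exact: h. Qed.

Lemma torusM n (s t : torus F n) i :
  Gm_val ((s * t)%g i) = Gm_val (s i) * Gm_val (t i).
Proof. by rewrite ffunE. Qed.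

Lemma torusV n (t : torus F n) i : Gm_val (t^-1%g i) = (Gm_val (t i))^-1.
Proof. by rewrite ffunE. Qed.

Lemma torus1 n i : Gm_val ((1%g : torus F n) i) = 1.
Proof. by rewrite ffunE. Qed.

Lemma torus_mulC n : commutative (fun s t : torus F n => (s * t)%g).
Proof. by move=> s t; apply: torus_eqP => i; rewrite !torusM mulrC. Qed.

Lemma chiM n xi (s t : torus F n) : chi xi (s * t)%g = chi xi s * chi xi t.
Proof.
by rewrite -big_split /=; apply: eq_bigr => i _; rewrite torusM expfzMl.
Qed.

Lemma chi1 n xi : chi xi (1%g : torus F n) = 1.
Proof. by rewrite /chi big1 // => i _; rewrite torus1 exp1rz. Qed.

Lemma chi_neq0 n xi (t : torus F n) : chi xi t != 0.
Proof. by apply/prodf_neq0 => i _; rewrite expfz_neq0 // Gm_neq0. Qed.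

Lemma chiV n xi (t : torus F n) : chi xi t^-1%g = (chi xi t)^-1.
Proof.
apply: (mulfI (chi_neq0 xi t)); rewrite -chiM mulgV chi1 divff //.
exact: chi_neq0.
Qed.

Lemma chi0 n (t : torus F n) : chi 0 t = 1.
Proof. by rewrite /chi big1 // => i _; rewrite mxE expr0z. Qed.

Lemma chiD n xi eta (t : torus F n) : chi (xi + eta) t = chi xi t * chi eta t.
Proof.
by rewrite -big_split /=; apply: eq_bigr => i _; rewrite mxE expfzDr // Gm_neq0.
Qed.

Lemma chi_delta n i (t : torus F n) : chi (delta_mx 0 i) t = Gm_val (t i).
Proof.
rewrite /chi (bigD1 i) //= mxE !eqxx expr1z big1 ?mulr1 // => j ne.
by rewrite mxE (negbTE ne) andbF expr0z.
Qed.

Lemma chi_inj n (s t : torus F n) : (forall xi, chi xi s = chi xi t) -> s = t.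
Proof. by move=> h; apply: torus_eqP => i; rewrite -!chi_delta. Qed.

Lemma torus_homE m n (M : 'M[int]_(n, m)) (t : torus F m) i :
  Gm_val (torus_hom M t i) = chi (row i M) t.
Proof. by rewrite ffunE /=; apply: eq_bigr => j _; rewrite mxE. Qed.

Lemma chi_sum n (I : Type) (r : seq I) (f : I -> 'rV[int]_n) (t : torus F n) :
  chi (\sum_(i <- r) f i) t = \prod_(i <- r) chi (f i) t.
Proof. by elim/big_rec2: _ => [|i y x _ <-]; rewrite ?chi0 ?chiD. Qed.

Lemma chi_scale n k xi (t : torus F n) : chi (k *: xi) t = chi xi t ^ k.
Proof.
rewrite /chi; elim/big_rec2: _ => [|i y x _ ->]; first by rewrite exp1rz.
by rewrite expfzMl mxE [k * _]mulrC exprz_exp.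
Qed.

Lemma chi_hom m n (M : 'M[int]_(n, m)) xi (t : torus F m) :
  chi xi (torus_hom M t) = chi (xi *m M) t.
Proof.
rewrite mulmx_sum_row chi_sum; apply: eq_bigr => i _.
by rewrite torus_homE chi_scale.
Qed.

Lemma torus_homM m n (M : 'M[int]_(n, m)) (s t : torus F m) :
  torus_hom M (s * t)%g = (torus_hom M s * torus_hom M t)%g.
Proof. by apply: chi_inj => xi; rewrite !(chiM, chi_hom). Qed.

Lemma torus_hom1 m n (M : 'M[int]_(n, m)) :
  torus_hom M (1%g : torus F m) = 1%g.
Proof. by apply: chi_inj => xi; rewrite chi_hom !chi1. Qed.

Lemma torus_homV m n (M : 'M[int]_(n, m)) (t : torus F m) :
  torus_hom M t^-1%g = (torus_hom M t)^-1%g.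
Proof. by apply: chi_inj => xi; rewrite !(chiV, chi_hom). Qed.

Lemma torus_hom_mul m n p (M : 'M[int]_(n, m)) (N : 'M[int]_(m, p))
    (t : torus F p) : torus_hom M (torus_hom N t) = torus_hom (M *m N) t.
Proof. by apply: chi_inj => xi; rewrite !chi_hom mulmxA. Qed.

Lemma torus_hom_id n (t : torus F n) : torus_hom 1%:M t = t.
Proof. by apply: chi_inj => xi; rewrite !chi_hom mulmx1. Qed.

(** Duality between the torus and its character lattice: the coordinates of the point are the values
    of [g] on the standard basis. *)
Lemma chi_represent n (g : 'rV[int]_n -> F) :
  (forall xi, g xi != 0) -> (forall xi eta, g (xi + eta) = g xi * g eta) ->
  exists t : torus F n, forall xi, chi xi t = g xi.
Proof.
move=> g0 gD; exists [ffun i => MkGm (g0 (delta_mx 0 i))] => xi.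
have g00 : g 0 = 1.
  by apply: (mulfI (g0 0)); rewrite mulr1 -gD addr0.
have gN x : g (- x) = (g x)^-1.
  by apply: (mulfI (g0 x)); rewrite -gD subrr divff.
have gn k x : g (x *+ k) = g x ^+ k.
  by elim: k => [|k IH]; rewrite ?mulr0n ?g00 // mulrS gD IH exprS.
have gZ k x : g (k *: x) = g x ^ k.
  case: k => k; first by rewrite -[Posz k]natz scaler_nat gn natz.
  have -> : Negz k *: x = - (x *+ k.+1) by rewrite NegzE scaleNr -natz scaler_nat.
  by rewrite gN gn.
rewrite {2}[xi]row_sum_delta.
have -> : g (\sum_j xi 0 j *: delta_mx 0 j) = \prod_j g (xi 0 j *: delta_mx 0 j).
  by elim/big_rec2: _ => [|i y x _ <-]; rewrite ?g00 ?gD.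
by apply: eq_bigr => j _; rewrite ffunE gZ.
Qed.

End Torus.

(** The witness has coordinate 2 at an index where the exponents differ and 1 elsewhere; in
    characteristic zero 2 has infinite order. *)
Lemma chi_separates (F : numFieldType) n (xi eta : 'rV[int]_n) :
  xi != eta -> exists t : torus F n, chi xi t != chi eta t.
Proof.
move=> ne; have [i hi] : exists i, xi 0 i != eta 0 i.
  apply/existsP; apply: contraNT ne => /existsPn h.
  by apply/eqP/rowP => i; have := h i; rewrite negbK => /eqP.
have two : (2 : F) != 0 by rewrite pnatr_eq0.
exists [ffun j => if j == i then MkGm two else 1%g].
have E z : chi z [ffun j => if j == i then MkGm two else 1%g] = 2 ^ z 0 i.
  rewrite /chi (bigD1 i) //= ffunE eqxx big1 ?mulr1 // => j /negbTE ji.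
  by rewrite ffunE ji exp1rz.
rewrite !E -subr_eq0; apply: contraNneq hi => /eqP; rewrite subr_eq0.
move/eqP => h; have : (2 : F) ^ (xi 0 i - eta 0 i) = 1.
  by rewrite expfzDr // h -expfzDr // subrr expr0z.
by move/eqP; rewrite pexprz_eq1 ?ler0n // pnatr_eq1 orbF subr_eq0.
Qed.

Lemma big_by_key (V : nmodType) (I K : eqType) (l : seq I) (key : I -> K) (f : I -> V) :
  \sum_(i <- l) f i = \sum_(x <- undup (map key l)) \sum_(i <- l | key i == x) f i.
Proof.
rewrite (exchange_big_dep predT) //= big_seq [RHS]big_seq.
apply: eq_bigr => i li; rewrite (big_rem (key i)) /=; last first.
  by rewrite mem_undup map_f.
rewrite eqxx big1_seq ?addr0 // => x /andP[/eqP <-].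
by rewrite mem_rem_uniq ?undup_uniq // !inE eqxx.
Qed.

(* A finite sum of characters determines the coefficient of each of them, hence
   any reweighting of the sum. *)
Lemma chi_sum_eq0 (F : numFieldType) n (I : eqType) (l : seq I)
    (ch : I -> 'rV[int]_n) (a : I -> F) (h : 'rV[int]_n -> F) :
  (forall t : torus F n, \sum_(i <- l) a i * chi (ch i) t = 0) ->
  \sum_(i <- l) a i * h (ch i) = 0.
Proof.
move=> Z; have E (k : 'rV[int]_n -> F) : \sum_(i <- l) a i * k (ch i)
    = \sum_(x <- undup (map ch l)) (\sum_(i <- l | ch i == x) a i) * k x.
  rewrite (big_by_key _ ch); apply: eq_bigr => x _; rewrite big_distrl /=.
  by apply: eq_bigr => i /eqP ->.
rewrite E big_seq big1 // => x sx; apply/eqP; rewrite mulf_eq0; apply/orP; left.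
apply/eqP.
apply: (@characters_independent F _ (torus F n) (fun s t => (s * t)%g) 1%g
  (@chi F n) (fun x => \sum_(i <- l | ch i == x) a i) (undup (map ch l))) => //.
- by move=> i y z; rewrite chiM.
- by move=> i; rewrite chi1.
- by move=> i j _ _; exact: chi_separates.
- exact: undup_uniq.
- by move=> t; rewrite -E.
Qed.

(** At points with nonzero coordinates distinct monomials are distinct characters, whose
    independence isolates each coefficient. *)
Lemma mpoly_eval_inj (F : numFieldType) n (p : {mpoly F[n]}) :
  (forall v, p.@[v] = 0) -> p = 0.
Proof.
move=> Z; apply/mpolyP => m; rewrite mcoeff0.
pose ch (m : 'X_{1..n}) : 'rV[int]_n := \row_i (m i)%:Z.
have ch_inj : injective ch.
  move=> m1 m2 /rowP h; apply/mnmP => i.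
  by have := h i; rewrite !mxE => -[].
have := @chi_sum_eq0 F n _ (msupp p) ch (fun i => p@_i) (fun x => (x == ch m)%:R).
have [mp|/memN_msupp_eq0 //] := boolP (m \in msupp p).
rewrite (big_rem m) //= eqxx mulr1 big1_seq ?addr0 => [|j /=]; last first.
  by rewrite mem_rem_uniq ?msupp_uniq // inE (inj_eq ch_inj) => /andP[/negbTE ->];
     rewrite mulr0.
apply=> t; rewrite -[RHS](Z (fun i => Gm_val (t i))) mevalE.
by apply: eq_bigr => j _; congr (_ * _); apply: eq_bigr => i _; rewrite mxE.
Qed.

(** * Polynomials and Laurent polynomials *)

Lemma mpoly_ring_ind (F : comNzRingType) n (P : {mpoly F[n]} -> Prop) :
  (forall c, P c%:MP) -> (forall i, P 'X_i) ->
  (forall p q, P p -> P q -> P (p + q)) ->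
  (forall p q, P p -> P q -> P (p * q)) -> forall p, P p.
Proof.
move=> PC PX PD PM p; rewrite (mpolyE p).
apply: (@big_ind _ P) => [||m _]; [by rewrite -mpolyC0 | exact: PD |].
rewrite -mul_mpolyC; apply: (PM) => //; rewrite mpolyXE_id.
apply: (@big_ind _ P) => [||i _]; [exact: (PC 1) | exact: (PM) |].
elim: (m i) => [|k IH]; first exact: (PC 1).
by rewrite exprS; apply: PM.
Qed.

Lemma mderivXU (F : nzRingType) n (i j : 'I_n) :
  ('X_i : {mpoly F[n]})^`M(j) = (i == j)%:R.
Proof.
rewrite mderivX mnm1E; case: eqVneq => [->|_]; last by rewrite scale0r.
rewrite scale1r -mpolyX0; congr mpolyX; apply/mnmP => k.
by rewrite mnmBE subnn mnm0E.
Qed.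

Section Polynomials.

Variables (F : numFieldType) (n : nat).
Implicit Types (p q : {mpoly F[n]}) (v : 'I_n -> F) (z : 'rV[F]_n).

Lemma mderiv_comp (k : nat) (lq : k.-tuple {mpoly F[n]}) (p : {mpoly F[k]}) i :
  (p \mPo lq)^`M(i) = \sum_(j < k) (p^`M(j) \mPo lq) * (tnth lq j)^`M(i).
Proof.
elim/mpoly_ring_ind: p => [c|j|p q IHp IHq|p q IHp IHq].
- rewrite comp_mpolyC mderivC big1 // => j _.
  by rewrite mderivC comp_mpoly0 mul0r.
- rewrite comp_mpolyXU -tnth_nth (bigD1 j) //= mderivXU eqxx comp_mpoly1 mul1r.
  rewrite big1 ?addr0 // => l /negbTE jl.
  by rewrite mderivXU eq_sym jl comp_mpoly0 mul0r.
- rewrite comp_mpolyD mderivD IHp IHq -big_split; apply: eq_bigr => j _ /=.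
  by rewrite mderivD comp_mpolyD mulrDl.
- rewrite rmorphM /= mderivM IHp IHq big_distrl big_distrr -big_split /=.
  apply: eq_bigr => j _; rewrite mderivM comp_mpolyD !rmorphM /=; ring.
Qed.

Definition dlog p v i : F := p^`M(i).@[v] / p.@[v].

Lemma dlogM p q v i : p.@[v] != 0 -> q.@[v] != 0 ->
  dlog (p * q) v i = dlog p v i + dlog q v i.
Proof.
move=> p0 q0; rewrite /dlog mderivM !(rmorphM, rmorphD) /=; field.
by rewrite p0 q0.
Qed.

Lemma dlog_prodX (I : Type) (s : seq I) (f : I -> {mpoly F[n]}) (e : I -> nat) v i :
  (forall j, (f j).@[v] != 0) ->
  dlog (\prod_(j <- s) f j ^+ e j) v i = \sum_(j <- s) (e j)%:R * dlog (f j) v i.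
Proof.
move=> f0.
have X0 j k : (f j ^+ k).@[v] != 0 by rewrite rmorphXn /= expf_neq0.
have d1 : dlog 1 v i = 0 by rewrite /dlog -mpolyC1 mderivC meval0 mul0r.
have dX j k : dlog (f j ^+ k) v i = k%:R * dlog (f j) v i.
  elim: k => [|k IH]; first by rewrite mul0r.
  by rewrite exprS dlogM // IH -(natr1 k) mulrDl mul1r addrC.
elim: s => [|j s IH]; first by rewrite !big_nil.
rewrite !big_cons dlogM // ?IH ?dX // rmorph_prod.
elim: (s) => [|l r IHr]; first by rewrite big_nil oner_neq0.
by rewrite big_cons mulf_neq0 //; exact: X0.
Qed.

Lemma mpoly_row_eq0 p : (forall z, p.@[z 0] = 0) -> p = 0.
Proof.
move=> h; apply: mpoly_eval_inj => v; rewrite -[RHS](h (\row_i v i)).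
by apply: meval_eq => i; rewrite mxE.
Qed.

Lemma mpoly_row_inj p q : (forall z, p.@[z 0] = q.@[z 0]) -> p = q.
Proof.
move=> h; apply/eqP; rewrite -subr_eq0; apply/eqP/mpoly_row_eq0 => z.
by rewrite mevalB h subrr.
Qed.

Lemma generic_point (I : finType) (f : I -> {mpoly F[n]}) :
  (forall i, f i != 0) -> exists z : 'rV_n, forall i, (f i).@[z 0] != 0.
Proof.
move=> f0; have P0 : \prod_i f i != 0 by apply/prodf_neq0.
have [z hz] : exists z : 'rV_n, (\prod_i f i).@[z 0] != 0.
  apply/not_existsP => h; move/eqP: P0; apply; apply: mpoly_row_eq0 => z.
  by apply/eqP; apply: contra_notT (h z).
by exists z => i; move: hz; rewrite rmorph_prod => /prodf_neq0; apply.
Qed.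

Lemma mderiv_linear (c : 'I_n -> F) i : (\sum_j c j *: 'X_j)^`M(i) = (c i)%:MP_[n].
Proof.
rewrite raddf_sum (bigD1 i) //= mderivZ mderivXU eqxx.
rewrite big1 => [|j /negbTE ji]; last by rewrite mderivZ mderivXU ji scaler0.
by rewrite addr0 -mul_mpolyC mulr1.
Qed.

Definition affine (a : 'cV[F]_n) (c : F) : {mpoly F[n]} :=
  \sum_i a i 0 *: 'X_i - c%:MP.

Lemma affine_eval a c z : (affine a c).@[z 0] = (z *m a) 0 0 - c.
Proof.
rewrite rmorphB /= mevalC raddf_sum mxE; congr (_ - _); apply: eq_bigr => i _.
by rewrite /= mevalZ mevalXU mulrC.
Qed.

Lemma affine_deriv a c i : (affine a c)^`M(i) = (a i 0)%:MP.
Proof.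
by rewrite mderivB mderivC subr0 mderiv_linear.
Qed.

Lemma affine_neq0 a c : a != 0 -> affine a c != 0.
Proof.
apply: contra_neq => h; apply/matrixP => i j; rewrite ord1 mxE.
have := affine_deriv a c i; rewrite h mderiv0 => /(congr1 (meval (fun=> 0))).
by rewrite meval0 mevalC.
Qed.

Definition mlin (M : 'M[F]_n) : {mpoly F[n]} -> {mpoly F[n]} :=
  comp_mpoly [tuple \sum_i M i j *: 'X_i | j < n].
HB.instance Definition _ M := GRing.RMorphism.copy (mlin M) (mlin M).

Lemma mlin_eval M p z : (mlin M p).@[z 0] = p.@[(z *m M) 0].
Proof.
rewrite comp_mpoly_meval; apply: meval_eq => j; rewrite tnth_mktuple raddf_sum.
by rewrite mxE; apply: eq_bigr => i _; rewrite /= mevalZ mevalXU mulrC.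
Qed.

Lemma mlin_deriv M p i z :
  (mlin M p)^`M(i).@[z 0] = \sum_j M i j * p^`M(j).@[(z *m M) 0].
Proof.
rewrite mderiv_comp raddf_sum; apply: eq_bigr => j _ /=.
rewrite rmorphM /= [(p^`M(j) \mPo _).@[_]]mlin_eval mulrC; congr (_ * _).
by rewrite tnth_mktuple mderiv_linear mevalC.
Qed.

(* Lists of pairs (xi, g) represent the Laurent polynomial functions
   sum t^xi g(z) on T x h^*. *)
Definition laurent := seq ('rV[int]_n * {mpoly F[n]}).
Implicit Types l : laurent.

Definition lval l (t : torus F n) z : F := \sum_(x <- l) chi x.1 t * x.2.@[z 0].
Definition lderiv i l : laurent := [seq (x.1, x.2^`M(i)) | x : 'rV[int]_n * {mpoly F[n]} <- l].
Definition leuler i l : laurent :=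
  [seq (x.1, (x.1 0 i)%:~R *: x.2) | x : 'rV[int]_n * {mpoly F[n]} <- l].

(** Independence of characters at each fixed [z]. The free weight [h] serves both to isolate one
    character and to apply t_i d/dt_i. *)
Lemma lval_eq0 l (h : 'rV[int]_n -> F) :
  (forall t z, lval l t z = 0) -> \sum_(x <- l) h x.1 *: x.2 = 0.
Proof.
move=> Z; apply: mpoly_row_eq0 => z; rewrite raddf_sum /=.
under eq_bigr do rewrite mevalZ mulrC.
apply: (@chi_sum_eq0 F n _ l fst (fun x => x.2.@[z 0]) h) => t.
by rewrite -[RHS](Z t z); apply: eq_bigr => x _; rewrite mulrC.
Qed.

Lemma lval_cat l l' t z : lval (l ++ l') t z = lval l t z + lval l' t z.
Proof. by rewrite /lval big_cat. Qed.

Definition lopp l : laurent := [seq (x.1, - x.2) | x : 'rV[int]_n * {mpoly F[n]} <- l].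

Lemma lval_opp l t z : lval (lopp l) t z = - lval l t z.
Proof. by rewrite /lval big_map -sumrN; apply: eq_bigr => x _; rewrite mevalN mulrN. Qed.

Lemma lval_inj l l' (h : 'rV[int]_n -> F) :
  (forall t z, lval l t z = lval l' t z) ->
  \sum_(x <- l) h x.1 *: x.2 = \sum_(x <- l') h x.1 *: x.2.
Proof.
move=> E; have := @lval_eq0 (l ++ lopp l') h.
rewrite big_cat big_map /=; under [X in _ + X]eq_bigr do rewrite scalerN.
rewrite sumrN => Z; apply/eqP; rewrite -subr_eq0; apply/eqP; apply: Z => t z.
by rewrite lval_cat lval_opp E subrr.
Qed.

(** Needed because a function has many lists. With the weight [chi xi t], [t] fixed, the two sides
    are equal as polynomials in z and may be differentiated. *)
Lemma lderiv_inj i l l' : (forall t z, lval l t z = lval l' t z) ->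
  forall t z, lval (lderiv i l) t z = lval (lderiv i l') t z.
Proof.
move=> E t z; have := lval_inj (fun xi => chi xi t) E => /(congr1 (mderiv i)).
rewrite !(raddf_sum (mderiv i)) => /(congr1 (meval (z 0))).
rewrite !raddf_sum /lval !big_map /=.
by under eq_bigr do rewrite mderivZ mevalZ; under [in RHS]eq_bigr do rewrite mderivZ mevalZ.
Qed.

Lemma leuler_inj i l l' : (forall t z, lval l t z = lval l' t z) ->
  forall t z, lval (leuler i l) t z = lval (leuler i l') t z.
Proof.
move=> E t z; have := lval_inj (fun xi => chi xi t * (xi 0 i)%:~R) E.
move/(congr1 (meval (z 0))); rewrite !raddf_sum /lval !big_map /=.
by under eq_bigr do rewrite -scalerA mevalZ; under [in RHS]eq_bigr do rewrite -scalerA mevalZ.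
Qed.

(* The Poisson bracket of the symplectic form sum dz_i /\ dt_i / t_i. *)
Definition lbracket l l' t z : F :=
  \sum_i (lval (lderiv i l) t z * lval (leuler i l') t z
          - lval (leuler i l) t z * lval (lderiv i l') t z).

Lemma lbracket_eq l1 l1' l2 l2' :
  (forall t z, lval l1 t z = lval l1' t z) ->
  (forall t z, lval l2 t z = lval l2' t z) ->
  forall t z, lbracket l1 l2 t z = lbracket l1' l2' t z.
Proof.
move=> E1 E2 t z; apply: eq_bigr => i _.
by rewrite (lderiv_inj i E1) (lderiv_inj i E2) (leuler_inj i E1) (leuler_inj i E2).
Qed.

End Polynomials.

(** * Integral hyperplanes *)

Definition ppart (a : int) : nat := if a is Posz k then k else 0%N.

Lemma ppartB a : (ppart a)%:Z - (ppart (- a))%:Z = a.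
Proof.
case: a => [[|k]|k] /=; first by [].
  by rewrite subr0.
by rewrite NegzE sub0r.
Qed.

Lemma ppart_abs a : (ppart a + ppart (- a))%N = `|a|%N.
Proof.
case: a => [[|k]|k] /=; first by [].
  by rewrite addn0.
by rewrite add0n.
Qed.

Lemma ppartMn k a : ppart (k%:Z * a) = (k * ppart a)%N.
Proof.
case: a => j; first by rewrite -PoszM.
by rewrite /= muln0 NegzE mulrN -PoszM; case: (k * j.+1)%N.
Qed.

Lemma ppartBn (a b : nat) : ppart (a%:Z - b%:Z) = (a - b)%N.
Proof.
have [ab|/ltnW ba] := leqP b a; first by rewrite subzn.
rewrite -opprB subzn // (eqP ba).
by case: (b - a)%N.
Qed.

Section Normals.

Variable n : nat.
Implicit Types a b : 'cV[int]_n.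

(** For a primitive cocharacter this is a character of value 1 on it, the tool by which integrality
    and signs are detected below. *)
Lemma bezout_divisibility a : exists u : 'rV[int]_n, (u *m a) 0 0 = divisibility a.
Proof.
rewrite /divisibility; elim/big_rec: _ => [|i x _ [u hu]].
  by exists 0; rewrite mul0mx mxE.
have [p [q h]] := Bezoutz (a i 0) x.
exists (p *: delta_mx 0 i + q *: u).
rewrite mulmxDl -!scalemxAl !mxE [\sum_j u 0 j * _](_ : _ = x%:Z); last first.
  by rewrite -hu mxE.
rewrite (bigD1 i) //= big1 => [|j /negbTE ji]; last first.
  by rewrite mxE ji andbF mul0r.
by rewrite mxE !eqxx mul1r addr0 h /gcdz absz_nat.
Qed.

Lemma divisibilityZ k a : divisibility (k *: a) = (`|k| * divisibility a)%N.
Proof.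
rewrite /divisibility; elim/big_rec2: _ => [|i y x _ ->]; first by rewrite muln0.
by rewrite mxE abszM muln_gcdr.
Qed.

Lemma primitive_neq0 a : primitive a -> a != 0.
Proof.
move=> h; apply: contra_eq_neq h => ->.
by rewrite -(scale0r 0) divisibilityZ absz0.
Qed.

(** The vanishing minors give u(b) a = u(a) b for every character u; choosing u(b) = 1 makes the
    factor the integer u(a). *)
Lemma proportional_primitive a b : primitive b ->
  (forall i j, a i 0 * b j 0 = a j 0 * b i 0) -> exists k : int, a = k *: b.
Proof.
move=> pb h; have [u hu] := bezout_divisibility b; rewrite pb in hu.
exists ((u *m a) 0 0); apply/colP => j; rewrite [RHS]mxE mxE mulr_suml.
transitivity ((u *m b) 0 0 * a j 0); first by rewrite hu mul1r.
by rewrite mxE mulr_suml; apply: eq_bigr => i _; rewrite -!mulrA -h [b i 0 * _]mulrC -h.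
Qed.

End Normals.

Section Hyperplanes.

Variables (R : realType) (n : nat).
Local Notation C := R[i].
Implicit Types (a b : 'cV[int]_n) (z : 'rV[C]_n).

Lemma pairingDl z z' (a : 'cV[C]_n) : pairing (z + z') a = pairing z a + pairing z' a.
Proof. by rewrite /pairing mulmxDl mxE. Qed.

Lemma pairingZl c z (a : 'cV[C]_n) : pairing (c *: z) a = c * pairing z a.
Proof. by rewrite /pairing -scalemxAl mxE. Qed.

Lemma pairingZr z c (a : 'cV[C]_n) : pairing z (c *: a) = c * pairing z a.
Proof. by rewrite /pairing -scalemxAr mxE. Qed.

Lemma pairing_delta i (a : 'cV[C]_n) : pairing (delta_mx 0 i) a = a i 0.
Proof. by rewrite /pairing -rowE mxE. Qed.

Lemma map_intr_neq0 a : a != 0 -> (map_mx intr a : 'cV[C]_n) != 0.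
Proof.
apply: contra_neq => /colP h; apply/colP => i.
by have := h i; rewrite !mxE => /eqP; rewrite intr_eq0 => /eqP.
Qed.

Lemma map_intrZ k a : (map_mx intr (k *: a) : 'cV[C]_n) = k%:~R *: map_mx intr a.
Proof. by apply/colP => i; rewrite !mxE rmorphM. Qed.

Lemma pairing_surj a c : a != 0 -> exists z, pairing z (map_mx intr a : 'cV[C]_n) = c.
Proof.
move/map_intr_neq0 => a0.
have [i ai] : exists i, (map_mx intr a : 'cV[C]_n) i 0 != 0.
  apply/existsP; apply: contraNT a0 => /existsPn h; apply/eqP/colP => i.
  by rewrite [RHS]mxE; have := h i; rewrite negbK => /eqP.
exists ((c / (map_mx intr a : 'cV[C]_n) i 0) *: delta_mx 0 i).
by rewrite pairingZl pairing_delta divfK.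
Qed.

Lemma hyperplane_primitive a b (c c' : C) : primitive b -> a != 0 ->
  hyperplane a c = hyperplane b c' ->
  exists k : int, [/\ a = k *: b, c = k%:~R * c', k != 0 & divisibility a = `|k|%N].
Proof.
move=> pb a0 E.
have hE z : pairing z (map_mx intr a) = c <-> pairing z (map_mx intr b) = c'.
  by rewrite -[X in X <-> _]/(hyperplane a c z) E.
have [z0 hz0] := pairing_surj c' (primitive_neq0 pb).
have [|k Ek] := @proportional_primitive n a b pb.
  (* The vector b_j e_i - b_i e_j is tangent to the common hyperplane, so moving [z0] along it does
     not change the value of [a]: this is the minor. *)
  move=> i j; pose v : 'rV[C]_n := (b j 0)%:~R *: delta_mx 0 i - (b i 0)%:~R *: delta_mx 0 j.
  have Pv (x : 'cV[int]_n) : pairing v (map_mx intr x)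
      = (b j 0 * x i 0 - b i 0 * x j 0)%:~R :> C.
    by rewrite /v -scaleNr pairingDl !pairingZl !pairing_delta !mxE rmorphB !rmorphM mulNr.
  have : pairing (z0 + v) (map_mx intr a) = c.
    by apply/hE; rewrite pairingDl hz0 Pv mulrC subrr addr0.
  rewrite pairingDl (hE z0).2 // Pv -[RHS]addr0 => /addrI /eqP.
  by rewrite intr_eq0 subr_eq0 => /eqP; rewrite mulrC => ->; rewrite mulrC.
exists k; have k0 : k != 0 by apply: contraNneq a0 => k0; rewrite Ek k0 scale0r.
split=> //; last by rewrite Ek divisibilityZ pb muln1.
by move/hE: (hz0) => <-; rewrite Ek map_intrZ pairingZr hz0.
Qed.

Lemma hyperplaneZ (k : int) a (c : C) : k != 0 ->
  hyperplane (k *: a) (k%:~R * c) = hyperplane a c.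
Proof.
move=> k0; apply/seteqP; split=> z; rewrite /hyperplane /= map_intrZ pairingZr.
  by apply/mulfI; rewrite intr_eq0.
by move->.
Qed.

End Hyperplanes.

(** * Coordinate rings of hypertoric varieties *)

Section CoordRing.

Variables (R : realType) (n : nat) (X : hypertoric_data R[i] n).
Local Notation C := R[i].
Local Notation d := (hd_size X).
Local Notation N := (nvars n d).
Implicit Types (f g h : coord_ring X) (x : ambient R n d) (z : 'rV[C]_n).

Lemma crE f g : (forall x : level X, f x = g x) -> f = g.
Proof. by move=> h; apply: val_inj; apply/funext. Qed.
Lemma crD f g (x : level X) : (f + g) x = f x + g x. Proof. by []. Qed.
Lemma crM f g (x : level X) : (f * g) x = f x * g x. Proof. by []. Qed.
Lemma crZ c f (x : level X) : (c *: f) x = c * f x. Proof. by []. Qed.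
Lemma cr1 (x : level X) : (1 : coord_ring X) x = 1. Proof. by []. Qed.

Lemma coords_u x k : coords x (ix_u n k) = a_u x 0 k.
Proof. by rewrite /coords /ix_u !row_mxEl. Qed.
Lemma coords_v x k : coords x (ix_v n k) = a_v x 0 k.
Proof. by rewrite /coords /ix_v row_mxEl row_mxEr. Qed.
Lemma coords_t x i : coords x (ix_t d i) = Gm_val (a_t x i).
Proof. by rewrite /coords /ix_t row_mxEr !row_mxEl mxE. Qed.
Lemma coords_tV x i : coords x (ix_tV d i) = (Gm_val (a_t x i))^-1.
Proof. by rewrite /coords /ix_tV row_mxEr row_mxEl row_mxEr mxE torusV. Qed.
Lemma coords_z x i : coords x (ix_z d i) = a_z x 0 i.
Proof. by rewrite /coords /ix_z !row_mxEr. Qed.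

Lemma big_nvars (T : Type) (idx : T) (op : Monoid.com_law idx) (F : 'I_N -> T) :
  \big[op/idx]_j F j
  = op (\big[op/idx]_k op (F (ix_u n k)) (F (ix_v n k)))
       (\big[op/idx]_i op (op (F (ix_t d i)) (F (ix_tV d i))) (F (ix_z d i))).
Proof. by rewrite !big_split_ord /= !big_split. Qed.

Definition xweight (xi : 'rV[int]_n) (k : 'I_d) : int := (xi *m hd_alpha X) 0 k.

Definition tdeg (m : 'X_{1..N}) : 'rV[int]_n :=
  \row_i ((m (ix_t d i))%:Z - (m (ix_tV d i))%:Z).

(** The weight of a monomial under T^d; the last summand is there because T^d acts on T through
    alpha. *)
Definition weight (m : 'X_{1..N}) : 'rV[int]_d :=
  \row_k ((m (ix_u n k))%:Z - (m (ix_v n k))%:Z + xweight (tdeg m) k).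

Lemma monomial_eval m x : 'X_[m].@[coords x] = chi (tdeg m) (a_t x)
  * (\prod_k (a_u x 0 k ^+ m (ix_u n k) * a_v x 0 k ^+ m (ix_v n k))
     * \prod_i a_z x 0 i ^+ m (ix_z d i)).
Proof.
rewrite mevalX big_nvars /= [RHS]mulrCA; congr (_ * _).
  by apply: eq_bigr => k _; rewrite coords_u coords_v.
rewrite -big_split /=; apply: eq_bigr => i _.
rewrite coords_t coords_tV coords_z mxE expfzDr ?Gm_neq0 //.
by rewrite -exprnN exprVn.
Qed.

Lemma monomial_bigact m s x :
  'X_[m].@[coords (bigact s x)] = chi (weight m) s * 'X_[m].@[coords x].
Proof.
rewrite !monomial_eval /= chiM chi_hom.
have -> : weight m = \row_k ((m (ix_u n k))%:Z - (m (ix_v n k))%:Z)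
    + tdeg m *m hd_alpha X by apply/rowP => k; rewrite [LHS]mxE [RHS]mxE [X in _ = X + _]mxE.
rewrite chiD; set P := \prod_k _; set Z := \prod_k _; set P' := \prod_k _.
suff -> : P = chi (\row_k ((m (ix_u n k))%:Z - (m (ix_v n k))%:Z)) s * P' by ring.
rewrite /P -big_split /=; apply: eq_bigr => k _; rewrite !mxE.
by rewrite expfzDr ?Gm_neq0 // -exprnN !exprMn exprVn mulrACA.
Qed.

(* The weight zero part of a polynomial carries all values of an invariant
   function, and any reweighting h of its homogeneous parts is h 0 times it. *)
Lemma invariant_reweight (p : {mpoly C[N]}) x (h : 'rV[int]_d -> C) :
  (forall s, p.@[coords (bigact s x)] = p.@[coords x]) ->
  \sum_(m <- msupp p) p@_m * 'X_[m].@[coords x] * h (weight m)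
  = h 0 * p.@[coords x].
Proof.
move=> inv.
have := @chi_sum_eq0 C d (option 'X_{1..N}) (None :: map Some (msupp p))
  (oapp weight 0) (oapp (fun m => p@_m * 'X_[m].@[coords x]) (- p.@[coords x])) h.
rewrite big_cons big_map /= => H; apply/eqP.
rewrite -subr_eq0 addrC [h 0 * _]mulrC -mulNr; apply/eqP/H => s.
rewrite big_cons big_map /= chi0 mulr1 addrC; apply/eqP; rewrite subr_eq0.
apply/eqP; rewrite -(inv s) [in RHS](mpolyE p) raddf_sum /=; apply: eq_bigr => m _.
by rewrite mevalZ (monomial_bigact m s x) [chi _ s * _]mulrC mulrA.
Qed.

(* The generators of weight xi under T. *)
Definition xmono (xi : 'rV[int]_n) x : C := chi xi (a_t x)
  * \prod_k (a_v x 0 k ^+ ppart (xweight xi k) * a_u x 0 k ^+ ppart (- xweight xi k)).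

Definition xpoly (xi : 'rV[int]_n) : {mpoly C[N]} :=
  \prod_i ('X_(ix_t d i) ^+ ppart (xi 0 i) * 'X_(ix_tV d i) ^+ ppart (- xi 0 i))
  * \prod_k ('X_(ix_v n k) ^+ ppart (xweight xi k)
             * 'X_(ix_u n k) ^+ ppart (- xweight xi k)).

Lemma expz_ppart (F : fieldType) (a : F) (k : int) :
  a != 0 -> a ^ k = a ^+ ppart k / a ^+ ppart (- k).
Proof. by move=> a0; rewrite -{1}[k]ppartB expfzDr // -exprnN. Qed.

Lemma xpoly_eval xi x : (xpoly xi).@[coords x] = xmono xi x.
Proof.
rewrite rmorphM !rmorph_prod /=; congr (_ * _); apply: eq_bigr => i _.
  rewrite !(rmorphM, rmorphXn) /= !mevalXU coords_t coords_tV.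
  by rewrite (expz_ppart _ (Gm_neq0 _)) exprVn.
by rewrite !(rmorphM, rmorphXn) /= !mevalXU coords_u coords_v.
Qed.

Lemma xmono_bigact xi s x : xmono xi (bigact s x) = xmono xi x.
Proof.
rewrite /xmono /= chiM chi_hom [chi (xi *m _) _ * _]mulrC -mulrA; congr (_ * _).
rewrite -big_split /=; apply: eq_bigr => k _; rewrite -/(xweight xi k) !mxE.
rewrite (expz_ppart _ (Gm_neq0 _)) !exprMn exprVn.
have H (a b v u : C) : a != 0 -> b != 0 -> a / b * (a^-1 * v * (b * u)) = v * u.
  by move=> a0 b0; field; rewrite a0.
by apply: H; rewrite expf_neq0 // Gm_neq0.
Qed.

Definition zpoly (g : {mpoly C[n]}) : {mpoly C[N]} := g \mPo [tuple 'X_(ix_z d i) | i < n].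

Lemma zpoly_eval (g : {mpoly C[n]}) x : (zpoly g).@[coords x] = g.@[a_z x 0].
Proof.
rewrite comp_mpoly_meval; apply: meval_eq => i.
by rewrite tnth_mktuple mevalXU coords_z.
Qed.

Definition fpoly (k : 'I_d) : {mpoly C[n]} :=
  affine (map_mx intr (hd_coch k)) (hd_lambda X 0 k).

Lemma fpolyE k z :
  (fpoly k).@[z 0] = pairing z (map_mx intr (hd_coch k)) - hd_lambda X 0 k.
Proof. by rewrite affine_eval. Qed.

Lemma level_uv (x : level X) k : a_u x 0 k * a_v x 0 k = (fpoly k).@[a_z x 0].
Proof. by rewrite fpolyE -(levelP x) addrK. Qed.

Lemma in_levelP x : (forall k, a_u x 0 k * a_v x 0 k = (fpoly k).@[a_z x 0]) -> in_level x.
Proof. by move=> h k; rewrite h fpolyE subrK. Qed.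

Definition xelt_poly (l : laurent C n) : {mpoly C[N]} :=
  \sum_(y <- l) zpoly y.2 * xpoly y.1.

Definition xsum (l : laurent C n) x : C :=
  \sum_(y <- l) xmono y.1 x * y.2.@[a_z x 0].

Lemma xelt_polyE l x : (xelt_poly l).@[coords x] = xsum l x.
Proof.
rewrite raddf_sum; apply: eq_bigr => y _ /=.
by rewrite rmorphM /= zpoly_eval xpoly_eval mulrC.
Qed.

Lemma xsum_bigact l s x : xsum l (bigact s x) = xsum l x.
Proof. by apply: eq_bigr => y _; rewrite (xmono_bigact y.1 s x). Qed.

Lemma xelt_subproof l : coord_pred (fun x : level X => xsum l x).
Proof.
apply/asboolP; split; last by move=> s x; exact: xsum_bigact.
by exists (xelt_poly l) => x; rewrite xelt_polyE.
Qed.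
Definition xelt l : coord_ring X := CoordRing (xelt_subproof l).

(** In a monomial of weight zero the exponent of v_k minus that of u_k is [xweight]. Removing the
    common powers of u_k v_k, which is [fpoly k] on the level set, leaves [xmono] times a polynomial
    in z. *)
Lemma coord_ring_xelt f : exists l, f = xelt l.
Proof.
case: f => f cf; have [[p hp] inv] := asboolW cf.
pose c m : {mpoly C[n]} := p@_m *:
  (\prod_i 'X_i ^+ m (ix_z d i) * \prod_k fpoly k ^+ minn (m (ix_u n k)) (m (ix_v n k))).
exists [seq (tdeg m, c m) | m <- msupp p & weight m == 0].
apply: crE => x /=; rewrite hp /xsum big_map big_filter /=.
(* The indicator of weight zero keeps exactly the invariant monomials. *)
have := @invariant_reweight p x (fun w => (w == 0)%:R).
rewrite eqxx mul1r => <-; last by move=> s; rewrite -(hp x) -(inv s x) hp.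
rewrite [RHS]big_mkcond; apply: eq_bigr => m _.
have [w0|_] := eqVneq (weight m) 0; last by rewrite mulr0.
rewrite mulr1 monomial_eval mevalZ [RHS]mulrCA; congr (_ * _).
rewrite rmorphM !rmorph_prod /= /xmono -[RHS]mulrA; congr (_ * _).
rewrite [RHS]mulrCA mulrC; congr (_ * _).
  by apply: eq_bigr => i _; rewrite rmorphXn /= mevalXU.
rewrite -big_split /=; apply: eq_bigr => k _; rewrite rmorphXn /= -level_uv.
have := congr1 (fun w : 'rV_d => w 0 k) w0; rewrite !mxE.
set a := m _; set b := m _; move/eqP; rewrite addr_eq0 => /eqP h.
have {h} -> : xweight (tdeg m) k = b%:Z - a%:Z by rewrite -[LHS]opprK -h opprB.
rewrite opprB !ppartBn exprMn.
have E (y : C) i j : y ^+ i = y ^+ (i - j) * y ^+ minn i j.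
  by rewrite -exprD minnE subnKC ?leq_subr.
rewrite [_ ^+ a](E _ a b) [_ ^+ b](E _ b a) [minn b a]minnC; ring.
Qed.

End CoordRing.

(** The last two hypotheses are infinitesimal T^d-invariance. They express the derivative in the
    coordinate held constant through the other derivatives; substitution turns the u, v part of the
    ambient bracket into the chain rule terms of the bracket of the restrictions. *)
Lemma gauge_identity (F : fieldType) n (u v pu pv qu qv : F) (du dv al ep eq : 'I_n -> F) :
  (forall i, du i * v + u * dv i = al i) ->
  (exists2 a : F, a != 0 & (u = a /\ forall i, du i = 0) \/ (v = a /\ forall i, dv i = 0)) ->
  u * pu - v * pv + \sum_i al i * ep i = 0 ->
  u * qu - v * qv + \sum_i al i * eq i = 0 ->
  pu * qv - pv * qu
  = \sum_i ((pu * du i + pv * dv i) * eq i - ep i * (qu * du i + qv * dv i)).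
Proof.
move=> duv [a a0 gauge].
move/(canRL (addKr _)); rewrite addr0 opprB => hp.
move/(canRL (addKr _)); rewrite addr0 opprB => hq.
case: gauge => -[E d0]; rewrite E in hp hq duv; apply: (mulfI a0).
  transitivity (pv * (v * qv - a * qu) - (v * pv - a * pu) * qv); first by ring.
  rewrite -hp -hq !big_distrr big_distrl -sumrB; apply: eq_bigr => i _ /=.
  by rewrite -duv d0; ring.
transitivity (pu * (a * qv - u * qu) - (a * pv - u * pu) * qu); first by ring.
rewrite -hp -hq !big_distrr big_distrl -sumrB; apply: eq_bigr => i _ /=.
by rewrite -duv d0; ring.
Qed.

Lemma bracket_sum (F : fieldType) (n d : nat) (a : 'I_d -> F) (b c : 'I_d -> 'I_n -> F)
    (pz qz ep eq : 'I_n -> F) :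
  (forall k, a k = \sum_i (b k i * eq i - ep i * c k i)) ->
  \sum_k a k + \sum_i (pz i * eq i - ep i * qz i)
  = \sum_i ((\sum_k b k i + pz i) * eq i - ep i * (\sum_k c k i + qz i)).
Proof.
move=> h; rewrite (eq_bigr _ (fun k _ => h k)) exchange_big -big_split.
apply: eq_bigr => i _ /=; rewrite sumrB -mulr_suml -mulr_sumr; ring.
Qed.

Lemma big_delta (F : pzSemiRingType) (I : finType) (f : I -> F) i :
  \sum_j f j * (j == i)%:R = f i.
Proof.
rewrite (bigD1 i) //= eqxx mulr1 big1 ?addr0 // => j /negbTE ->.
by rewrite mulr0.
Qed.

(** * Slices of the T^d-orbits and the bracket restricted to them *)

Section Slice.

Variables (R : realType) (n : nat) (X : hypertoric_data R[i] n).
Local Notation C := R[i].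
Local Notation d := (hd_size X).
Local Notation N := (nvars n d).
Implicit Types (f g h : coord_ring X) (x : ambient R n d) (z : 'rV[C]_n).

(* A slice to the T^d-orbits over the locus where, for each k, the coordinate
   U k or V k held constant is nonzero; it is a copy of T x h^* in Z_lambda. *)
Variables U V : 'I_d -> {mpoly C[n]}.
Hypothesis UV : forall k, U k * V k = fpoly k.

Definition slice_point t z : ambient R n d :=
  Ambient (\row_k (U k).@[z 0]) (\row_k (V k).@[z 0]) t z.

Lemma slice_subproof t z : in_level (slice_point t z).
Proof. by apply: in_levelP => k; rewrite !mxE -rmorphM /= UV. Qed.

Definition slice t z : level X := Level (slice_subproof t z).

Definition slice_factor (xi : 'rV[int]_n) : {mpoly C[n]} :=
  \prod_k (V k ^+ ppart (xweight xi k) * U k ^+ ppart (- xweight xi k)).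

Definition lslice (l : laurent C n) : laurent C n :=
  [seq (y.1, y.2 * slice_factor y.1) | y : 'rV[int]_n * {mpoly C[n]} <- l].

Lemma xmono_slice xi t z :
  xmono xi (slice_point t z) = chi xi t * (slice_factor xi).@[z 0].
Proof.
rewrite /xmono /= rmorph_prod /=; congr (_ * _); apply: eq_bigr => k _.
by rewrite rmorphM /= !rmorphXn !mxE.
Qed.

Lemma xelt_slice l t z : xelt X l (slice t z) = lval (lslice l) t z.
Proof.
rewrite /lval big_map; apply: eq_bigr => y _.
by rewrite (xmono_slice y.1 t z) rmorphM /= mulrAC mulrA.
Qed.

Hypothesis factor_neq0 : forall xi, slice_factor xi != 0.

(** Multiplying by [q] gives vanishing on the whole slice, so the coefficient of each character is
    zero. As the [xmono] generate C[X] over polynomials in z, equality follows on all of Z_lambda,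
    not only on the orbits that meet the slice. *)
Lemma slice_inj q f g : q != 0 ->
  (forall t z, q.@[z 0] != 0 -> f (slice t z) = g (slice t z)) -> f = g.
Proof.
move=> q0 E; apply/eqP; rewrite -subr_eq0; apply/eqP.
have [l El] := coord_ring_xelt (f - g).
pose ql : laurent C n := [seq (y.1, q * y.2) | y : 'rV[int]_n * {mpoly C[n]} <- lslice l].
have ql0 t z : lval ql t z = 0.
  rewrite /lval big_map; transitivity (q.@[z 0] * lval (lslice l) t z).
    by rewrite big_distrr; apply: eq_bigr => y _; rewrite rmorphM /= mulrCA.
  have [->|qz] := eqVneq q.@[z 0] 0; first by rewrite mul0r.
  rewrite -xelt_slice -El; apply/eqP; rewrite mulf_eq0; apply/orP; right.
  by rewrite -[X in X == _]/(f _ - g _) E // subrr.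
have coef0 xi : \sum_(y <- l | y.1 == xi) y.2 = 0.
  have := lval_eq0 (fun eta => (eta == xi)%:R) ql0.
  rewrite !big_map /=; under eq_bigr do rewrite mulrC.
  move=> H; suff : (\sum_(y <- l | y.1 == xi) y.2) * (slice_factor xi * q) = 0.
    by move/eqP; rewrite !mulf_eq0 (negbTE q0) (negbTE (factor_neq0 xi)) !orbF => /eqP.
  rewrite -[RHS]H big_distrl big_mkcond /=; apply: eq_bigr => y _.
  case: eqP => [->|_]; last by rewrite scale0r.
  by rewrite scale1r mulrA.
rewrite El; apply: crE => x /=; rewrite /xsum (big_by_key _ fst) big1 // => xi _.
transitivity (xmono xi x * (\sum_(y <- l | y.1 == xi) y.2).@[a_z x 0]); last first.
  by rewrite coef0 meval0 mulr0.
by rewrite raddf_sum big_distrr; apply: eq_bigr => y /eqP ->.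
Qed.

Lemma monomial_euler (m : 'X_{1..N}) j :
  'X_j * 'X_[m]^`M(j) = (m j)%:R *: 'X_[m] :> {mpoly C[N]}.
Proof.
rewrite mderivX -scalerAr -mpolyXD; have [->|mj] := posnP (m j); first by rewrite !scale0r.
by congr (_ *: mpolyX _ _); rewrite addmC submK // lep1mP -lt0n.
Qed.

Lemma coordinate_euler (p : {mpoly C[N]}) j v :
  v j * p^`M(j).@[v] = \sum_(m <- msupp p) (m j)%:R * (p@_m * 'X_[m].@[v]).
Proof.
rewrite [in LHS](mpolyE p) (raddf_sum (mderiv j)) raddf_sum big_distrr.
apply: eq_bigr => m _ /=.
rewrite mderivZ mevalZ mulrCA -[v j]mevalXU -rmorphM /= monomial_euler mevalZ.
by rewrite mulrCA.
Qed.

Lemma euler_eval (p : {mpoly C[N]}) i x : (euler i p).@[coords x]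
  = \sum_(m <- msupp p) (tdeg m 0 i)%:~R * (p@_m * 'X_[m].@[coords x]).
Proof.
rewrite rmorphB !rmorphM /= !mevalXU !coordinate_euler -sumrB.
by apply: eq_bigr => m _; rewrite -mulrBl mxE rmorphB.
Qed.

(* The infinitesimal form of T^d-invariance. *)
Lemma invariant_lie (p : {mpoly C[N]}) x k :
  (forall s, p.@[coords (bigact s x)] = p.@[coords x]) ->
  a_u x 0 k * p^`M(ix_u n k).@[coords x] - a_v x 0 k * p^`M(ix_v n k).@[coords x]
  + \sum_i (hd_alpha X i k)%:~R * (euler i p).@[coords x] = 0.
Proof.
move=> inv; rewrite -coords_u -coords_v !coordinate_euler -sumrB.
have -> : \sum_i (hd_alpha X i k)%:~R * (euler i p).@[coords x]
    = \sum_(m <- msupp p) (xweight (tdeg m) k)%:~R * (p@_m * 'X_[m].@[coords x]).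
  under eq_bigr do rewrite euler_eval big_distrr /=.
  rewrite exchange_big; apply: eq_bigr => m _ /=; rewrite /xweight mxE raddf_sum big_distrl.
  by apply: eq_bigr => i _ /=; rewrite rmorphM /=; ring.
have := @invariant_reweight R n X p x (fun w => (w 0 k)%:~R) inv.
rewrite mxE mul0r => H; rewrite -[RHS]H -big_split /=; apply: eq_bigr => m _.
by rewrite -mulrBl -mulrDl mulrC mxE rmorphD rmorphB.
Qed.

Definition slice_tuple (t : torus C n) : N.-tuple {mpoly C[n]} :=
  [tuple row_mx (row_mx (\row_k U k) (\row_k V k))
     (row_mx (row_mx (\row_i (Gm_val (t i))%:MP) (\row_i (Gm_val (t i))^-1%:MP))
        (\row_i 'X_i)) 0 j | j < N].

Lemma slice_tuple_u t k : tnth (slice_tuple t) (ix_u n k) = U k.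
Proof. by rewrite tnth_mktuple /ix_u !row_mxEl mxE. Qed.
Lemma slice_tuple_v t k : tnth (slice_tuple t) (ix_v n k) = V k.
Proof. by rewrite tnth_mktuple /ix_v row_mxEl row_mxEr mxE. Qed.
Lemma slice_tuple_t t i : tnth (slice_tuple t) (ix_t d i) = (Gm_val (t i))%:MP.
Proof. by rewrite tnth_mktuple /ix_t row_mxEr !row_mxEl mxE. Qed.
Lemma slice_tuple_tV t i : tnth (slice_tuple t) (ix_tV d i) = (Gm_val (t i))^-1%:MP.
Proof. by rewrite tnth_mktuple /ix_tV row_mxEr row_mxEl row_mxEr mxE. Qed.
Lemma slice_tuple_z t i : tnth (slice_tuple t) (ix_z d i) = 'X_i.
Proof. by rewrite tnth_mktuple /ix_z !row_mxEr mxE. Qed.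

Lemma ix_ind (P : 'I_N -> Prop) :
  (forall k, P (ix_u n k)) -> (forall k, P (ix_v n k)) -> (forall i, P (ix_t d i)) ->
  (forall i, P (ix_tV d i)) -> (forall i, P (ix_z d i)) -> forall j, P j.
Proof.
move=> Pu Pv Pt Ps Pz j; case: (split_ordP j) => a ->; case: (split_ordP a) => b ->.
- exact: Pu.
- exact: Pv.
- by case: (split_ordP b) => c ->; [exact: Pt | exact: Ps].
- exact: Pz.
Qed.

Lemma slice_tuple_eval (p : {mpoly C[N]}) t z :
  (p \mPo slice_tuple t).@[z 0] = p.@[coords (slice_point t z)].
Proof.
rewrite comp_mpoly_meval; apply: meval_eq; apply: ix_ind => k.
- by rewrite slice_tuple_u coords_u mxE.
- by rewrite slice_tuple_v coords_v mxE.
- by rewrite slice_tuple_t coords_t mevalC.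
- by rewrite slice_tuple_tV coords_tV mevalC.
- by rewrite slice_tuple_z coords_z mevalXU.
Qed.

(** The restriction of [p] to the slice: coefficients are computed at t = 1, and the dependence on t
    is carried by [tdeg]. *)
Definition lrestrict (p : {mpoly C[N]}) : laurent C n :=
  [seq (tdeg m, p@_m *: ('X_[m] \mPo slice_tuple 1%g)) | m <- msupp p].

Lemma monomial_slice_eval (m : 'X_{1..N}) t z :
  'X_[m].@[coords (slice_point t z)]
  = chi (tdeg m) t * ('X_[m] \mPo slice_tuple 1%g).@[z 0].
Proof.
apply: (etrans _ (congr1 (fun c => chi (tdeg m) t * c)
  (esym (slice_tuple_eval 'X_[m] 1%g z)))).
apply: (etrans (monomial_eval m (slice_point t z))); congr (_ * _).
by apply: esym; apply: (etrans (monomial_eval m (slice_point 1%g z))); rewrite chi1 mul1r.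
Qed.

Lemma monomial_slice (m : 'X_{1..N}) t :
  'X_[m] \mPo slice_tuple t = chi (tdeg m) t *: ('X_[m] \mPo slice_tuple 1%g).
Proof.
apply: mpoly_row_inj => z; rewrite mevalZ -(monomial_slice_eval m t z).
exact: slice_tuple_eval.
Qed.

Lemma lrestrict_comp p t :
  p \mPo slice_tuple t = \sum_(y <- lrestrict p) chi y.1 t *: y.2.
Proof.
rewrite comp_mpolyEX [RHS]big_map; apply: eq_bigr => m _ /=.
by rewrite monomial_slice scalerA mulrC -scalerA.
Qed.

Lemma lrestrict_val p t z : lval (lrestrict p) t z = p.@[coords (slice_point t z)].
Proof.
rewrite -slice_tuple_eval lrestrict_comp raddf_sum.
by apply: eq_bigr => y _; rewrite /= mevalZ.
Qed.

Lemma lrestrict_euler p i t z :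
  lval (leuler i (lrestrict p)) t z = (euler i p).@[coords (slice_point t z)].
Proof.
rewrite euler_eval /lval /leuler /lrestrict -map_comp [LHS]big_map; apply: eq_bigr => m _ /=.
by rewrite !mevalZ (monomial_slice_eval m t z); ring.
Qed.

Lemma lrestrict_deriv p i t z :
  let x := slice_point t z in
  lval (lderiv i (lrestrict p)) t z
  = \sum_k (p^`M(ix_u n k).@[coords x] * (U k)^`M(i).@[z 0]
            + p^`M(ix_v n k).@[coords x] * (V k)^`M(i).@[z 0])
    + p^`M(ix_z d i).@[coords x].
Proof.
move=> x; transitivity ((p \mPo slice_tuple t)^`M(i).@[z 0]).
  rewrite lrestrict_comp (raddf_sum (mderiv i)) raddf_sum /lval [LHS]big_map.
  by apply: eq_bigr => y _ /=; rewrite mderivZ mevalZ.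
rewrite mderiv_comp raddf_sum big_nvars /=; congr (_ + _).
  apply: eq_bigr => k _; rewrite slice_tuple_u slice_tuple_v.
  by congr (_ + _); apply: (etrans (mevalM _ _ _)); congr (_ * _); exact: slice_tuple_eval.
have h j : ((p^`M(ix_t d j) \mPo slice_tuple t) * (tnth (slice_tuple t) (ix_t d j))^`M(i)).@[z 0]
    + ((p^`M(ix_tV d j) \mPo slice_tuple t) * (tnth (slice_tuple t) (ix_tV d j))^`M(i)).@[z 0]
    + ((p^`M(ix_z d j) \mPo slice_tuple t) * (tnth (slice_tuple t) (ix_z d j))^`M(i)).@[z 0]
    = (p^`M(ix_z d j) \mPo slice_tuple t).@[z 0] * (j == i)%:R.
  rewrite slice_tuple_t slice_tuple_tV slice_tuple_z !mderivC mderivXU.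
  move: (_ \mPo _) (_ \mPo _) (_ \mPo _) => a b c.
  by rewrite !mulr0 meval0 !add0r mevalM rmorph_nat.
apply: (etrans (eq_bigr _ (fun j _ => h j))).
apply: (etrans (big_delta (fun j => (p^`M(ix_z d j) \mPo slice_tuple t).@[z 0]) i)).
exact: slice_tuple_eval.
Qed.

Hypothesis gauge : forall k, exists2 a : C, a != 0 & U k = a%:MP \/ V k = a%:MP.

Lemma bracket_slice (p q : {mpoly C[N]}) t z :
  (forall s x, p.@[coords (bigact s x)] = p.@[coords (x : ambient R n d)]) ->
  (forall s x, q.@[coords (bigact s x)] = q.@[coords (x : ambient R n d)]) ->
  (ambient_bracket p q).@[coords (slice_point t z)]
  = lbracket (lrestrict p) (lrestrict q) t z.
Proof.
move=> pinv qinv; set x := slice_point t z.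
pose E p i := (euler i p).@[coords x].
pose D j p := (mderiv j p).@[coords x].
pose dU k i := (U k)^`M(i).@[z 0]; pose dV k i := (V k)^`M(i).@[z 0].
transitivity (\sum_k (D (ix_u n k) p * D (ix_v n k) q - D (ix_v n k) p * D (ix_u n k) q)
  + \sum_i (D (ix_z d i) p * E q i - E p i * D (ix_z d i) q)).
  rewrite mevalD (raddf_sum (meval _)) (raddf_sum (meval _)).
  by congr (_ + _); apply: eq_bigr => i _ /=; rewrite mevalB !mevalM.
have dUV k i : dU k i * (V k).@[z 0] + (U k).@[z 0] * dV k i = (hd_alpha X i k)%:~R.
  have := congr1 (fun p => p^`M(i).@[z 0]) (UV k).
  by rewrite /= mderivM affine_deriv mevalC !mxE mevalD !mevalM => ->.
have gk k : exists2 a : C, a != 0 & ((U k).@[z 0] = a /\ forall i, dU k i = 0)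
    \/ ((V k).@[z 0] = a /\ forall i, dV k i = 0).
  have [a a0 [h|h]] := gauge k; exists a => //; [left | right]; rewrite h mevalC.
    by split=> // i; rewrite /dU h mderivC meval0.
  by split=> // i; rewrite /dV h mderivC meval0.
have lie r k : (forall s x, r.@[coords (bigact s x)] = r.@[coords (x : ambient R n d)]) ->
    (U k).@[z 0] * D (ix_u n k) r - (V k).@[z 0] * D (ix_v n k) r
    + \sum_i (hd_alpha X i k)%:~R * E r i = 0.
  by move=> inv; have := @invariant_lie r x k (inv^~ x); rewrite /= !mxE.
apply: (etrans (bracket_sum (fun i => D (ix_z d i) p) (fun i => D (ix_z d i) q)
  (fun k => gauge_identity (dUV k) (gk k) (lie p k pinv) (lie q k qinv)))).
apply: eq_bigr => i _; congr (_ * _ - _ * _); apply: esym.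
- exact: lrestrict_deriv.
- exact: lrestrict_euler.
- exact: lrestrict_euler.
- exact: lrestrict_deriv.
Qed.

End Slice.

Lemma scaled_sub (F : comPzRingType) (c c' x x' p p' r r' : F) :
  c * p = r -> c' * p' = r' -> c * x * p - c' * x' * p' = x * r - x' * r'.
Proof. by move=> <- <-; ring. Qed.

Lemma scaled_bracket (F : comPzRingType) (c c' pu pv qu qv pu' pv' qu' qv' : F) :
  c * c' = 1 -> c * pu = pu' -> c' * pv = pv' -> c * qu = qu' -> c' * qv = qv' ->
  pu * qv - pv * qu = pu' * qv' - pv' * qu'.
Proof.
move=> cc <- <- <- <-; rewrite -[LHS]mul1r -cc; ring.
Qed.

Lemma comp_mpoly_fixed (F : comNzRingType) n k (lq : n.-tuple {mpoly F[k]})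
    (lr : k.-tuple {mpoly F[k]}) (g : {mpoly F[n]}) :
  (forall i, tnth lq i \mPo lr = tnth lq i) -> (g \mPo lq) \mPo lr = g \mPo lq.
Proof.
move=> h; elim/mpoly_ring_ind: g => [c|i|p q hp hq|p q hp hq].
- by rewrite !comp_mpolyC.
- by rewrite comp_mpolyXU -tnth_nth.
- by rewrite !comp_mpolyD hp hq.
- by rewrite !rmorphM /= hp hq.
Qed.

(** * Existence of brackets and their determination by values on a slice *)

Section Poisson.

Variables (R : realType) (n : nat) (X : hypertoric_data R[i] n).
Local Notation C := R[i].
Local Notation d := (hd_size X).
Local Notation N := (nvars n d).
Implicit Types (f g h : coord_ring X) (x : ambient R n d) (z : 'rV[C]_n).

(** T^d acts diagonally on all the coordinates; its factors are the coordinates of the image of the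
    point with all coordinates 1. *)
Definition scaling (s : torus C d) : 'I_N -> C :=
  coords (Ambient (\row_k Gm_val (s k)) (\row_k (Gm_val (s k))^-1)
    (torus_hom (hd_alpha X) s) (const_mx 1)).

Lemma coords_bigact s x j : coords (bigact s x) j = scaling s j * coords x j.
Proof.
elim/ix_ind: j => k; rewrite /scaling.
- by rewrite !coords_u !mxE.
- by rewrite !coords_v !mxE.
- by rewrite !coords_t torusM.
- by rewrite !coords_tV torusM invfM.
- by rewrite !coords_z mxE mul1r.
Qed.

Definition scaling_tuple s : N.-tuple {mpoly C[N]} := [tuple scaling s j *: 'X_j | j < N].

Lemma scaling_eval (p : {mpoly C[N]}) s x :
  (p \mPo scaling_tuple s).@[coords x] = p.@[coords (bigact s x)].
Proof.
rewrite comp_mpoly_meval; apply: meval_eq => j.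
by rewrite tnth_mktuple mevalZ mevalXU coords_bigact.
Qed.

Lemma scaling_X s j : 'X_j \mPo scaling_tuple s = scaling s j *: 'X_j.
Proof. by rewrite comp_mpolyXU -tnth_nth tnth_mktuple. Qed.

Lemma scaling_zpoly s (g : {mpoly C[n]}) : zpoly X g \mPo scaling_tuple s = zpoly X g.
Proof.
apply: comp_mpoly_fixed => i; rewrite tnth_mktuple.
by apply: (etrans (scaling_X s _)); rewrite /scaling coords_z mxE scale1r.
Qed.

Lemma xpoly_monomial xi : exists m, xpoly X xi = 'X_[m].
Proof.
have XX j k : exists m, 'X_j ^+ k = 'X_[m] :> {mpoly C[N]}.
  by exists (U_(j) *+ k)%MM; exact: mpolyXn.
have MM (a b : {mpoly C[N]}) : (exists m, a = 'X_[m]) -> (exists m, b = 'X_[m]) ->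
    exists m, a * b = 'X_[m].
  by move=> [m ->] [m' ->]; exists (m + m')%MM; exact/esym/mpolyXD.
have PP (m : nat) (a : 'I_m -> {mpoly C[N]}) :
    (forall i, exists m, a i = 'X_[m]) -> exists m, \prod_i a i = 'X_[m].
  move=> h; apply: (@big_ind _ (fun a => exists m, a = 'X_[m])) => [||i _].
  - by exists 0%MM; exact/esym/mpolyX0.
  - exact: MM.
  - exact: h.
rewrite /xpoly.
by apply: (MM); apply: PP => i; apply: (MM); exact: XX.
Qed.

Lemma scaling_monomial s m :
  'X_[m] \mPo scaling_tuple s = 'X_[m].@[scaling s] *: 'X_[m].
Proof.
rewrite comp_mpolyX mevalX (mpolyXE_id _ m) -scaler_prod.
by apply: eq_bigr => j _; rewrite tnth_mktuple exprZn.
Qed.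

Lemma scaling_xpoly s xi : xpoly X xi \mPo scaling_tuple s = xpoly X xi.
Proof.
have [m Em] := xpoly_monomial xi.
rewrite Em scaling_monomial -Em -[RHS]scale1r; congr (_ *: _).
pose one := Ambient (const_mx 1) (const_mx 1) 1%g (const_mx 1) : ambient R n d.
transitivity (xmono xi (bigact s one)).
  rewrite -xpoly_eval; apply: meval_eq => j; rewrite coords_bigact -[LHS]mulr1.
  congr (_ * _); apply: esym; elim/ix_ind: j => k.
  - by rewrite coords_u mxE.
  - by rewrite coords_v mxE.
  - by rewrite coords_t torus1.
  - by rewrite coords_tV torus1 invr1.
  - by rewrite coords_z mxE.
rewrite (xmono_bigact xi s one) /xmono /= chi1 mul1r big1 // => k _.
by rewrite !mxE !expr1n mulr1.
Qed.

Lemma scaling_xelt s l : xelt_poly X l \mPo scaling_tuple s = xelt_poly X l.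
Proof.
rewrite /xelt_poly raddf_sum; apply: eq_bigr => y _ /=.
by rewrite rmorphM /= scaling_zpoly scaling_xpoly.
Qed.

Lemma scaling_deriv s (p : {mpoly C[N]}) j x : p \mPo scaling_tuple s = p ->
  scaling s j * p^`M(j).@[coords (bigact s x)] = p^`M(j).@[coords x].
Proof.
move=> h; rewrite -[in RHS]h mderiv_comp (raddf_sum (meval (coords x))) /=.
apply: (etrans (esym (big_delta
  (fun k => scaling s k * p^`M(k).@[coords (bigact s x)]) j))).
apply: eq_bigr => k _; apply: esym; rewrite tnth_mktuple mderivZ mderivXU mevalM mevalZ rmorph_nat.
by rewrite (scaling_eval p^`M(k) s x) mulrCA mulrA.
Qed.

(** Invariance is asked of the polynomials, not of their values: t_i and t_i^-1 are independent
    variables, so polynomials with invariant values may change under the substitution. The factors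
    of u_k and v_k are inverse to each other, and Euler operators are unaffected by scaling. *)
Lemma bracket_invariant s (p q : {mpoly C[N]}) x :
  p \mPo scaling_tuple s = p -> q \mPo scaling_tuple s = q ->
  (ambient_bracket p q).@[coords (bigact s x)] = (ambient_bracket p q).@[coords x].
Proof.
move=> hp hq.
have E r : r \mPo scaling_tuple s = r -> forall i,
    (euler i r).@[coords (bigact s x)] = (euler i r).@[coords x].
  move=> hr i; have ht := scaling_deriv (ix_t d i) x hr.
  have hV := scaling_deriv (ix_tV d i) x hr.
  have ev y : (euler i r).@[coords y] = coords y (ix_t d i) * r^`M(ix_t d i).@[coords y]
      - coords y (ix_tV d i) * r^`M(ix_tV d i).@[coords y].
    apply: (etrans (mevalB _ _ _)).
    by congr (_ - _); apply: (etrans (mevalM _ _ _)); congr (_ * _); exact: mevalXU.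
  apply: (etrans (ev _)); apply: (etrans _ (esym (ev _))).
  by apply: (etrans _ (scaled_sub _ _ ht hV)); congr (_ * _ - _ * _); exact: coords_bigact.
have ev y : (ambient_bracket p q).@[coords y]
    = \sum_k (p^`M(ix_u n k).@[coords y] * q^`M(ix_v n k).@[coords y]
              - p^`M(ix_v n k).@[coords y] * q^`M(ix_u n k).@[coords y])
      + \sum_i (p^`M(ix_z d i).@[coords y] * (euler i q).@[coords y]
                - (euler i p).@[coords y] * q^`M(ix_z d i).@[coords y]).
  apply: (etrans (mevalD _ _ _)); congr (_ + _).
    apply: (etrans (raddf_sum (meval _) _ _ _)); apply: eq_bigr => k _.
    by apply: (etrans (mevalB _ _ _)); congr (_ - _); exact: mevalM.
  apply: (etrans (raddf_sum (meval _) _ _ _)); apply: eq_bigr => k _.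
  by apply: (etrans (mevalB _ _ _)); congr (_ - _); exact: mevalM.
apply: (etrans (ev _)); apply: (etrans _ (esym (ev _))); congr (_ + _).
  apply: eq_bigr => k _; apply: scaled_bracket (scaling_deriv (ix_u n k) x hp)
    (scaling_deriv (ix_v n k) x hp) (scaling_deriv (ix_u n k) x hq)
    (scaling_deriv (ix_v n k) x hq).
  by rewrite /scaling coords_u coords_v !mxE divff // Gm_neq0.
apply: eq_bigr => i _.
have z1 r : r \mPo scaling_tuple s = r ->
    r^`M(ix_z d i).@[coords (bigact s x)] = r^`M(ix_z d i).@[coords x].
  move=> hr; rewrite -(scaling_deriv (ix_z d i) x hr) /scaling coords_z mxE.
  by rewrite mul1r.
by congr (_ * _ - _ * _); [exact: z1 | exact: E | exact: E | exact: z1].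
Qed.

(** The lifts [xelt_poly] are invariant as polynomials, so their bracket restricts to an element of
    C[X]. *)
Lemma poisson_exists f g : exists h, is_poisson_bracket f g h.
Proof.
have [l ->] := coord_ring_xelt f; have [l' ->] := coord_ring_xelt g.
pose p := xelt_poly X l; pose q := xelt_poly X l'.
have cp : coord_pred (fun x : level X => (ambient_bracket p q).@[coords x]).
  apply/asboolP; split; first by exists (ambient_bracket p q).
  by move=> s x; apply: bracket_invariant; exact: scaling_xelt.
exists (CoordRing cp), p, q; split=> //.
- by move=> s x; rewrite !xelt_polyE xsum_bigact.
- by move=> s x; rewrite !xelt_polyE xsum_bigact.
- by move=> x; rewrite xelt_polyE.
- by move=> x; rewrite xelt_polyE.
Qed.

Variables U V : 'I_d -> {mpoly C[n]}.
Hypothesis UV : forall k, U k * V k = fpoly k.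
Hypothesis factor_neq0 : forall xi, slice_factor U V xi != 0.
Hypothesis gauge : forall k, exists2 a : C, a != 0 & U k = a%:MP \/ V k = a%:MP.
Local Notation slice := (slice UV).

Lemma poisson_slice f g h (lf lg : laurent C n) : is_poisson_bracket f g h ->
  (forall t z, lval lf t z = f (slice t z)) ->
  (forall t z, lval lg t z = g (slice t z)) ->
  forall t z, h (slice t z) = lbracket lf lg t z.
Proof.
move=> [p [q [pinv qinv fp gq hpq]]] hf hg t z; rewrite hpq.
apply: (etrans (bracket_slice UV gauge t z pinv qinv)); apply: lbracket_eq => t' z'.
  by rewrite hf fp; exact: lrestrict_val.
by rewrite hg gq; exact: lrestrict_val.
Qed.

(** Some bracket of [f] and [g] exists, its values on the slice are the prescribed ones, and these
    determine an element of C[X]. *)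
Lemma poisson_from_slice f g h (lf lg : laurent C n) q : q != 0 ->
  (forall t z, lval lf t z = f (slice t z)) ->
  (forall t z, lval lg t z = g (slice t z)) ->
  (forall t z, q.@[z 0] != 0 -> h (slice t z) = lbracket lf lg t z) ->
  is_poisson_bracket f g h.
Proof.
move=> q0 hf hg hh; have [h' hh'] := poisson_exists f g.
suff -> : h = h' by [].
apply: (slice_inj factor_neq0 q0) => t z qz.
by rewrite hh // (poisson_slice hh' hf hg).
Qed.

End Poisson.

(** * Charts adapted to the multiarrangement *)

Section Chart.

Variables (R : realType) (n : nat).
Local Notation C := R[i].
Implicit Types (z : 'rV[C]_n) (t : torus C n) (xi : 'rV[int]_n).

Section Arrangement.

Variables (A : multiarrangement R n) (omega : 'I_(ma_size A) -> 'cV[int]_n).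
Variable lam : 'I_(ma_size A) -> C.
Local Notation dA := (ma_size A).

Definition hweight (xi : 'rV[int]_n) (j : 'I_dA) : int := (xi *m omega j) 0 0.

Definition hpoly (j : 'I_dA) : {mpoly C[n]} := affine (map_mx intr (omega j)) (lam j).

Definition hfactor (xi : 'rV[int]_n) : {mpoly C[n]} :=
  \prod_j hpoly j ^+ (ma_mult j * ppart (hweight xi j)).

Definition lfactor (l : laurent C n) : laurent C n :=
  [seq (y.1, y.2 * hfactor y.1) | y : 'rV[int]_n * {mpoly C[n]} <- l].

(* A copy of T x h^* in Z_lambda through which C[X] becomes the algebra of
   the functions sum t^xi g_xi(z) Q_xi(z) on T x h^*, where Q_xi is hfactor xi,
   with its standard Poisson bracket. *)
Record chart (X : hypertoric_data C n) := Chart {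
  chart_pt :> torus C n -> 'rV[C]_n -> level X;
  chart_t : forall t z, a_t (chart_pt t z) = t;
  chart_z : forall t z, a_z (chart_pt t z) = z;
  chart_translate : forall tau t z,
    level_translate tau (chart_pt t z) = chart_pt (tau * t)%g z;
  chart_laurent : forall f : coord_ring X, exists l,
    forall t z, f (chart_pt t z) = lval (lfactor l) t z;
  chart_surj : forall l, exists f : coord_ring X,
    forall t z, f (chart_pt t z) = lval (lfactor l) t z;
  chart_inj : forall (q : {mpoly C[n]}) (f g : coord_ring X), q != 0 ->
    (forall t (z : 'rV[C]_n), q.@[z 0] != 0 -> f (chart_pt t z) = g (chart_pt t z)) -> f = g;
  chart_poisson : forall (f g h : coord_ring X) (lf lg : laurent C n), is_poisson_bracket f g h ->
    (forall t z, lval lf t z = f (chart_pt t z)) ->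
    (forall t z, lval lg t z = g (chart_pt t z)) ->
    forall t z, h (chart_pt t z) = lbracket lf lg t z;
  chart_poisson_from : forall (f g h : coord_ring X) lf lg (q : {mpoly C[n]}), q != 0 ->
    (forall t z, lval lf t z = f (chart_pt t z)) ->
    (forall t z, lval lg t z = g (chart_pt t z)) ->
    (forall t (z : 'rV[C]_n), q.@[z 0] != 0 -> h (chart_pt t z) = lbracket lf lg t z) ->
    is_poisson_bracket f g h }.

End Arrangement.

Lemma level_eq (X : hypertoric_data C n) (x y : level X) :
  level_val x = level_val y -> x = y.
Proof.
case: x => x hx; case: y => y hy /= E; move: hx; rewrite E => hx.
by rewrite (Prop_irrelevance hx hy).
Qed.

Variables (A : multiarrangement R n) (omega : 'I_(ma_size A) -> 'cV[int]_n).
Variable lam : 'I_(ma_size A) -> C.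
Local Notation dA := (ma_size A).
Hypothesis omega_primitive : forall j, primitive (omega j).
Hypothesis hypE : forall j, ma_hyp j = hyperplane (omega j) (lam j).

Local Notation hP := (@hpoly A omega lam).
Local Notation hF := (@hfactor A omega lam).

Lemma hpolyE j z : (hP j).@[z 0] = pairing z (map_mx intr (omega j)) - lam j.
Proof. by rewrite affine_eval. Qed.

Lemma hpoly_neq0 j : hP j != 0.
Proof. by apply/affine_neq0/map_intr_neq0/primitive_neq0. Qed.

Lemma hfactor_neq0 xi : hF xi != 0.
Proof. by apply/prodf_neq0 => j _; rewrite expf_neq0 // hpoly_neq0. Qed.

Lemma multiplicity_hyp (j : 'I_dA) : multiplicity A (ma_hyp j) = ma_mult j.
Proof.
rewrite /multiplicity (bigD1 j) /=; last exact/asboolP.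
rewrite big1 ?addn0 // => k /andP[/asboolP /ma_distinct -> /eqP]; by [].
Qed.

Lemma multiplicity_gt0 H : (0 < multiplicity A H)%N -> exists j : 'I_dA, ma_hyp j = H.
Proof.
move=> h; apply: contrapT => ne; move: h; rewrite /multiplicity big1 // => j.
by move=> /asboolP E; case: ne; exists j.
Qed.

Variable X : hypertoric_data C n.
Local Notation d := (hd_size X).
Hypothesis HA : is_multiarrangement_of X A.

Lemma xweight_coch xi (k : 'I_d) : xweight xi k = (xi *m hd_coch k) 0 0.
Proof. by rewrite /xweight !mxE; apply: eq_bigr => i _; rewrite mxE. Qed.

Lemma coch_hyperplane (k : 'I_d) : hd_coch k != 0 -> exists (j : 'I_dA) (c : int),
  [/\ ma_hyp j = hyperplane (hd_coch k) (hd_lambda X 0 k),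
      hd_coch k = c *: omega j, hd_lambda X 0 k = c%:~R * lam j, c != 0
    & divisibility (hd_coch k) = `|c|%N].
Proof.
move=> k0; have [j Ej] : exists j : 'I_dA, ma_hyp j = hyperplane (hd_coch k) (hd_lambda X 0 k).
  apply: multiplicity_gt0; rewrite HA (bigD1 k) /=; last first.
    by rewrite k0; apply/asboolP.
  rewrite addn_gt0; apply/orP; left; rewrite lt0n.
  apply: contraNneq k0 => div0; have : forall i, `|hd_coch k i 0%R|%N = 0%N.
    move=> i; have : (divisibility (hd_coch k) %| `|hd_coch k i 0%R|)%N.
      by rewrite /divisibility (bigD1 i) //= dvdn_gcdl.
    by rewrite div0 dvd0n => /eqP.
  by move=> h; apply/eqP/colP => i; rewrite [RHS]mxE; apply/eqP; rewrite -absz_eq0 h.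
have := Ej; rewrite hypE => /esym /(hyperplane_primitive (omega_primitive j) k0).
by case=> c [E1 E2 E3 E4]; exists j, c.
Qed.

(** [None] marks alpha_k = 0, which contributes no hyperplane; otherwise alpha_k = c omega_j. *)
Definition index_spec (k : 'I_d) (o : option ('I_dA * int)) : Prop :=
  match o with
  | None => hd_coch k = 0
  | Some (j, c) =>
      [/\ hd_coch k != 0, ma_hyp j = hyperplane (hd_coch k) (hd_lambda X 0 k),
      hd_coch k = c *: omega j /\ hd_lambda X 0 k = c%:~R * lam j, c != 0
    & divisibility (hd_coch k) = `|c|%N]
  end.

Lemma coch_index : exists hk : 'I_d -> option ('I_dA * int), forall k, index_spec k (hk k).
Proof.
suff /choice [hk hkP] : forall k, exists o, index_spec k o by exists hk.
move=> k; have [k0|k0] := eqVneq (hd_coch k) 0; first by exists None.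
by have [j [c [E1 E2 E3 E4 E5]]] := coch_hyperplane k0; exists (Some (j, c)).
Qed.

(** The constant c goes to U_k if c > 0 and to V_k if c < 0. Since a negative c also exchanges the
    exponents of u_k and v_k, the factor at k is in both cases a constant times f_j^(|c| (xi_j)_+),
    and the |c| add up to m_j. *)
Lemma adapted_slice : exists U V : 'I_d -> {mpoly C[n]},
  [/\ forall k, U k * V k = fpoly k,
      forall k, exists2 a : C, a != 0 & U k = a%:MP \/ V k = a%:MP
    & forall xi, exists2 c : C, c != 0 & slice_factor U V xi = c *: hF xi].
Proof.
have [hk hkP] := coch_index.
pose U k := if hk k is Some (j, c) then
  if 0 < c then (c%:~R : C)%:MP else hP j else 1.
(* If alpha_k = 0 then u_k v_k = - lambda_k, so V_k may be zero; its exponent in every slice factor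
   is 0, because [xweight xi k] is 0. *)
pose V k := if hk k is Some (j, c) then
  if 0 < c then hP j else (c%:~R : C)%:MP else (- hd_lambda X 0 k)%:MP.
have fE k j c : hk k = Some (j, c) -> fpoly k = (c%:~R : C)%:MP * hP j.
  move=> E; have := hkP k; rewrite E => -[_ _ [Ea El] _ _].
  apply: mpoly_row_inj => z; rewrite fpolyE Ea El mevalM mevalC hpolyE.
  by rewrite map_intrZ pairingZr mulrBr.
exists U, V; split=> [k|k|xi].
- rewrite /U /V; case E: (hk k) => [[j c]|].
    by rewrite (fE _ _ _ E); case: ifP => // _; rewrite mulrC.
  have := hkP k; rewrite E mul1r => E0; apply: mpoly_row_inj => z.
  by rewrite mevalC fpolyE E0 map_mx0 /pairing mulmx0 mxE sub0r.
- rewrite /U /V; case E: (hk k) => [[j c]|]; last by exists 1; [exact: oner_neq0 | left].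
  have := hkP k; rewrite E => -[_ _ _ c0 _]; exists c%:~R; first by rewrite intr_eq0.
  by case: ifP; [left | right].
(* The contribution of alpha_k to the multiplicity of H_j. *)
pose mu k j := if hk k is Some (j', c) then if j' == j then `|c|%N else 0%N else 0%N.
have sum_mu j : (\sum_k mu k j)%N = ma_mult j.
  rewrite -multiplicity_hyp HA [RHS]big_mkcond; apply: eq_bigr => k _.
  rewrite /mu; have := hkP k; case: (hk k) => [[j' c]|]; last by move=> ->; rewrite eqxx.
  case=> -> <- _ _ -> /=; congr (if _ then _ else _); apply/eqP/asboolP => [->//|].
  exact: ma_distinct.
have factor k : exists2 c : C, c != 0 &
    V k ^+ ppart (xweight xi k) * U k ^+ ppart (- xweight xi k)
    = c *: \prod_j hP j ^+ (mu k j * ppart (hweight omega xi j)).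
  have wE j c : hk k = Some (j, c) -> xweight xi k = c * hweight omega xi j.
    move=> E; have := hkP k; rewrite E => -[_ _ [Ea _] _ _].
    by rewrite xweight_coch Ea -scalemxAr mxE.
  have muE j c : hk k = Some (j, c) ->
      \prod_j hP j ^+ (mu k j * ppart (hweight omega xi j))
      = hP j ^+ (`|c|%N * ppart (hweight omega xi j)).
    move=> E; rewrite (bigD1 j) //= big1 ?mulr1 /mu E ?eqxx // => i ij.
    by rewrite eq_sym (negbTE ij) mul0n.
  rewrite /U /V; case E: (hk k) => [[j c]|]; last first.
    have := hkP k; rewrite E => E0; exists 1; first exact: oner_neq0.
    have -> : xweight xi k = 0 by rewrite xweight_coch E0 mulmx0 mxE.
    by rewrite oppr0 !expr0 mulr1 scale1r big1 // => j _; rewrite /mu E mul0n.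
  have := hkP k; rewrite E => -[_ _ _ c0 _].
  have cC0 : (c%:~R : C) != 0 by rewrite intr_eq0.
  rewrite (muE _ _ E) (wE _ _ E).
  case: (ltrgt0P c) c0 => // cs _.
    exists (c%:~R ^+ ppart (- (c * hweight omega xi j))); first by rewrite expf_neq0.
    rewrite -rmorphXn mulrC mul_mpolyC; congr (_ *: _ ^+ _).
    by rewrite -{1}(gtz0_abs cs) ppartMn.
  exists (c%:~R ^+ ppart (c * hweight omega xi j)); first by rewrite expf_neq0.
  rewrite -rmorphXn mul_mpolyC; congr (_ *: _ ^+ _).
  by rewrite -mulNr -(ltz0_abs cs) ppartMn.
have [c c0 cE] : exists2 c : 'I_d -> C, forall k, c k != 0 & forall k,
    V k ^+ ppart (xweight xi k) * U k ^+ ppart (- xweight xi k)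
    = c k *: \prod_j hP j ^+ (mu k j * ppart (hweight omega xi j)).
  have [c hc] := choice (fun k => let: ex_intro2 c c0 E := factor k in
    ex_intro (fun c => c != 0 /\ _ = c *: _) c (conj c0 E)).
  by exists c => k; case: (hc k).
exists (\prod_k c k); first exact/prodf_neq0.
rewrite /slice_factor (eq_bigr _ (fun k _ => cE k)) scaler_prod; congr (_ *: _).
rewrite exchange_big; apply: eq_bigr => j _ /=.
by rewrite prodrXr -big_distrl sum_mu.
Qed.

(** The constants between [slice_factor] and [hfactor] depend on xi only and are absorbed into the
    coefficients of the terms. *)
Lemma chart_exists : exists _ : chart omega lam X, True.
Proof.
have [U [V [UV gauge factor]]] := adapted_slice.
have f0 xi : slice_factor U V xi != 0.
  have [c c0 ->] := factor xi; rewrite -mul_mpolyC mulf_neq0 ?hfactor_neq0 //.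
  by rewrite mpolyC_eq0.
have [c cP] := choice (fun xi => let: ex_intro2 c c0 E := factor xi in
    ex_intro (fun c => c != 0 /\ _ = c *: _) c (conj c0 E)).
unshelve eexists (@Chart A omega lam X (slice UV) _ _ _ _ _ _ _ _) => //.
- by move=> tau t z; apply: level_eq.
- move=> f; have [l ->] := coord_ring_xelt f.
  exists [seq (y.1, c y.1 *: y.2) | y : 'rV[int]_n * {mpoly C[n]} <- l] => t z.
  rewrite xelt_slice; congr (lval _ t z); rewrite /lslice /lfactor -map_comp.
  by apply: eq_map => y /=; rewrite (cP y.1).2 -scalerAr scalerAl.
- move=> l; exists (xelt X
    [seq (y.1, (c y.1)^-1 *: y.2) | y : 'rV[int]_n * {mpoly C[n]} <- l]) => t z.
  rewrite xelt_slice; congr (lval _ t z); rewrite /lslice /lfactor -map_comp.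
  apply: eq_map => y /=; have [c0 ->] := cP y.1.
  by rewrite -scalerAr -scalerAl scalerA divff // scale1r.
- by move=> q f g q0; exact: slice_inj.
- move=> f g h lf lg; exact: poisson_slice.
- move=> f g h lf lg q q0; exact: poisson_from_slice.
Qed.

End Chart.

(** * The action on the arrangement *)

Section ArrangementAction.

Variables (R : realType) (n : nat).
Local Notation C := R[i].
Implicit Types (z : 'rV[C]_n) (t : torus C n) (xi : 'rV[int]_n).
Variables (W : finGroupType) (rho : mx_representation int [set: W] n).

Lemma rhoM w w' : rho (w * w')%g = rho w *m rho w'.
Proof. by rewrite repr_mxM ?inE. Qed.

Lemma rho1 : rho 1%g = 1%:M.
Proof. exact: repr_mx1. Qed.

Lemma rhoVK w : rho w^-1%g *m rho w = 1%:M.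
Proof. by rewrite -rhoM mulVg rho1. Qed.

Lemma rhoKV w : rho w *m rho w^-1%g = 1%:M.
Proof. by rewrite -rhoM mulgV rho1. Qed.

Lemma map_intrM m p q (M : 'M[int]_(m, p)) (N : 'M[int]_(p, q)) :
  map_mx intr (M *m N) = map_mx intr M *m map_mx intr N :> 'M[C]_(m, q).
Proof. by rewrite map_mxM. Qed.

Lemma pairing_rho z w (a : 'cV[int]_n) :
  pairing (z *m map_mx intr (rho w)) (map_mx intr a)
  = pairing z (map_mx intr (rho w *m a)) :> C.
Proof. by rewrite /pairing map_intrM mulmxA. Qed.

Lemma dual_actK w : cancel (@dual_act R n W rho w) (dual_act rho w^-1%g).
Proof.
move=> z; rewrite /dual_act invgK -mulmxA -map_intrM rhoVK.
by rewrite map_mx1 mulmx1.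
Qed.

Lemma dual_act_hyperplane w (a : 'cV[int]_n) (c : C) :
  (dual_act rho w @` hyperplane a c)%classic = hyperplane (rho w *m a) c.
Proof.
apply/seteqP; split=> z /=.
  case=> y hy <-; rewrite /hyperplane /= /dual_act pairing_rho mulmxA rhoVK.
  by rewrite mul1mx.
move=> hz; exists (dual_act rho w^-1%g z); last by rewrite -{1}[w]invgK dual_actK.
by rewrite /hyperplane /= /dual_act invgK pairing_rho.
Qed.

Lemma dual_act_inj w (H H' : set 'rV[C]_n) :
  (dual_act rho w @` H)%classic = (dual_act rho w @` H')%classic -> H = H'.
Proof.
move=> E; apply/seteqP; split=> z hz.
  have : (dual_act rho w @` H)%classic (dual_act rho w z) by exists z.
  by rewrite E => -[y hy /(can_inj (dual_actK w)) <-].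
have : (dual_act rho w @` H')%classic (dual_act rho w z) by exists z.
by rewrite -E => -[y hy /(can_inj (dual_actK w)) <-].
Qed.

Variables (A : multiarrangement R n) (omega : 'I_(ma_size A) -> 'cV[int]_n).
Variable lam : 'I_(ma_size A) -> C.
Local Notation d := (ma_size A).
Hypothesis omega_primitive : forall j, primitive (omega j).
Hypothesis hypE : forall j, ma_hyp j = hyperplane (omega j) (lam j).

(* w H_k = H_(sg w k) and w omega_k = (-1)^(ep w k) omega_(sg w k). *)
Record compatible (sg : W -> 'I_d -> 'I_d) (ep : W -> 'I_d -> bool) : Prop := Compatible {
  compat_omega : forall w k, rho w *m omega k = (-1) ^+ ep w k *: omega (sg w k);
  compat_lam : forall w k, lam k = (-1) ^+ ep w k * lam (sg w k);
  compat_mult : forall w k, ma_mult (sg w k) = ma_mult k }.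

(** The factor c between the normals is a unit of Z: apply w^-1, which is integral, to c omega_j and
    pair the result omega_k with a character of value 1 on it. *)
Lemma normals_sign w (k j : 'I_d) : (dual_act rho w @` ma_hyp k)%classic = ma_hyp j ->
  exists e : bool, rho w *m omega k = (-1) ^+ e *: omega j /\ lam k = (-1) ^+ e * lam j.
Proof.
rewrite !hypE dual_act_hyperplane.
move/(hyperplane_primitive (omega_primitive j)) => [|c [E1 E2 _ _]].
  apply: contraNneq (primitive_neq0 (omega_primitive k)) => h.
  by rewrite -[omega k]mul1mx -(rhoVK w) -mulmxA h mulmx0.
have [u hu] := bezout_divisibility (omega k); rewrite omega_primitive in hu.
have h : c * (u *m (rho w^-1%g *m omega j)) 0 0 = 1.
  transitivity ((u *m (rho w^-1%g *m (c *: omega j))) 0 0).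
    by rewrite -!scalemxAr [RHS]mxE.
  by rewrite -E1 [_ *m (rho w *m _)]mulmxA rhoVK mul1mx hu.
have [E|E] : c = 1 \/ c = -1.
  have : `|c|%N == 1%N.
    by have /eqP := congr1 absz h; rewrite abszM muln_eq1 => /andP[].
  by case: (c) => [[|[|]]|[|]] //; [left | right].
  by exists false; rewrite E1 E2 E.
by exists true; rewrite E1 E2 E.
Qed.

(** Stated for a mere permutation of the hyperplanes, so that it also applies to a given action, for
    which invariance of the multiarrangement is still to be proved. *)
Lemma permuted_compatible :
  (forall w (k : 'I_d), exists2 j : 'I_d, (dual_act rho w @` ma_hyp k)%classic = ma_hyp j
    & ma_mult j = ma_mult k) -> exists sg ep, compatible sg ep.
Proof.
move=> perm.
have H (x : W * 'I_d) : exists y : 'I_d * bool,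
    [/\ rho x.1 *m omega x.2 = (-1) ^+ y.2 *: omega y.1,
        lam x.2 = (-1) ^+ y.2 * lam y.1 & ma_mult y.1 = ma_mult x.2].
  case: x => w k /=; have [j Ej mj] := perm w k.
  by have [e [E1 E2]] := normals_sign Ej; exists (j, e).
have [f hf] := choice H.
exists (fun w k => (f (w, k)).1), (fun w k => (f (w, k)).2).
by split=> w k; have [] := hf (w, k).
Qed.

Lemma invariant_compatible : multiarrangement_invariant rho A -> exists sg ep, compatible sg ep.
Proof.
move=> inv; apply: permuted_compatible => w k.
have := inv w (ma_hyp k); rewrite (multiplicity_hyp k) => E.
have [|j Ej] := @multiplicity_gt0 R n A (dual_act rho w @` ma_hyp k)%classic.
  by rewrite E ma_mult_gt0.
by exists j; rewrite ?Ej // -(multiplicity_hyp j) Ej.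
Qed.

Variables (sg : W -> 'I_d -> 'I_d) (ep : W -> 'I_d -> bool).
Hypothesis comp : compatible sg ep.

Lemma signZ_hyperplane (e : bool) (a : 'cV[int]_n) (c : C) :
  hyperplane ((-1) ^+ e *: a) ((-1) ^+ e * c) = hyperplane a c.
Proof.
have -> : (-1) ^+ e * c = ((-1) ^+ e : int)%:~R * c by rewrite rmorph_sign.
by rewrite hyperplaneZ // signr_eq0.
Qed.

Lemma compat_hyp w k : (dual_act rho w @` ma_hyp k)%classic = ma_hyp (sg w k).
Proof.
rewrite !hypE dual_act_hyperplane (compat_omega comp) (compat_lam comp w k).
exact: signZ_hyperplane.
Qed.

Lemma sgM w w' k : sg (w * w')%g k = sg w (sg w' k).
Proof.
apply: ma_distinct; rewrite -!compat_hyp !hypE !dual_act_hyperplane.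
by rewrite mulmxA rhoM.
Qed.

Lemma sg1 k : sg 1%g k = k.
Proof.
by apply: ma_distinct; rewrite -compat_hyp hypE dual_act_hyperplane rho1 mul1mx.
Qed.

Lemma sgK w : cancel (sg w) (sg w^-1%g).
Proof. by move=> k; rewrite -sgM mulVg sg1. Qed.

Lemma sgVK w : cancel (sg w^-1%g) (sg w).
Proof. by move=> k; rewrite -sgM mulgV sg1. Qed.

Lemma sg_bij w : bijective (sg w).
Proof. by exists (sg w^-1%g); [exact: sgK | exact: sgVK]. Qed.

Lemma omega_sign_inj (e e' : bool) k : (-1) ^+ e *: omega k = (-1) ^+ e' *: omega k -> e = e'.
Proof.
move/eqP; rewrite -subr_eq0 -scalerBl => /eqP h.
have [u hu] := bezout_divisibility (omega k); rewrite omega_primitive in hu.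
have : (u *m (((-1) ^+ e - (-1) ^+ e') *: omega k)) 0 0 = 0 by rewrite h mulmx0 mxE.
by rewrite -scalemxAr mxE hu mulr1; case: e e' {h} => -[].
Qed.

Lemma epM w w' k : ep (w * w')%g k = ep w (sg w' k) (+) ep w' k.
Proof.
apply: (@omega_sign_inj _ _ (sg (w * w')%g k)).
rewrite -(compat_omega comp) rhoM -mulmxA (compat_omega comp) -scalemxAr.
by rewrite (compat_omega comp) scalerA -signr_addb addbC sgM.
Qed.

Lemma ep1 k : ep 1%g k = false.
Proof.
by have := epM 1%g 1%g k; rewrite mulg1 sg1 addbb.
Qed.

Lemma compatible_invariant : multiarrangement_invariant rho A.
Proof.
move=> w H; rewrite /multiplicity (reindex (sg w)) /=; last first.
  exact/onW_bij/sg_bij.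
apply: eq_big => k; last by move=> _; rewrite (compat_mult comp).
congr asbool; apply/propext; rewrite -compat_hyp.
by split=> [/dual_act_inj|->].
Qed.

Lemma phiE w : phi rho omega w = \matrix_(j, k) ((-1) ^+ ep w k *+ (j == sg w k)).
Proof.
apply/matrixP => j k; rewrite !mxE compat_hyp.
case: asboolP => [/ma_distinct <-|ne]; last first.
  by case: eqP => // E; case: ne; rewrite E.
rewrite eqxx (compat_omega comp).
have h (e : bool) : ((-1) ^+ e *: omega (sg w k) == omega (sg w k)) = ~~ e.
  apply/eqP/idP => [|/negbTE ->]; last by rewrite expr0 scale1r.
  by rewrite -{2}[omega _]scale1r => /(@omega_sign_inj e false) ->.
by rewrite h; case: (ep w k) => //=; rewrite expr1 scaleN1r eqxx.
Qed.

Lemma arr_alphaE xi k : (xi *m arr_alpha omega) 0 k = (ma_mult k)%:Z * hweight omega xi k.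
Proof.
rewrite mxE /hweight mxE big_distrr; apply: eq_bigr => i _ /=.
by rewrite mxE -mulr_natl natz mulrCA.
Qed.

Lemma hweight_rho xi w k :
  hweight omega (xi *m rho w) k = (-1) ^+ ep w k * hweight omega xi (sg w k).
Proof. by rewrite /hweight -mulmxA (compat_omega comp) -scalemxAr mxE. Qed.

Lemma phi_mul_row (x : 'rV[int]_d) w k :
  (x *m phi rho omega w) 0 k = (-1) ^+ ep w k * x 0 (sg w k).
Proof.
rewrite phiE mxE (bigD1 (sg w k)) //= mxE eqxx mulr1n mulrC big1 ?addr0 // => j ne.
by rewrite mxE (negbTE ne) mulr0n mulr0.
Qed.

(** The W-equivariance of alpha, by which it induces a map on cohomology. *)
Lemma rho_alpha w : rho w *m arr_alpha omega = arr_alpha omega *m phi rho omega w.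
Proof.
apply/row_matrixP => i; rewrite !row_mul; apply/rowP => k.
rewrite arr_alphaE phi_mul_row -[i in RHS]/(i : 'I_n) rowE [in RHS]rowE arr_alphaE.
by rewrite hweight_rho (compat_mult comp) mulrCA.
Qed.

Lemma hpoly_rho w k z :
  (hpoly omega lam k).@[(z *m map_mx intr (rho w)) 0]
  = (-1) ^+ ep w k * (hpoly omega lam (sg w k)).@[z 0].
Proof.
rewrite !hpolyE pairing_rho (compat_omega comp) map_intrZ pairingZr rmorph_sign.
by rewrite mulrBr -(compat_lam comp).
Qed.

End ArrangementAction.

(** * The action attached to a splitting of the obstruction *)

(** The map (D, E) |-> (A D + N E, B^T E) with B = A^-1 is symplectic exactly when B N is
    symmetric. *)
Lemma symplectic_bracket (F : fieldType) n (A B N : 'M[F]_n) (D E D' E' : 'cV[F]_n) :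
  B *m A = 1%:M -> (B *m N)^T = B *m N ->
  \sum_i ((A *m D + N *m E) i 0 * (B^T *m E') i 0 - (B^T *m E) i 0 * (A *m D' + N *m E') i 0)
  = \sum_i (D i 0 * E' i 0 - E i 0 * D' i 0).
Proof.
move=> BA sym.
have dot (x y : 'cV[F]_n) : \sum_i x i 0 * y i 0 = (x^T *m y) 0 0.
  by rewrite mxE; apply: eq_bigr => i _; rewrite mxE.
rewrite !sumrB !dot !linearD /= !trmx_mul trmxK mulmxDl.
have r1 (x y : 'cV[F]_n) : x^T *m A^T *m (B^T *m y) = x^T *m y.
  by rewrite mulmxA -[_ *m A^T *m _]mulmxA -trmx_mul BA trmx1 mulmx1.
have r2 (x y : 'cV[F]_n) : x^T *m B *m (A *m y) = x^T *m y.
  by rewrite mulmxA -[_ *m B *m _]mulmxA BA mulmx1.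
have r3 (x y : 'cV[F]_n) : x^T *m N^T *m (B^T *m y) = x^T *m B *m (N *m y).
  by rewrite mulmxA -[_ *m N^T *m _]mulmxA -trmx_mul sym !mulmxA.
by rewrite r1 r2 r3 !mxE; ring.
Qed.

Section Action.

Variables (R : realType) (n : nat).
Local Notation C := R[i].
Implicit Types (z : 'rV[C]_n) (t tau : torus C n) (xi : 'rV[int]_n).
Variables (W : finGroupType) (rho : mx_representation int [set: W] n).
Variables (A : multiarrangement R n) (omega : 'I_(ma_size A) -> 'cV[int]_n).
Variable lam : 'I_(ma_size A) -> C.
Local Notation d := (ma_size A).
Hypothesis omega_primitive : forall j, primitive (omega j).
Hypothesis hypE : forall j, ma_hyp j = hyperplane (omega j) (lam j).
Variables (sg : W -> 'I_d -> 'I_d) (ep : W -> 'I_d -> bool).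
Hypothesis comp : compatible rho omega lam sg ep.
Local Notation f_ := (hpoly omega lam).
Local Notation Q_ := (hfactor omega lam).
Local Notation h_ := (hweight omega).
Local Notation act := (fun w z => z *m map_mx intr (rho w)).

Definition generic z := forall j, (f_ j).@[z 0] != 0.

(** The default value 1 at c = 0 is met only off the generic locus. *)
Definition gm (c : C) : Gm C := insubd (Gm_one C) c.
Lemma gmE c : c != 0 -> Gm_val (gm c) = c.
Proof. by move=> c0; rewrite /gm insubdK. Qed.

(** The sign arising at H_k when w' reverses its normal and w then reverses the normal of w' H_k. By
    [kappa_cd] it is the pullback of the cocycle of [c_d], carried back by (w w')^-1. *)
Definition kappa (w w' : W) : torus C d :=
  [ffun k => if ep w' k && ep w (sg w' k) then gm (-1) else 1%g].

(* The failure of the map z |-> w^-1 z to preserve the factors Q_xi is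
   absorbed by multiplication with a rational function with values in T. *)
Definition twist (w : W) z : torus C d :=
  [ffun k => if ep w k then gm ((f_ (sg w k)).@[z 0])^-1 else 1%g].

Lemma generic_act w z : generic z -> generic (act w z).
Proof. by move=> g k; rewrite (hpoly_rho comp) mulf_neq0 ?signr_eq0. Qed.

(** The sign left over from f_k(w^-1 z) = - f_(wk)(z) in Q_xi. It need not be multiplicative in xi,
    as a_+ is not additive. *)
Definition esign w xi : C :=
  \prod_k (-1) ^+ (ep w k * (ma_mult k * ppart (h_ xi k)))%N.

Lemma hweight_inv xi w k :
  h_ (xi *m rho w^-1%g) (sg w k) = (-1) ^+ ep w k * h_ xi k.
Proof.
have := hweight_rho comp (xi *m rho w^-1%g) w k.
by rewrite -mulmxA rhoVK mulmx1 => ->; rewrite mulrA -expr2 sqrr_sign mul1r.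
Qed.

Lemma ppart_oppE (F : fieldType) (a : F) (m : nat) (k : int) : a != 0 ->
  a^-1 ^ (m%:Z * k) * (- a) ^+ (m * ppart k)
  = (-1) ^+ (m * ppart k) * a ^+ (m * ppart (- k)).
Proof.
move=> a0; rewrite [(- a) ^+ _]exprNn mulrCA; congr (_ * _).
rewrite (expz_ppart _ (invr_neq0 a0)) -mulrN !ppartMn !exprVn invrK mulrAC mulVf ?mul1r //.
by rewrite expf_neq0.
Qed.

(** Where w reverses the normal of H, the exponent of f_(wH) has to pass from m (xi_H)_+ to m (-
    xi_H)_+. The difference is - m xi_H, which is what the character of alpha applied to the twist
    supplies. *)
Lemma twist_factor w xi z : generic z ->
  chi (xi *m arr_alpha omega) (twist w z) * (Q_ xi).@[act w z 0]
  = esign w xi * (Q_ (xi *m rho w^-1%g)).@[z 0].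
Proof.
move=> gz; rewrite /hfactor !rmorph_prod /= [in RHS](reindex (sg w)) /=; last first.
  exact/onW_bij/(sg_bij hypE comp).
rewrite -!big_split /=; apply: eq_bigr => k _.
rewrite !rmorphXn /= (hpoly_rho comp) arr_alphaE ffunE hweight_inv (compat_mult comp).
case: (ep w k) => /=; last by rewrite exp1rz !mul1r.
by rewrite gmE ?invr_eq0 ?gz // !expr1 !mulN1r mul1n ppart_oppE ?gz.
Qed.

Variable b : W -> torus C n.

Definition twisted (w : W) t z : torus C n :=
  (b w * torus_hom (arr_alpha omega) (twist w z) * torus_hom (rho w^-1%g) t)%g.

(** The pullback along [twisted], on lists: by [twist_factor] the poles of the twist cancel and the
    coefficients stay polynomial, so the rational map acts on C[X]. *)
Definition lmove (w : W) tau (l : laurent C n) : laurent C n :=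
  [seq (y.1 *m rho w^-1%g, (chi y.1 (b w) * esign w y.1 * chi (y.1 *m rho w^-1%g) tau^-1%g)
      *: mlin (map_mx intr (rho w)) y.2) | y : 'rV[int]_n * {mpoly C[n]} <- l].

Lemma lmove_term w tau xi t z : generic z ->
  chi (xi *m rho w^-1%g) t * (chi xi (b w) * esign w xi * chi (xi *m rho w^-1%g) tau^-1%g)
    * (Q_ (xi *m rho w^-1%g)).@[z 0]
  = chi xi (twisted w (tau^-1 * t)%g z) * (Q_ xi).@[act w z 0].
Proof.
move=> gz; rewrite /twisted !chiM !chi_hom chiM.
have E := twist_factor w xi gz.
transitivity (chi xi (b w) * (chi (xi *m rho w^-1%g) tau^-1%g
   * chi (xi *m rho w^-1%g) t) * (esign w xi * (Q_ (xi *m rho w^-1%g)).@[z 0])); first by ring.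
by rewrite -E; ring.
Qed.

Lemma lmove_val w tau l t z : generic z ->
  lval (lfactor omega lam (lmove w tau l)) t z
  = lval (lfactor omega lam l) (twisted w (tau^-1 * t)%g z) (act w z).
Proof.
move=> gz; rewrite /lval /lfactor /lmove -map_comp !big_map.
apply: eq_bigr => y _ /=; rewrite !mevalM mevalZ mlin_eval.
have E := lmove_term w tau y.1 t gz.
apply: (etrans _ (etrans (congr1 ( *%R (y.2).@[act w z 0]) E) (mulrCA _ _ _))).
have H (p c u q : C) : p * (c * u * q) = u * (p * c * q) by ring.
exact: H.
Qed.

Definition gpoly : {mpoly C[n]} := \prod_j f_ j.

Lemma gpoly_neq0 : gpoly != 0.
Proof. by apply/prodf_neq0 => j _; exact: hpoly_neq0. Qed.

Lemma gpoly_generic z : gpoly.@[z 0] != 0 -> generic z.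
Proof. by rewrite rmorph_prod => /prodf_neq0 h j; exact: h. Qed.

Variables (X : hypertoric_data C n) (ch : chart omega lam X).

Lemma chart_generic_inj (f g : coord_ring X) :
  (forall t z, generic z -> f (ch t z) = g (ch t z)) -> f = g.
Proof.
move=> h; apply: (chart_inj (c := ch) gpoly_neq0) => t z /gpoly_generic; exact: h.
Qed.

(** The pullback is prescribed only where the twist has no pole. This determines it, so linearity,
    multiplicativity and the composition law all follow from uniqueness. *)
Definition moves w tau (f f' : coord_ring X) := forall t z, generic z ->
  f' (ch t z) = f (ch (twisted w (tau^-1 * t)%g z) (act w z)).

Lemma moves_exists w tau f : exists f', moves w tau f f'.
Proof.
have [l hl] := chart_laurent ch f.
have [f' hf'] := chart_surj ch (lmove w tau l).
by exists f' => t z gz; rewrite hf' hl lmove_val.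
Qed.

Lemma moves_unique w tau f g g' : moves w tau f g -> moves w tau f g' -> g = g'.
Proof. by move=> h h'; apply: chart_generic_inj => t z gz; rewrite h // h'. Qed.

Lemma moves_morphism w tau : exists phi : {lrmorphism coord_ring X -> coord_ring X},
  forall f, moves w tau f (phi f).
Proof.
have [phi hphi] := choice (moves_exists w tau).
have phiB : zmod_morphism phi.
  by move=> f g; apply: moves_unique (hphi _) _ => t z gz;
     rewrite -[LHS]/(phi f _ - phi g _) !hphi.
have phiM : monoid_morphism phi.
  split; first by apply: moves_unique (hphi _) _ => t z gz.
  by move=> f g; apply: moves_unique (hphi _) _ => t z gz; rewrite crM !hphi.
have phiZ : scalable phi.
  by move=> a f; apply: moves_unique (hphi _) _ => t z gz; rewrite crZ hphi.
pose lin := GRing.isScalable.Build C (coord_ring X) (coord_ring X) *:%R phi phiZ.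
pose add := GRing.isZmodMorphism.Build (coord_ring X) (coord_ring X) phi phiB.
pose mul := GRing.isMonoidMorphism.Build (coord_ring X) (coord_ring X) phi phiM.
pose m : {lrmorphism coord_ring X -> coord_ring X} := HB.pack phi add mul lin.
by exists m.
Qed.

End Action.

(** * The twisted maps preserve the bracket and compose to an action *)

Section PoissonAction.

Variables (R : realType) (n : nat).
Local Notation C := R[i].
Implicit Types (z : 'rV[C]_n) (t tau : torus C n) (xi : 'rV[int]_n).
Variables (W : finGroupType) (rho : mx_representation int [set: W] n).
Variables (A : multiarrangement R n) (omega : 'I_(ma_size A) -> 'cV[int]_n).
Variable lam : 'I_(ma_size A) -> C.
Local Notation d := (ma_size A).
Hypothesis omega_primitive : forall j, primitive (omega j).
Hypothesis hypE : forall j, ma_hyp j = hyperplane (omega j) (lam j).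
Variables (sg : W -> 'I_d -> 'I_d) (ep : W -> 'I_d -> bool).
Hypothesis comp : compatible rho omega lam sg ep.
Local Notation f_ := (hpoly omega lam).
Local Notation Q_ := (hfactor omega lam).
Local Notation h_ := (hweight omega).
Local Notation act := (fun w z => z *m map_mx intr (rho w)).
Local Notation generic := (@generic R n A omega lam).

Lemma dlog_hfactor xi z i : generic z -> dlog (Q_ xi) (z 0) i
  = \sum_j (ma_mult j * ppart (h_ xi j))%:R * ((omega j i 0)%:~R / (f_ j).@[z 0]).
Proof.
move=> gz; rewrite dlog_prodX //; apply: eq_bigr => j _; congr (_ * _).
by rewrite /dlog affine_deriv mevalC mxE.
Qed.

Lemma hfactor_generic xi z : generic z -> (Q_ xi).@[z 0] != 0.
Proof.
move=> gz; rewrite rmorph_prod; apply/prodf_neq0 => j _.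
by rewrite rmorphXn /= expf_neq0.
Qed.

(* The logarithmic derivatives of the twist. *)
Definition twist_log (w : W) z : 'M[C]_n := - \sum_k
  ((ep w k)%:R * (ma_mult k)%:R / (f_ (sg w k)).@[z 0])
  *: map_mx intr (omega (sg w k) *m (omega k)^T).

(** The correction is linear in xi, hence given by a matrix, because (- a)_+ = a_+ - a. *)
Lemma dlog_twist w xi z i : generic z ->
  dlog (Q_ (xi *m rho w^-1%g)) (z 0) i
  = \sum_j (rho w i j)%:~R * dlog (Q_ xi) (act w z 0) j
    + \sum_j twist_log w z i j * (xi 0 j)%:~R.
Proof.
move=> gz; have gz' : generic (act w z) by exact: (generic_act comp).
rewrite (dlog_hfactor _ _ gz) (reindex (sg w)) /=; last exact/onW_bij/(sg_bij hypE comp).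
have -> : \sum_j (rho w i j)%:~R * dlog (Q_ xi) (act w z 0) j
    = \sum_k (ma_mult k * ppart (h_ xi k))%:R
        * ((omega (sg w k) i 0)%:~R / (f_ (sg w k)).@[z 0]).
  under eq_bigr do rewrite (dlog_hfactor _ _ gz') big_distrr /=.
  rewrite exchange_big; apply: eq_bigr => k _ /=.
  under eq_bigr do rewrite mulrCA; rewrite -big_distrr /=; congr (_ * _).
  under eq_bigr do rewrite mulrA -rmorphM; rewrite -big_distrl -rmorph_sum /=.
  rewrite (hpoly_rho comp) (_ : \sum_j _ = (rho w *m omega k) i 0); last by rewrite mxE.
  rewrite (compat_omega comp) mxE rmorphM rmorph_sign invfM mulrACA divff ?mul1r //.
  by rewrite signr_eq0.
have -> : \sum_j twist_log w z i j * (xi 0 j)%:~R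
    = - \sum_k (ep w k)%:R * (ma_mult k)%:R * (h_ xi k)%:~R
        * ((omega (sg w k) i 0)%:~R / (f_ (sg w k)).@[z 0]).
  transitivity (- \sum_j \sum_k ((ep w k)%:R * (ma_mult k)%:R / (f_ (sg w k)).@[z 0])
      * (omega (sg w k) i 0 * omega k j 0)%:~R * (xi 0 j)%:~R).
    rewrite -sumrN; apply: eq_bigr => j _; rewrite -big_distrl /= -mulNr; congr (_ * _).
    rewrite mxE summxE; congr (- _); apply: eq_bigr => k _.
    by rewrite !mxE big_ord1 !mxE.
  rewrite exchange_big; congr (- _); apply: eq_bigr => k _ /=.
  rewrite /hweight mxE rmorph_sum big_distrr big_distrl; apply: eq_bigr => j _ /=.
  by rewrite !rmorphM /=; ring.
rewrite -sumrB; apply: eq_bigr => k _.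
rewrite (hweight_inv comp) (compat_mult comp) -mulrBl; congr (_ * _).
case: (ep w k) => /=; last by rewrite mul1r !mul0r subr0.
rewrite expr1 mulN1r mul1r -{3}[h_ xi k]ppartB rmorphB /= !natrM; ring.
Qed.

(** At a reversed hyperplane w^-1 sends omega_(wk) to - omega_k, so each summand becomes a multiple
    of omega_k omega_k^T. *)
Lemma twist_log_sym w z :
  (map_mx intr (rho w^-1%g) *m twist_log w z)^T = map_mx intr (rho w^-1%g) *m twist_log w z.
Proof.
rewrite mulmxN linearN /=; congr (- _); rewrite mulmx_sumr linear_sum.
apply: eq_bigr => k _ /=; rewrite -scalemxAr linearZ /=.
case E: (ep w k); last by rewrite !mul0r !scale0r.
congr (_ *: _); rewrite -map_intrM mulmxA.
have -> : rho w^-1%g *m omega (sg w k) = - omega k.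
  have := compat_omega comp w k; rewrite E expr1 scaleN1r => /(congr1 -%R).
  by rewrite opprK => <-; rewrite mulmxN mulmxA rhoVK mul1mx.
by rewrite map_trmx trmx_mul trmxK linearN /= mulNmx mulmxN.
Qed.

Variable b : W -> torus C n.
Local Notation twisted := (@twisted R n W rho A omega lam sg ep b).
Local Notation lmove := (@lmove R n W rho A omega ep b).
Local Notation lfactor := (lfactor omega lam).

Definition deriv_col (l : laurent C n) t z : 'cV[C]_n := \col_i lval (lderiv i l) t z.
Definition euler_col (l : laurent C n) t z : 'cV[C]_n := \col_i lval (leuler i l) t z.

Lemma lbracketE l l' t z : lbracket l l' t z
  = \sum_i (deriv_col l t z i 0 * euler_col l' t z i 0
            - euler_col l t z i 0 * deriv_col l' t z i 0).
Proof. by apply: eq_bigr => i _; rewrite !mxE. Qed.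

Lemma euler_lfactor l t z : euler_col (lfactor l) t z
  = \sum_(y <- l) (chi y.1 t * (Q_ y.1).@[z 0] * y.2.@[z 0]) *: map_mx intr y.1^T.
Proof.
apply/colP => i; rewrite mxE summxE /lval /leuler /lfactor -map_comp big_map.
by apply: eq_bigr => y _; rewrite /= !mxE mevalZ mevalM; ring.
Qed.

Lemma deriv_lfactor l t z : generic z -> deriv_col (lfactor l) t z
  = \sum_(y <- l) (chi y.1 t * (Q_ y.1).@[z 0]) *:
      (\col_i (y.2^`M(i).@[z 0] + y.2.@[z 0] * dlog (Q_ y.1) (z 0) i)).
Proof.
move=> gz; apply/colP => i; rewrite mxE summxE /lval /lderiv /lfactor -map_comp big_map.
apply: eq_bigr => y _; rewrite /= !mxE mderivM mevalD !mevalM /dlog.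
have H (p q r u v : C) : q != 0 -> p * (r * q + u * v) = p * q * (r + u * (v / q)).
  by move=> q0; field.
exact/H/hfactor_generic.
Qed.

Lemma euler_lmove w tau l t z : generic z ->
  euler_col (lfactor (lmove w tau l)) t z
  = (map_mx intr (rho w^-1%g))^T *m euler_col (lfactor l) (twisted w (tau^-1 * t)%g z) (act w z).
Proof.
move=> gz; rewrite !euler_lfactor big_map mulmx_sumr; apply: eq_bigr => y _ /=.
rewrite -scalemxAr map_trmx -map_intrM -trmx_mul; congr (_ *: _).
rewrite mevalZ mlin_eval; have E := lmove_term hypE comp b w tau y.1 t gz.
apply: (etrans _ (congr1 ( *%R^~ (y.2).@[act w z 0]) E)).
have H (p c u q : C) : p * q * (c * u) = p * c * q * u by ring.
exact: H.
Qed.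

(** The torus component of the map depends on z, so derivatives in z acquire Euler derivatives, with
    matrix [twist_log]. *)
Lemma deriv_lmove w tau l t z : generic z ->
  let t' := twisted w (tau^-1 * t)%g z in
  deriv_col (lfactor (lmove w tau l)) t z
  = map_mx intr (rho w) *m deriv_col (lfactor l) t' (act w z)
    + twist_log w z *m euler_col (lfactor l) t' (act w z).
Proof.
move=> gz t'; have gz' : generic (act w z) by exact: (generic_act comp).
rewrite euler_lfactor !deriv_lfactor // big_map !mulmx_sumr -big_split.
apply: eq_bigr => y _ /=; rewrite -!scalemxAr.
have E := lmove_term hypE comp b w tau y.1 t gz.
set c := (_ * _ * chi _ tau^-1%g) in E *.
apply/colP => i; rewrite !mxE mderivZ !mevalZ mlin_eval mlin_deriv (dlog_twist _ _ _ gz).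
have -> : \sum_j (map_mx intr (rho w) : 'M[C]_n) i j *
    (\col_i0 (y.2^`M(i0).@[act w z 0] + y.2.@[act w z 0] * dlog (Q_ y.1) (act w z 0) i0)) j 0
  = \sum_j (map_mx intr (rho w) : 'M[C]_n) i j * y.2^`M(j).@[act w z 0]
    + y.2.@[act w z 0] * \sum_j (rho w i j)%:~R * dlog (Q_ y.1) (act w z 0) j.
  rewrite big_distrr -big_split; apply: eq_bigr => j _ /=.
  by rewrite !mxE; ring.
have -> : \sum_j twist_log w z i j * (map_mx intr y.1^T : 'cV[C]_n) j 0
  = \sum_j twist_log w z i j * (y.1 0 j)%:~R.
  by apply: eq_bigr => j _; rewrite !mxE.
have H (p c0 q e s1 s2 s3 u : C) : p * c0 * q = e ->
    p * q * (c0 * s1 + c0 * u * (s2 + s3)) = e * (s1 + u * s2) + e * u * s3.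
  by move=> <-; ring.
exact: H E.
Qed.

Variables (X : hypertoric_data C n) (ch : chart omega lam X).

(** Derivatives transform as in [symplectic_bracket] with A = rho w, B = rho w^-1 and N =
    [twist_log]. *)
Lemma moves_poisson w tau (f g h f' g' h' : coord_ring X) :
  moves rho sg ep b ch w tau f f' -> moves rho sg ep b ch w tau g g' ->
  moves rho sg ep b ch w tau h h' ->
  is_poisson_bracket f g h -> is_poisson_bracket f' g' h'.
Proof.
move=> mf mg mh fgh.
have [lf hlf] := chart_laurent ch f; have [lg hlg] := chart_laurent ch g.
(* The bracket is computed from lists with the right values at all points. They are known at generic
   points only, and extend because the moved list also defines an element of C[X]. *)
have valf l (k k' : coord_ring X) : (forall t z, k (ch t z) = lval (lfactor l) t z) ->
    moves rho sg ep b ch w tau k k' ->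
    forall t z, lval (lfactor (lmove w tau l)) t z = k' (ch t z).
  move=> hl mk t z; have [k'' hk''] := chart_surj ch (lmove w tau l).
  have -> : k' = k''; last by rewrite hk''.
  apply: (moves_unique omega_primitive mk) => {}t {}z gz.
  by rewrite hk'' hl (lmove_val hypE comp).
apply: (chart_poisson_from (gpoly_neq0 lam omega_primitive) (valf _ _ _ hlf mf)
  (valf _ _ _ hlg mg)) => t z /gpoly_generic gz.
rewrite mh // (chart_poisson fgh (fun t z => esym (hlf t z)) (fun t z => esym (hlg t z))).
rewrite !lbracketE !deriv_lmove // !euler_lmove //.
apply: esym; apply: symplectic_bracket; first by rewrite -map_intrM rhoVK map_mx1.
exact: twist_log_sym.
Qed.

Lemma torus_hom_phi w (s : torus C d) k :
  Gm_val (torus_hom (phi rho omega w^-1%g) s k) = Gm_val (s (sg w k)) ^ ((-1) ^+ ep w k).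
Proof.
have epV : ep w^-1%g (sg w k) = ep w k.
  have := epM omega_primitive hypE comp w^-1%g w k.
  by rewrite mulVg (ep1 omega_primitive hypE comp); case: (ep _ _); case: (ep _ _).
rewrite ffunE /= (bigD1 (sg w k)) //= (phiE omega_primitive hypE comp) mxE.
rewrite (sgK hypE comp) eqxx epV mulr1n big1 ?mulr1 // => j jk.
rewrite mxE; case: eqP => [E|_]; last by rewrite mulr0n expr0z.
by rewrite E (sgVK hypE comp) eqxx in jk.
Qed.

Lemma twistM w w' z : generic z ->
  (kappa sg ep w w' * twist omega lam sg ep (w * w')%g z)%g
  = (twist omega lam sg ep w' (act w z)
     * torus_hom (phi rho omega w'^-1%g) (twist omega lam sg ep w z))%g.
Proof.
move=> gz; apply: torus_eqP => k; rewrite !torusM torus_hom_phi !ffunE.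
rewrite (epM omega_primitive hypE comp) (sgM hypE comp) (hpoly_rho comp).
have := gz (sg w (sg w' k)); move: (f_ _).@[_] => F F0.
case: (ep w' k); case: (ep w (sg w' k)) => /=;
  rewrite ?gmE ?expr0 ?expr1 ?mulN1r ?mul1r ?invr_eq0 ?oppr_eq0 ?oner_neq0 ?expr1z ?exprN1 //.
(* Both normals are reversed: the factors are 1 / (- F) and F. *)
- by rewrite invrK invrN mulNr mulVf.
- by rewrite invr1 mulr1.
Qed.

(* b splits the obstruction cocycle. *)
Hypothesis b_cocycle : forall w w', b (w * w')%g
  = (b w' * torus_hom (rho w'^-1%g) (b w) * torus_hom (arr_alpha omega) (kappa sg ep w w'))%g.

Lemma twistedM w w' t z : generic z ->
  twisted (w * w')%g t z = twisted w' (twisted w t z) (act w z).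
Proof.
move=> gz; rewrite /twisted !torus_homM.
rewrite !(torus_hom_mul (rho w'^-1%g)) (rho_alpha omega_primitive hypE comp).
rewrite -(torus_hom_mul (arr_alpha omega)) -rhoM -invMg b_cocycle.
have := congr1 (torus_hom (arr_alpha omega)) (twistM w w' gz).
rewrite !torus_homM => E; apply: chi_inj => xi.
have := congr1 (chi xi) E; rewrite !chiM => {}E.
have H (x1 x2 x3 x4 x5 x6 x7 : C) : x3 * x4 = x5 * x6 ->
    x1 * x2 * x3 * x4 * x7 = x1 * x5 * (x2 * x6 * x7).
  move=> h; transitivity (x1 * x2 * (x3 * x4) * x7); first by ring.
  by rewrite h; ring.
exact: H E.
Qed.

Lemma b1 : b 1%g = 1%g.
Proof.
have := b_cocycle 1%g 1%g; rewrite mulg1 invg1 rho1 torus_hom_id.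
have -> : kappa sg ep 1%g 1%g = 1%g :> torus C d.
  by apply/ffunP => k; rewrite !ffunE (ep1 omega_primitive hypE comp).
rewrite torus_hom1 mulg1 => /(congr1 (fun x => (b 1%g)^-1 * x)%g).
by rewrite mulVg mulKg.
Qed.

Lemma twisted1 t z : twisted 1%g t z = t.
Proof.
rewrite /twisted b1 mul1g invg1 rho1 torus_hom_id.
have -> : twist omega lam sg ep 1%g z = 1%g.
  by apply/ffunP => k; rewrite !ffunE (ep1 omega_primitive hypE comp).
by rewrite torus_hom1 mul1g.
Qed.

Lemma splitting_W_invariant : W_invariant X rho.
Proof.
have [act hact] := choice (fun x : torus C n * W =>
  moves_morphism omega_primitive hypE comp b ch x.2 x.1).
exists (fun tau w => act (tau, w)); split.
- move=> tau f x; pose g := act (tau, 1%g) f.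
  (* The law is required on all of Z_lambda. Translation is first shown to give an element of C[X],
     so that comparison on the chart is enough. *)
  have [g' hg'] : exists g' : coord_ring X, forall x, g' x = f (level_translate tau^-1%g x).
    have [l hl] := coord_ring_xelt f.
    exists (xelt X [seq (y.1, chi y.1 tau^-1%g *: y.2) | y : 'rV[int]_n * {mpoly C[n]} <- l]) => y.
    rewrite hl /= /xsum big_map; apply: eq_bigr => v _ /=.
    by rewrite /xmono /= chiM mevalZ; ring.
  rewrite -hg'; congr (cr_val _ x); apply: (chart_generic_inj omega_primitive (ch := ch)) => t z gz.
  rewrite hg' (hact (tau, 1%g) f) // twisted1 chart_translate rho1.
  by rewrite map_mx1 mulmx1.
- move=> tau tau' w w' f; apply: (chart_generic_inj omega_primitive (ch := ch)) => t z gz.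
  have gz' : generic (z *m map_mx intr (rho w)) by exact: (generic_act comp).
  rewrite (hact (_, (w * w')%g)) // (hact (tau, w)) // (hact (tau', w')) //.
  rewrite twistedM // -mulmxA -map_intrM -rhoM; congr (cr_val f (ch (twisted w' _ _) _)).
  rewrite /twisted invMg !torus_homM -torus_homV torus_hom_mul rhoVK torus_hom_id.
  apply: chi_inj => xi; rewrite /= !chiM.
  have H (x y p q r : C) : x * y * (p * q * r) = p * (x * y * (q * r)) by ring.
  exact: H.
- move=> w f g h fgh; exact: (moves_poisson (hact (1%g, w) f) (hact (1%g, w) g) (hact (1%g, w) h)).
- move=> w a; apply: (chart_generic_inj omega_primitive (ch := ch)) => t z gz.
  by rewrite (hact (1%g, w)) //= !chart_z /pairing mulmxA.
Qed.

End PoissonAction.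

(** * Orders of vanishing along hyperplanes *)

Lemma poly_eval_inj (F : numFieldType) (p : {poly F}) : (forall x, p.[x] = 0) -> p = 0.
Proof.
move=> Z; apply/eqP; apply: contraT => p0.
pose rs := [seq i%:R | i <- iota 0 (size p)] : seq F.
have := @max_poly_roots F p rs p0; rewrite size_map size_iota ltnn => -> //.
  by apply/allP => x _; apply/eqP/Z.
by rewrite map_inj_uniq ?iota_uniq // => i j /eqP; rewrite eqr_nat => /eqP.
Qed.

Section Vanishing.

Variable F : numFieldType.

Lemma polyX_order (M N : nat) (r s : {poly F}) : r.[0] != 0 -> s.[0] != 0 ->
  'X^M * r = 'X^N * s -> M = N.
Proof.
wlog le : M N r s / (M <= N)%N => [W|] r0 s0 E.
  case: (leqP M N) => [le|/ltnW le]; first exact: (W M N r s).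
  by apply/esym/(W N M s r) => //.
move: E; rewrite -(subnKC le) exprD -mulrA => /mulfI; rewrite monic_neq0 ?monicXn //.
move=> /(_ isT) E; move: r0; rewrite E hornerM hornerXn expr0n.
by case: (N - M)%N => [|k] /=; rewrite ?addn0 // mul0r eqxx.
Qed.

Lemma linear_power_order (x y : F) e : y != 0 ->
  exists2 r : {poly F}, r.[0] != 0 &
    (x%:P + y *: 'X) ^+ e = 'X^(if x == 0 then e else 0%N) * r.
Proof.
move=> y0; case: eqP => [->|/eqP x0].
  exists (y ^+ e)%:P; first by rewrite hornerC expf_neq0.
  by rewrite add0r exprZn -mul_polyC mulrC.
exists ((x%:P + y *: 'X) ^+ e); last by rewrite expr0 mul1r.
by rewrite horner_exp hornerD hornerC hornerZ hornerX mulr0 addr0 expf_neq0.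
Qed.

Lemma prod_linear_order (I : finType) (x y : I -> F) (e : I -> nat) :
  (forall i, y i != 0) -> exists2 r : {poly F}, r.[0] != 0 &
  \prod_i ((x i)%:P + y i *: 'X) ^+ e i = 'X^(\sum_(i | x i == 0%R) e i)%N * r.
Proof.
move=> y0; rewrite [in 'X^_]big_mkcond.
elim/big_rec2: _ => [|i N p _ [r r0 ->]].
  by exists 1; rewrite ?hornerC ?oner_neq0 // expr0 mul1r.
have [r' r'0 ->] := linear_power_order (x i) (e i) (y0 i).
by exists (r' * r); rewrite ?hornerM ?mulf_neq0 // exprD mulrACA.
Qed.

(** Each factor with x_i = 0 vanishes to order exactly 1 at s = 0, as y_i is nonzero; the sums are
    the orders of the two products there. *)
Lemma product_order (I J : finType) (x y : I -> F) (x' y' : J -> F) (e : I -> nat)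
    (e' : J -> nat) (c c' : F) :
  (forall i, y i != 0) -> (forall j, y' j != 0) -> c != 0 -> c' != 0 ->
  (forall s, c * \prod_i (x i + s * y i) ^+ e i = c' * \prod_j (x' j + s * y' j) ^+ e' j) ->
  (\sum_(i | x i == 0%R) e i = \sum_(j | x' j == 0%R) e' j)%N.
Proof.
move=> y0 y'0 c0 c'0 E.
have [r r0 Er] := prod_linear_order x e y0.
have [r' r'0 Er'] := prod_linear_order x' e' y'0.
have hE (K : finType) (u v : K -> F) (k : K -> nat) s :
    (\prod_i ((u i)%:P + v i *: 'X) ^+ k i).[s] = \prod_i (u i + s * v i) ^+ k i.
  rewrite horner_prod; apply: eq_bigr => i _.
  by rewrite horner_exp hornerD hornerC hornerZ hornerX mulrC.
apply: (@polyX_order _ _ (c *: r) (c' *: r')).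
- by rewrite hornerZ mulf_neq0.
- by rewrite hornerZ mulf_neq0.
rewrite -!scalerAr -Er -Er'; apply/eqP; rewrite -subr_eq0; apply/eqP/poly_eval_inj => s.
by rewrite hornerD hornerN !hornerZ !hE E subrr.
Qed.

End Vanishing.

(** A generic direction v is transversal to every hyperplane, and a generic y is moved along v onto
    the hyperplane of [i0]. Up to a nonzero constant [p i] at y is the i-th equation at the landing
    point. *)
Lemma generic_line (R : realType) n (I : finType) (a : I -> 'cV[int]_n) (c : I -> R[i]) i0 :
  (forall i, a i != 0) -> exists z v : 'rV[R[i]]_n,
  [/\ pairing z (map_mx intr (a i0)) = c i0,
      forall i, pairing v (map_mx intr (a i)) != 0
    & forall i, pairing z (map_mx intr (a i)) = c i ->
        hyperplane (a i) (c i) = hyperplane (a i0) (c i0)].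
Proof.
move=> a0.
have [v hv] := generic_point (fun i => affine_neq0 0 (map_intr_neq0 R (a0 i))).
have v0 i : pairing v (map_mx intr (a i)) != 0 by have := hv i; rewrite affine_eval subr0.
pose p i : {mpoly R[i][n]} := pairing v (map_mx intr (a i0)) *: affine (map_mx intr (a i)) (c i)
  - pairing v (map_mx intr (a i)) *: affine (map_mx intr (a i0)) (c i0).
have pE i (z : 'rV[R[i]]_n) : (p i).@[z 0]
    = pairing v (map_mx intr (a i0)) * (pairing z (map_mx intr (a i)) - c i)
      - pairing v (map_mx intr (a i)) * (pairing z (map_mx intr (a i0)) - c i0).
  by rewrite mevalB !mevalZ !affine_eval.
(* If [p i] is identically zero the two hyperplanes coincide; the value 1 removes the condition on
   y. *)
have [|y hy] := @generic_point R[i] n I (fun i => if p i == 0 then 1 else p i).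
  by move=> i; case: ifP => [_|/negbT //]; rewrite oner_neq0.
pose s := - (pairing y (map_mx intr (a i0)) - c i0) / pairing v (map_mx intr (a i0)).
have zE i : pairing (y + s *: v) (map_mx intr (a i)) - c i
    = (p i).@[y 0] / pairing v (map_mx intr (a i0)).
  by rewrite pairingDl pairingZl pE /s; field.
exists (y + s *: v), v; split=> // [|i zi].
  apply/eqP; rewrite -subr_eq0 zE pE; apply/eqP; rewrite -mulrBl; ring.
have pi0 : p i = 0.
  apply/eqP; apply: contraT => pi; have := hy i; rewrite (negbTE pi).
  have /eqP := zE i; rewrite zi subrr eq_sym mulf_eq0 invr_eq0 (negbTE (v0 i0)) orbF.
  by move=> ->.
have E (z : 'rV[R[i]]_n) : pairing v (map_mx intr (a i0)) * (pairing z (map_mx intr (a i)) - c i)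
      = pairing v (map_mx intr (a i)) * (pairing z (map_mx intr (a i0)) - c i0).
  by apply/eqP; rewrite -subr_eq0 -pE pi0 meval0.
apply/seteqP; split=> z; rewrite /hyperplane /= => hz; apply/eqP; rewrite -subr_eq0.
  by have /esym/eqP := E z; rewrite hz subrr mulr0 mulf_eq0 (negbTE (v0 i)).
by have /eqP := E z; rewrite hz subrr mulr0 mulf_eq0 (negbTE (v0 i0)).
Qed.

(** * Consequences of a Hamiltonian action *)

Section Necessity.

Variables (R : realType) (n : nat).
Local Notation C := R[i].
Implicit Types (z : 'rV[C]_n) (t tau : torus C n) (xi eta : 'rV[int]_n).
Variables (W : finGroupType) (rho : mx_representation int [set: W] n).
Variables (A : multiarrangement R n) (omega : 'I_(ma_size A) -> 'cV[int]_n).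
Variable lam : 'I_(ma_size A) -> C.
Local Notation d := (ma_size A).
Hypothesis omega_primitive : forall j, primitive (omega j).
Hypothesis hypE : forall j, ma_hyp j = hyperplane (omega j) (lam j).
Local Notation f_ := (hpoly omega lam).
Local Notation Q_ := (hfactor omega lam).
Local Notation h_ := (hweight omega).
Local Notation act := (fun w z => z *m map_mx intr (rho w)).
Local Notation generic := (@generic R n A omega lam).

Variables (X : hypertoric_data C n) (ch : chart omega lam X).

Definition zelt (g : {mpoly C[n]}) : coord_ring X := xelt X [:: (0, g)].

Lemma zeltE g (x : level X) : zelt g x = g.@[a_z x 0].
Proof.
rewrite /= /xsum big_seq1 /= /xmono chi0 mul1r big1 ?mul1r // => k _.
by rewrite /xweight mul0mx mxE oppr0 !expr0 mulr1.
Qed.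

Lemma zelt_chart g t z : zelt g (ch t z) = g.@[z 0].
Proof. by rewrite zeltE chart_z. Qed.

Lemma hweightN xi j : h_ (- xi) j = - h_ xi j.
Proof. by rewrite /hweight mulNmx mxE. Qed.

Lemma hfactor0 : Q_ 0 = 1.
Proof.
rewrite /hfactor big1 // => j _.
by rewrite /hweight mul0mx mxE muln0 expr0.
Qed.

Lemma bx_exists xi : exists f : coord_ring X, forall t z, f (ch t z) = chi xi t * (Q_ xi).@[z 0].
Proof.
have [f hf] := chart_surj ch [:: (xi, 1)]; exists f => t z.
by rewrite hf /lval big_seq1 /= mul1r.
Qed.

Lemma chart_eq (f g : coord_ring X) : (forall t z, f (ch t z) = g (ch t z)) -> f = g.
Proof. by move=> h; apply: (chart_generic_inj omega_primitive (ch := ch)) => t z _. Qed.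

(** * Scalars attached to a given Hamiltonian action *)

Section GivenAction.

Variable hact : torus C n -> W -> {lrmorphism coord_ring X -> coord_ring X}.
Hypothesis hact_translate : forall tau f x,
  hact tau 1%g f x = f (level_translate tau^-1%g x).
Hypothesis hactM : forall tau tau' w w' f,
  hact (tau * torus_hom (rho w) tau')%g (w * w')%g f = hact tau w (hact tau' w' f).
Hypothesis hact_moment : forall w a,
  hact 1%g w (moment X a) = moment X (map_mx intr (rho w) *m a).

Local Notation ph := (hact 1%g).

Lemma phM w w' f : ph (w * w')%g f = ph w (ph w' f).
Proof. by rewrite -hactM torus_hom1 mulg1. Qed.

Lemma ph1 f : ph 1%g f = f.
Proof.
apply: chart_eq => t z.
by rewrite hact_translate chart_translate invg1 mul1g.
Qed.

(** Equivariance of the moment map gives the linear functions, which generate all polynomials in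
    z. *)
Lemma ph_zelt w g : ph w (zelt g) = zelt (mlin (map_mx intr (rho w)) g).
Proof.
elim/mpoly_ring_ind: g => [c|i|p q hp hq|p q hp hq].
- have zc c' : zelt c'%:MP = c' *: 1.
    by apply: chart_eq => t z; rewrite zelt_chart mevalC crZ cr1 mulr1.
  by rewrite /mlin comp_mpolyC !zc linearZ rmorph1.
- have -> : zelt 'X_i = moment X (delta_mx i 0).
    apply: chart_eq => t z; rewrite zelt_chart mevalXU /= chart_z /pairing.
    by rewrite -colE mxE.
  rewrite hact_moment; apply: chart_eq => t z.
  rewrite zelt_chart mlin_eval mevalXU /= chart_z /pairing mulmxA.
  by rewrite -colE mxE.
- have zD a b : zelt (a + b) = zelt a + zelt b.
    by apply: chart_eq => t z; rewrite crD !zelt_chart mevalD.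
  by rewrite rmorphD /= !zD raddfD /= hp hq.
- have zM a b : zelt (a * b) = zelt a * zelt b.
    by apply: chart_eq => t z; rewrite crM !zelt_chart mevalM.
  by rewrite rmorphM /= !zM rmorphM /= hp hq.
Qed.

Variable bx : 'rV[int]_n -> coord_ring X.
Hypothesis bxE : forall xi t z, bx xi (ch t z) = chi xi t * (Q_ xi).@[z 0].

(** The image has weight w xi: w carries a translation by w^-1 t to one by t, and translations scale
    x_xi. *)
Lemma ph_weight w xi t z :
  ph w (bx xi) (ch t z) = chi (xi *m rho w^-1%g) t * ph w (bx xi) (ch 1%g z).
Proof.
have wt tau : hact tau 1%g (bx xi) = chi xi tau^-1%g *: bx xi.
  apply: chart_eq => s y; rewrite hact_translate chart_translate crZ !bxE chiM.
  by rewrite mulrA.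
pose tau := torus_hom (rho w^-1%g) t^-1%g.
have E : torus_hom (rho w) tau = t^-1%g.
  by rewrite torus_hom_mul rhoKV torus_hom_id.
have := congr1 (fun f : coord_ring X => f (ch 1%g z)) (hactM 1%g tau w 1%g (bx xi)).
rewrite /= wt linearZ crZ -(torus_homV (rho w^-1%g)) invgK chi_hom => <-.
have := hactM (torus_hom (rho w) tau) 1%g 1%g w (bx xi).
rewrite mulg1 mul1g torus_hom1 mulg1 mul1g => ->.
by rewrite hact_translate chart_translate E invgK mulg1.
Qed.

(** By its weight the image equals the eta-part of its own expansion. The others drop out by
    independence of characters, applied at fixed z with the value itself as an extra term of weight
    eta. *)
Lemma ph_coefficient w xi : exists c : {mpoly C[n]},
  ph w (bx xi) = zelt c * bx (xi *m rho w^-1%g).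
Proof.
set eta := xi *m _; have [l hl] := chart_laurent ch (ph w (bx xi)).
exists (\sum_(y <- l | y.1 == eta) y.2).
apply: chart_eq => t z; rewrite ph_weight -/eta crM zelt_chart bxE mulrCA; congr (_ * _).
pose G := ph w (bx xi) (ch 1%g z); rewrite -/G.
have := @chi_sum_eq0 C n (option ('rV[int]_n * {mpoly C[n]})) (None :: map Some l)
  (oapp fst eta) (oapp (fun y => y.2.@[z 0] * (Q_ y.1).@[z 0]) (- G))
  (fun x => (x == eta)%:R).
rewrite big_cons big_map /= eqxx mulr1 => H.
apply/eqP; rewrite eq_sym -subr_eq0 addrC; apply/eqP.
rewrite raddf_sum big_distrl big_mkcond /=.
apply: etrans (H _) => [|s].
  congr (_ + _); apply: eq_bigr => y _; case: eqP => [->|_]; last by rewrite mulr0.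
  by rewrite mulr1.
rewrite big_cons big_map /= addrC mulNr; apply/eqP; rewrite subr_eq0; apply/eqP.
rewrite mulrC /G -ph_weight hl /lval big_map; apply: eq_bigr => y _ /=.
by rewrite mevalM mulrC.
Qed.

Lemma zeltM_bx_inj g g' xi : zelt g * bx xi = zelt g' * bx xi -> g = g'.
Proof.
move=> E; apply: (mulIf (hfactor_neq0 lam omega_primitive xi)).
apply: mpoly_row_inj => z.
have : (zelt g * bx xi) (ch 1%g z) = (zelt g' * bx xi) (ch 1%g z) by rewrite E.
by rewrite !crM !zelt_chart !bxE chi1 !mul1r !mevalM.
Qed.

Lemma zeltM a b : zelt (a * b) = zelt a * zelt b.
Proof. by apply: chart_eq => t z; rewrite crM !zelt_chart mevalM. Qed.

(** Applying w and w^-1 in turn shows that the coefficient is a unit of the polynomial ring, hence a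
    nonzero constant. *)
Lemma ph_scalar : exists c : W -> 'rV[int]_n -> C,
  (forall w xi, c w xi != 0) /\
  forall w xi, ph w (bx xi) = c w xi *: bx (xi *m rho w^-1%g).
Proof.
suff H (x : W * 'rV[int]_n) : exists c : C, c != 0 /\
    ph x.1 (bx x.2) = c *: bx (x.2 *m rho x.1^-1%g).
  have [c hc] := choice H; exists (fun w xi => c (w, xi)).
  by split=> w xi; have [] := hc (w, xi).
case: x => w xi /=; set eta := xi *m _.
have [c hc] := ph_coefficient w xi; have [c' hc'] := ph_coefficient w^-1%g eta.
have etaK : eta *m rho w^-1^-1%g = xi by rewrite invgK -mulmxA rhoVK mulmx1.
rewrite etaK -/eta in hc hc'.
have E : mlin (map_mx intr (rho w)) c' * c = 1.
  apply: (@zeltM_bx_inj _ _ eta); rewrite zeltM -mulrA -hc -ph_zelt -rmorphM -hc'.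
  apply: (etrans (esym (phM w w^-1%g (bx eta)))); rewrite mulgV ph1.
  by apply: chart_eq => t z; rewrite crM zelt_chart meval1 mul1r.
have := mpoly_intro_unit E; case/andP=> /eqP cE c0.
exists c@_0%MM; split; first by rewrite -unitfE.
rewrite hc cE; apply: chart_eq => t z.
by rewrite crM zelt_chart mevalC crZ mcoeffC eqxx mulr1.
Qed.

Variable c : W -> 'rV[int]_n -> C.
Hypothesis c0 : forall w xi, c w xi != 0.
Hypothesis cE : forall w xi, ph w (bx xi) = c w xi *: bx (xi *m rho w^-1%g).

(** The image under w of x_xi x_eta Q_(xi+eta) = x_(xi+eta) Q_xi Q_eta, a form of t^xi t^eta =
    t^(xi+eta) without denominators. *)
Lemma scalar_relation w xi eta z : let act_xi := xi *m rho w^-1%g in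
  let act_eta := eta *m rho w^-1%g in
  c w xi * c w eta * ((Q_ act_xi).@[z 0] * (Q_ act_eta).@[z 0] * (Q_ (xi + eta)).@[act w z 0])
  = c w (xi + eta) * ((Q_ (act_xi + act_eta)).@[z 0]
      * ((Q_ xi).@[act w z 0] * (Q_ eta).@[act w z 0])).
Proof.
move=> x e.
have E : bx xi * bx eta * zelt (Q_ (xi + eta)) = bx (xi + eta) * zelt (Q_ xi * Q_ eta).
  by apply: chart_eq => t y; rewrite !crM !bxE !zelt_chart mevalM chiD; ring.
have : ph w (bx xi) * ph w (bx eta) * ph w (zelt (Q_ (xi + eta)))
    = ph w (bx (xi + eta)) * ph w (zelt (Q_ xi * Q_ eta)).
  by rewrite -!rmorphM E.
rewrite !cE !ph_zelt mulmxDl -/x -/e => /(congr1 (fun f : coord_ring X => cr_val f (ch 1%g z))).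
have ev a b f g :
    (a *: bx f * (b *: bx g) * zelt (mlin (map_mx intr (rho w)) (Q_ (xi + eta)))) (ch 1%g z)
    = a * b * ((Q_ f).@[z 0] * (Q_ g).@[z 0] * (Q_ (xi + eta)).@[act w z 0]).
  by rewrite !crM !crZ !bxE zelt_chart mlin_eval !chi1; ring.
have ev' a f : (a *: bx f * zelt (mlin (map_mx intr (rho w)) (Q_ xi * Q_ eta))) (ch 1%g z)
    = a * ((Q_ f).@[z 0] * ((Q_ xi).@[act w z 0] * (Q_ eta).@[act w z 0])).
  by rewrite !crM !crZ !bxE zelt_chart mlin_eval chi1 mevalM; ring.
by move=> h; apply: (etrans (esym (ev _ _ _ _))); apply: (etrans h); exact: ev'.
Qed.

Lemma hfactor_opp xi z : (Q_ xi).@[z 0] * (Q_ (- xi)).@[z 0]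
  = \prod_j (f_ j).@[z 0] ^+ (ma_mult j * `|h_ xi j|%N).
Proof.
rewrite -mevalM /hfactor -big_split rmorph_prod; apply: eq_bigr => j _ /=.
by rewrite -exprD rmorphXn hweightN -mulnDr ppart_abs.
Qed.

(* Comparing orders of vanishing in the image of x_xi x_(-xi). *)
Lemma arrangement_permuted w (k : 'I_d) : exists2 j : 'I_d,
  (dual_act rho w @` ma_hyp k)%classic = ma_hyp j & ma_mult j = ma_mult k.
Proof.
have [u hu] := bezout_divisibility (omega k); rewrite omega_primitive in hu.
pose e := u *m rho w^-1%g.
pose a (x : 'I_d + 'I_d) := match x with inl j => omega j | inr j => rho w *m omega j end.
pose c' (x : 'I_d + 'I_d) := match x with inl j => lam j | inr j => lam j end.
have a0 x : a x != 0.
  case: x => j /=; first exact: primitive_neq0.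
  apply: contraNneq (primitive_neq0 (omega_primitive j)) => h.
  by rewrite -[omega j]mul1mx -(rhoVK rho w) -mulmxA h mulmx0.
(* The line meets w H_k in a point lying on no other H_j or w H_j. As [u] has value 1 on omega_k,
   the order there is m_k on one side; on the other it is m_j, because [e] has value 1 or -1 on
   omega_j. *)
have [z [v [z0 v0 zh]]] := generic_line c' (inr k) a0.
have rel s : c w u * c w (- u) * \prod_j
      ((pairing z (map_mx intr (omega j)) - lam j) + s * pairing v (map_mx intr (omega j)))
        ^+ (ma_mult j * `|h_ e j|%N)
    = c w 0 * \prod_j
      ((pairing z (map_mx intr (rho w *m omega j)) - lam j)
         + s * pairing v (map_mx intr (rho w *m omega j))) ^+ (ma_mult j * `|h_ u j|%N).
  have := scalar_relation w u (- u) (z + s *: v).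
  rewrite /= subrr mulNmx -/e hfactor0 meval1 mulr1 subrr hfactor0 meval1 mul1r !hfactor_opp.
  have E1 : \prod_j (f_ j).@[(z + s *: v) 0] ^+ (ma_mult j * `|h_ e j|%N)
      = \prod_j ((pairing z (map_mx intr (omega j)) - lam j)
           + s * pairing v (map_mx intr (omega j))) ^+ (ma_mult j * `|h_ e j|%N).
    by apply: eq_bigr => j _; rewrite hpolyE pairingDl pairingZl addrAC.
  have E2 : \prod_j (f_ j).@[act w (z + s *: v) 0] ^+ (ma_mult j * `|h_ u j|%N)
      = \prod_j ((pairing z (map_mx intr (rho w *m omega j)) - lam j)
         + s * pairing v (map_mx intr (rho w *m omega j))) ^+ (ma_mult j * `|h_ u j|%N).
    by apply: eq_bigr => j _; rewrite hpolyE pairing_rho pairingDl pairingZl addrAC.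
  by move=> h; rewrite -E1 -E2.
have := product_order (fun j => v0 (inl j)) (fun j => v0 (inr j))
  (mulf_neq0 (c0 w u) (c0 w (- u))) (c0 w 0) rel.
rewrite [in RHS](bigD1 k) /=; last by rewrite z0 subrr.
rewrite [X in (_ + X)%N]big1 => [|j /andP[/eqP/subr0_eq h jk]]; last first.
  have := zh (inr j) h; rewrite /= -!dual_act_hyperplane -!hypE => /dual_act_inj.
  by move/ma_distinct => E; rewrite E eqxx in jk.
rewrite addn0 /hweight hu muln1 => E.
have [j hj] : exists j : 'I_d, ma_hyp j = (dual_act rho w @` ma_hyp k)%classic.
  apply: contrapT => ne; move: E; rewrite big1 => [h|j /eqP/subr0_eq h].
    by have := ma_mult_gt0 k; rewrite -h.
  by case: ne; exists j; rewrite !hypE dual_act_hyperplane; exact: (zh (inl j) h).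
exists j => //; move: E; rewrite (bigD1 j) /=; last first.
  have : hyperplane (rho w *m omega k) (lam k) z by exact: z0.
  by rewrite -dual_act_hyperplane -hypE -hj hypE /hyperplane /= => ->; rewrite subrr.
rewrite big1 => [|i /andP[/eqP/subr0_eq h ij]]; last first.
  have := zh (inl i) h; rewrite /= -dual_act_hyperplane -!hypE -hj => /ma_distinct E.
  by rewrite E eqxx in ij.
have [s [hs _]] := normals_sign omega_primitive hypE (esym hj).
have -> : `|(e *m omega j) 0%R 0%R|%N = 1%N.
  have : (e *m ((-1) ^+ s *: omega j)) 0 0 = 1.
    by rewrite -hs mulmxA -[e *m _]mulmxA rhoVK mulmx1 hu.
  by rewrite -scalemxAr mxE => /(congr1 absz); rewrite abszMsign.
by rewrite muln1 addn0.
Qed.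

Lemma scalar_cocycle w w' xi :
  c (w * w')%g xi = c w' xi * c w (xi *m rho w'^-1%g).
Proof.
have zc a : zelt a%:MP = a *: 1.
  by apply: chart_eq => t z; rewrite zelt_chart mevalC crZ cr1 mulr1.
have := phM w w' (bx xi); rewrite !cE linearZ /= cE -mulmxA -rhoM -invMg => E.
suff : (c (w * w')%g xi)%:MP_[n] = (c w' xi * c w (xi *m rho w'^-1%g))%:MP.
  by move/(congr1 (meval (fun=> 0))); rewrite !mevalC.
apply: (@zeltM_bx_inj _ _ (xi *m rho (w * w')^-1%g)).
by rewrite !zc -!scalerAl !mul1r E scalerA.
Qed.

End GivenAction.

(** * From the scalars to a splitting of the cocycle *)

Variables (sg : W -> 'I_d -> 'I_d) (ep : W -> 'I_d -> bool).
Hypothesis comp : compatible rho omega lam sg ep.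
Local Notation esign := (@esign R n W A omega ep).
Local Notation alpha := (arr_alpha omega).

Lemma esign_sqr w xi : esign w xi * esign w xi = 1.
Proof.
rewrite -big_split /= big1 // => k _.
by rewrite -expr2 -exprM mulnC exprM sqrrN expr1n expr1n.
Qed.

Lemma generic_exists : exists z, generic z.
Proof.
have [z hz] := generic_point (hpoly_neq0 lam omega_primitive).
by exists z.
Qed.

(** Parities are not compared directly: [twist_factor] for w', w and w w' is combined with [twistM]
    at a generic point, where the values of Q cancel. *)
Lemma esignM w w' xi : esign w' xi * esign w (xi *m rho w'^-1%g)
  = esign (w * w')%g xi * chi (xi *m alpha) (kappa sg ep w w').
Proof.
have [z gz] := generic_exists; have gz' : generic (act w z) by exact: (generic_act comp).
have E1 := twist_factor hypE comp w' xi gz'.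
have E2 := twist_factor hypE comp w (xi *m rho w'^-1%g) gz.
have E3 := twist_factor hypE comp (w * w')%g xi gz.
rewrite rhoM map_intrM mulmxA invMg rhoM mulmxA in E3.
have E4 := congr1 (chi (xi *m alpha)) (twistM omega_primitive hypE comp w w' gz).
rewrite !chiM chi_hom -[xi *m alpha *m _]mulmxA -(rho_alpha omega_primitive hypE comp) in E4.
rewrite mulmxA in E4.
have q1 := hfactor_generic (xi *m rho w'^-1%g) gz'.
have q2 := hfactor_generic (xi *m rho w'^-1%g *m rho w^-1%g) gz.
have H (p q r s x1 x2 x3 u v k : C) : q != 0 -> r != 0 -> x1 * u = p * q ->
    x2 * q = v * r -> x3 * u = s * r -> k * x3 = x1 * x2 -> p * v = s * k.
  move=> q0 r0 h1 h2 h3 h4; apply: (mulIf q0); apply: (mulIf r0).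
  transitivity (p * q * (v * r)); first by ring.
  rewrite -h1 -h2; transitivity (x1 * x2 * u * q); first by ring.
  rewrite -h4; transitivity (k * (x3 * u) * q); first by ring.
  by rewrite h3; ring.
exact: (H _ _ _ _ _ _ _ _ _ _ q1 q2 E1 E2 E3 E4).
Qed.

(** Neither [c] nor [esign] need be multiplicative in xi, but by the relation and [twist_factor]
    they deviate by the same sign. Their product is therefore a character of the lattice, that is, a
    point b_w of T. *)
Lemma splitting_exists (c : W -> 'rV[int]_n -> C) :
  (forall w xi, c w xi != 0) ->
  (forall w xi eta z, c w xi * c w eta * ((Q_ (xi *m rho w^-1%g)).@[z 0]
       * (Q_ (eta *m rho w^-1%g)).@[z 0] * (Q_ (xi + eta)).@[act w z 0])
     = c w (xi + eta) * ((Q_ (xi *m rho w^-1%g + eta *m rho w^-1%g)).@[z 0]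
      * ((Q_ xi).@[act w z 0] * (Q_ eta).@[act w z 0]))) ->
  (forall w w' xi, c (w * w')%g xi = c w' xi * c w (xi *m rho w'^-1%g)) ->
  exists b : W -> torus C n, forall w w', b (w * w')%g
    = (b w' * torus_hom (rho w'^-1%g) (b w) * torus_hom alpha (kappa sg ep w w'))%g.
Proof.
move=> c0 rel coc.
have esign0 w xi : esign w xi != 0.
  by apply/eqP => h; have /eqP := esign_sqr w xi; rewrite h mul0r eq_sym oner_eq0.
have [b hb] : exists b : W -> torus C n, forall w xi, chi xi (b w) = c w xi * esign w xi.
  suff /choice [b hb] : forall w, exists b : torus C n,
    forall xi, chi xi b = c w xi * esign w xi by exists b.
  move=> w; apply: chi_represent => [xi|xi eta]; first by rewrite mulf_neq0.
  have [z gz] := generic_exists; have gz' : generic (act w z) by exact: (generic_act comp).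
  have E1 := twist_factor hypE comp w xi gz.
  have E2 := twist_factor hypE comp w eta gz.
  have E3 := twist_factor hypE comp w (xi + eta) gz.
  rewrite !mulmxDl chiD in E3.
  have q1 := hfactor_generic (xi *m rho w^-1%g) gz.
  have q2 := hfactor_generic (eta *m rho w^-1%g) gz.
  have q3 := hfactor_generic (xi *m rho w^-1%g + eta *m rho w^-1%g) gz.
  have H (x1 x2 u1 u2 u3 e1 e2 e3 p1 p2 p3 d1 d2 d3 : C) :
      x1 * u1 = e1 * p1 -> x2 * u2 = e2 * p2 -> x1 * x2 * u3 = e3 * p3 ->
      p1 != 0 -> p2 != 0 -> p3 != 0 -> e1 * e1 = 1 -> e2 * e2 = 1 -> e3 * e3 = 1 ->
      d1 * d2 * (p1 * p2 * u3) = d3 * (p3 * (u1 * u2)) ->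
      d3 * e3 = d1 * e1 * (d2 * e2).
    move=> h1 h2 h3 p10 p20 p30 e10 e20 e30 h.
    have : d1 * d2 * e3 = d3 * (e1 * e2).
      apply: (mulIf p10); apply: (mulIf p20); apply: (mulIf p30).
      transitivity (d1 * d2 * p1 * p2 * (e3 * p3)); first by ring.
      rewrite -h3; transitivity (x1 * x2 * (d1 * d2 * (p1 * p2 * u3))); first by ring.
      rewrite h; transitivity (d3 * p3 * (x1 * u1) * (x2 * u2)); first by ring.
      by rewrite h1 h2; ring.
    move=> k; transitivity (d3 * (e1 * e2) * (e1 * e2) * e3).
      transitivity (d3 * e3 * (e1 * e1) * (e2 * e2)); last by ring.
      by rewrite e10 e20 !mulr1.
    rewrite -k; transitivity (d1 * e1 * (d2 * e2) * (e3 * e3)); first by ring.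
    by rewrite e30 mulr1.
  exact: (H _ _ _ _ _ _ _ _ _ _ _ _ _ _ E1 E2 E3 q1 q2 q3 (esign_sqr _ _) (esign_sqr _ _)
    (esign_sqr _ _) (rel w xi eta z)).
exists b => w w'; apply: chi_inj => xi; rewrite !chiM !chi_hom !hb coc.
apply: (mulIf (esign0 (w * w')%g xi)).
have kk : chi (xi *m alpha) (kappa sg ep w w') * chi (xi *m alpha) (kappa sg ep w w') = 1.
  rewrite -chiM; have -> : (kappa sg ep w w' * kappa sg ep w w')%g = 1%g :> torus C d.
    apply: torus_eqP => k; rewrite torusM torus1 ffunE; case: ifP => _; last by rewrite mulr1.
    by rewrite gmE ?oppr_eq0 ?oner_neq0 // mulrN1 opprK.
  by rewrite chi1.
have E := esignM w w' xi.
transitivity (c w' xi * c w (xi *m rho w'^-1%g)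
  * (esign w' xi * esign w (xi *m rho w'^-1%g)) * chi (xi *m alpha) (kappa sg ep w w')
  * esign (w * w')%g xi); last by ring.
rewrite E; set k := chi _ (kappa _ _ _ _) in kk *; set s := esign (w * w')%g xi.
transitivity (c w' xi * c w (xi *m rho w'^-1%g) * s * s * (k * k)); last by ring.
by rewrite kk mulr1.
Qed.

End Necessity.

(** * The extension of the group of signed permutations *)

Section SignedPermutations.

Variables (R : realType) (d : nat).
Local Notation C := R[i].
Implicit Types (s : torus C d) (u v : 'cV[C]_d) (sigma tau : 'S_d) (e : 'I_d -> bool).

Definition spmx sigma e : 'M[int]_d := \matrix_(j, k) ((-1) ^+ e k *+ (j == sigma k)).

(* The section of tildeW -> W_d sending e_k |-> e_(sigma k) to u_k |-> u_(sigma k)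
   and e_k |-> - e_(sigma k) to u_k |-> v_(sigma k), v_k |-> - u_(sigma k). *)
Definition sec (g : 'M[int]_d) : 'M[C]_(d + d) :=
  block_mx (\matrix_(j, k) (g j k == 1)%:R) (- \matrix_(j, k) (g j k == -1)%:R)
           (\matrix_(j, k) (g j k == -1)%:R) (\matrix_(j, k) (g j k == 1)%:R).

Lemma block_ext (M N : 'M[C]_(d + d)) :
  (forall u v, M *m col_mx u v = N *m col_mx u v) -> M = N.
Proof.
move=> h; have h' (x : 'cV[C]_(d + d)) : M *m x = N *m x by rewrite -[x]vsubmxK.
apply/matrixP => i j; have := h' (delta_mx j 0).
by rewrite -!colE => /colP /(_ i); rewrite !mxE.
Qed.

Lemma torus_mx_act s u v : torus_mx s *m col_mx u v
  = col_mx (\col_j (Gm_val (s j) * u j 0)) (\col_j ((Gm_val (s j))^-1 * v j 0)).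
Proof.
rewrite mul_block_col !mul0mx addr0 add0r; congr col_mx; apply/colP => j.
  by rewrite mul_diag_mx !mxE.
by rewrite mul_diag_mx !mxE torusV.
Qed.

Lemma sec_act sigma e u v : sec (spmx sigma e) *m col_mx u v
  = col_mx (\col_j (if e (sigma^-1 j)%g then - v (sigma^-1 j)%g 0 else u (sigma^-1 j)%g 0))
           (\col_j (if e (sigma^-1 j)%g then u (sigma^-1 j)%g 0 else v (sigma^-1 j)%g 0)).
Proof.
have P (w : 'cV[C]_d) (b : bool) j :
    \sum_k (spmx sigma e j k == (-1) ^+ b)%:R * w k 0
    = if e (sigma^-1 j)%g == b then w (sigma^-1 j)%g 0 else 0.
  rewrite (bigD1 (sigma^-1 j)%g) //= big1 ?addr0 => [|k jk]; last first.
    rewrite mxE; case: (j =P sigma k) => [E|_]; first by rewrite E permK eqxx in jk.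
    by rewrite mulr0n eq_sym signr_eq0 mul0r.
  rewrite mxE permKV eqxx mulr1n; case: (e _); case: b => /=;
    by rewrite ?mul1r ?mul0r.
rewrite mul_block_col; congr col_mx; apply/colP => j; rewrite ?mulNmx !mxE.
  have := P u false j; have := P v true j; rewrite !expr0 !expr1 => E1 E2.
  rewrite (eq_bigr (fun k => (spmx sigma e j k == 1)%:R * u k 0)) => [|k _]; last by rewrite !mxE.
  rewrite [X in _ - X](eq_bigr (fun k => (spmx sigma e j k == -1)%:R * v k 0)) => [|k _];
    last by rewrite !mxE.
  by rewrite E1 E2; case: (e _); rewrite /= ?add0r ?subr0.
have := P v false j; have := P u true j; rewrite !expr0 !expr1 => E1 E2.
rewrite (eq_bigr (fun k => (spmx sigma e j k == -1)%:R * u k 0)) => [|k _]; last by rewrite !mxE.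
rewrite [X in _ + X](eq_bigr (fun k => (spmx sigma e j k == 1)%:R * v k 0)) => [|k _];
    last by rewrite !mxE.
by rewrite E1 E2; case: (e _); rewrite /= ?add0r ?addr0.
Qed.

Lemma spmxM sigma tau e f : spmx sigma e *m spmx tau f
  = spmx (tau * sigma)%g (fun k => e (tau k) (+) f k).
Proof.
apply/matrixP => j k; rewrite mxE (bigD1 (tau k)) //= !mxE eqxx mulr1n.
rewrite big1 ?addr0 => [|i ik]; last by rewrite [in X in _ * X]mxE (negbTE ik) mulr0n mulr0.
by rewrite permM signr_addb; case: (j == _); rewrite ?mul0r ?mulr1n // mulr0n mul0r.
Qed.

Lemma torus_hom_spmx sigma e s j : Gm_val (torus_hom (spmx sigma e) s j)
  = Gm_val (s (sigma^-1 j)%g) ^ ((-1) ^+ e (sigma^-1 j)%g).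
Proof.
rewrite ffunE /= (bigD1 (sigma^-1 j)%g) //= mxE permKV eqxx mulr1n big1 ?mulr1 // => k jk.
rewrite mxE; case: eqP => [E|_]; last by rewrite mulr0n expr0z.
by rewrite E permK eqxx in jk.
Qed.

Lemma sec_lies_over sigma e : lies_over (sec (spmx sigma e)) (spmx sigma e).
Proof.
move=> s; apply: block_ext => u v.
rewrite -!mulmxA torus_mx_act !sec_act torus_mx_act; congr col_mx; apply/colP => j.
  rewrite !mxE torus_hom_spmx; case: (e _) => /=; last by rewrite expr0 expr1z.
  by rewrite expr1 exprN1 mulrN.
rewrite !mxE torus_hom_spmx; case: (e _) => /=; last by rewrite expr0 expr1z.
by rewrite expr1 exprN1 invrK.
Qed.

(* The square of the rotation of a plane is -1. *)
Definition cd (g h : 'M[int]_d) : torus C d :=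
  [ffun j => if [exists i, exists k, (g j i == -1) && (h i k == -1)]
             then gm (-1) else 1%g].

Lemma N1_neq0 : (-1 : C) != 0.
Proof. by rewrite oppr_eq0 oner_neq0. Qed.

Lemma cd_sqr g h : (cd g h * cd g h)%g = 1%g.
Proof.
apply: torus_eqP => j; rewrite torusM torus1 ffunE; case: ifP => _; last by rewrite mulr1.
by rewrite (gmE N1_neq0) mulrN1 opprK.
Qed.

Lemma cd_spmx sigma tau e f k : Gm_val (cd (spmx sigma e) (spmx tau f) (sigma (tau k)))
  = if f k && e (tau k) then -1 else 1.
Proof.
rewrite ffunE; have N1 (b : bool) (a : bool) : ((-1) ^+ b *+ a == -1 :> int) = a && b.
  by case: a; case: b.
case: existsP => [[i /existsP[l]]|ne].
  rewrite !mxE !N1 => /andP[/andP[/eqP/perm_inj <- ei] /andP[/eqP/perm_inj <- fk]].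
  by rewrite fk ei (gmE N1_neq0).
case: ifP => // /andP[fk etk]; case: ne; exists (tau k); apply/existsP; exists k.
by rewrite !mxE !N1 !eqxx fk etk.
Qed.

Lemma torus_mxM s t : torus_mx (s * t)%g = torus_mx s *m torus_mx t.
Proof.
apply: block_ext => u v; rewrite -mulmxA !torus_mx_act; congr col_mx; apply/colP => j.
  by rewrite !mxE torusM mulrA.
by rewrite !mxE torusM invfM mulrA.
Qed.

Lemma torus_mx1 : torus_mx (1%g : torus C d) = 1%:M.
Proof.
apply: block_ext => u v; rewrite torus_mx_act mul1mx; congr col_mx; apply/colP => j.
  by rewrite !mxE torus1 mul1r.
by rewrite !mxE torus1 invr1 mul1r.
Qed.

Lemma torus_mx_unit s : torus_mx s \in unitmx.
Proof.
have E : torus_mx s^-1%g *m torus_mx s = 1%:M by rewrite -torus_mxM mulVg torus_mx1.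
by have [] := mulmx1_unit E.
Qed.

Lemma torus_mx_inj : injective (@torus_mx R d).
Proof.
move=> s t E; apply: torus_eqP => j.
have := congr1 (fun M => M *m col_mx (const_mx 1 : 'cV_d) (const_mx 1 : 'cV_d)) E.
rewrite /= !torus_mx_act => /eq_col_mx [/colP /(_ j) + _].
by rewrite !mxE !mulr1.
Qed.

Lemma secM sigma tau e f : sec (spmx sigma e) *m sec (spmx tau f)
  = torus_mx (cd (spmx sigma e) (spmx tau f)) *m sec (spmx sigma e *m spmx tau f).
Proof.
apply: block_ext => u v; rewrite -!mulmxA sec_act sec_act spmxM sec_act torus_mx_act.
have E j : Gm_val (cd (spmx sigma e) (spmx tau f) j)
    = if f (tau^-1 (sigma^-1 j))%g && e (sigma^-1 j)%g then -1 else 1.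
  rewrite -{1}[j](permKV sigma) -{1}[(sigma^-1 j)%g](permKV tau) cd_spmx.
  by rewrite permKV.
have EV j : ((tau * sigma)^-1 j)%g = (tau^-1 (sigma^-1 j))%g.
  by rewrite invMg permM.
congr col_mx; apply/colP => j; rewrite !mxE E EV !permKV.
  by case: (e _); case: (f _); rewrite /= ?mul1r ?mulN1r ?invr1 ?mul1r.
by case: (e _); case: (f _); rewrite /= ?invr1 ?mul1r ?invrN ?invr1 ?mulN1r ?opprK.
Qed.

Lemma spmx1 : spmx 1%g (fun=> false) = 1%:M.
Proof. by apply/matrixP => j k; rewrite !mxE perm1. Qed.

Lemma sec1 : sec 1%:M = 1%:M.
Proof.
rewrite -spmx1; apply: block_ext => u v; rewrite sec_act mul1mx.
by congr col_mx; apply/colP => j; rewrite mxE invg1 perm1.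
Qed.

Lemma sec_rot j : sec (spmx 1%g (pred1 j))
  = block_mx (1%:M - delta_mx j j) (- delta_mx j j) (delta_mx j j) (1%:M - delta_mx j j).
Proof.
have D (w : 'cV[C]_d) i : (delta_mx j j *m w) i 0 = if i == j then w i 0 else 0.
  rewrite mxE (bigD1 j) //= big1 => [|k kj]; last by rewrite mxE (negbTE kj) andbF mul0r.
  by rewrite mxE eqxx andbT addr0; case: eqP => [->|_]; rewrite ?mul1r ?mul0r.
have addE (x y : 'cV[C]_d) i : (x + y) i 0 = x i 0 + y i 0 by rewrite mxE.
have oppE (x : 'cV[C]_d) i : (- x) i 0 = - x i 0 by rewrite mxE.
apply: block_ext => u v; rewrite sec_act mul_block_col !mulmxBl !mulNmx !mul1mx.
congr col_mx; apply/colP => i; rewrite [LHS]mxE invg1 perm1 /= !addE !oppE !D.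
  by case: eqP => _; ring.
by case: eqP => _; ring.
Qed.

(** The inverse appears because [perm_mx sigma] sends e_(sigma j) to e_j. *)
Lemma sec_perm sigma : sec (spmx sigma (fun=> false))
  = block_mx (perm_mx sigma^-1%g) 0 0 (perm_mx sigma^-1%g).
Proof.
have P (w : 'cV[C]_d) j : (perm_mx sigma^-1%g *m w) j 0 = w (sigma^-1 j)%g 0.
  by rewrite -row_permE mxE.
apply: block_ext => u v; rewrite sec_act mul_block_col !mul0mx addr0 add0r.
by congr col_mx; apply/colP => j; rewrite mxE P.
Qed.

Lemma cd_disjoint sigma tau e f : (forall k, ~~ (f k && e (tau k))) ->
  cd (spmx sigma e) (spmx tau f) = 1%g.
Proof.
move=> ne; apply: torus_eqP => j; rewrite torus1.
by rewrite -[j](permKV sigma) -[(sigma^-1 j)%g](permKV tau) cd_spmx (negbTE (ne _)).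
Qed.

Lemma eq_spmx sigma e f : e =1 f -> spmx sigma e = spmx sigma f.
Proof. by move=> ef; apply/matrixP => j k; rewrite !mxE ef. Qed.

(** Rotations in distinct planes, and a permutation after them, compose without sign by
    [cd_disjoint]; so the section is a product of generators. *)
Lemma tildeW_sec sigma e : tildeW (sec (spmx sigma e)).
Proof.
have R0 (r : seq 'I_d) : uniq r -> tildeW (sec (spmx 1%g (fun k => k \in r))).
  elim: r => [_|i r IH /= /andP[ir ur]].
    rewrite (eq_spmx _ (f := fun=> false)) // spmx1 sec1; exact: tildeW_one.
  have -> : sec (spmx 1%g (fun k => k \in i :: r))
      = sec (spmx 1%g (pred1 i)) *m sec (spmx 1%g (fun k => k \in r)).
    rewrite secM cd_disjoint => [|k]; last first.
      by rewrite perm1 /=; apply: contra ir => /andP[kr /eqP <-].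
    rewrite torus_mx1 mul1mx spmxM mulg1; congr sec; apply: eq_spmx => k.
    by rewrite /= perm1 inE; case: eqP => [->|_] //=; rewrite (negbTE ir).
  apply: tildeW_mul; last exact: IH.
  by rewrite sec_rot; exact: tildeW_rot.
have -> : sec (spmx sigma e)
    = sec (spmx sigma (fun=> false)) *m sec (spmx 1%g (fun k => k \in enum e)).
  rewrite secM cd_disjoint => [|k]; last by rewrite andbF.
  rewrite torus_mx1 mul1mx spmxM mul1g; congr sec; apply: eq_spmx => k /=.
  by rewrite mem_enum.
apply: tildeW_mul; last by apply: R0; exact: enum_uniq.
by rewrite sec_perm; exact: tildeW_perm.
Qed.

(** These matrices include the generators and are closed under products and inverses, so tildeW
    contains nothing else. *)
Definition twisted_sec (M : 'M[C]_(d + d)) : Prop := exists sigma e s,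
  (s * s)%g = 1%g /\ M = torus_mx s *m sec (spmx sigma e).

Lemma torus_sqr_hom (g : 'M[int]_d) s : (s * s = 1)%g -> (torus_hom g s * torus_hom g s = 1)%g.
Proof. by move=> s2; rewrite -torus_homM s2 torus_hom1. Qed.

Lemma torus_sqrM s t : (s * s = 1)%g -> (t * t = 1)%g -> (s * t * (s * t) = 1)%g.
Proof.
move=> s2 t2; rewrite -mulgA [(t * (s * t))%g]mulgA [(t * s)%g]torus_mulC.
by rewrite -[(s * t * t)%g]mulgA t2 mulg1 s2.
Qed.

Lemma twisted_sec_mul M N : twisted_sec M -> twisted_sec N -> twisted_sec (M *m N).
Proof.
move=> [sigma [e [s [s2 ->]]]] [tau [f [t [t2 ->]]]].
exists (tau * sigma)%g, (fun k => e (tau k) (+) f k).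
exists (s * (torus_hom (spmx sigma e) t * cd (spmx sigma e) (spmx tau f)))%g; split.
  by apply: torus_sqrM => //; apply: torus_sqrM; [exact: torus_sqr_hom | exact: cd_sqr].
rewrite !torus_mxM -spmxM -!mulmxA; congr (_ *m _).
by rewrite -secM !mulmxA (sec_lies_over sigma e t).
Qed.

Lemma twisted_sec_torus s : (s * s = 1)%g -> twisted_sec (torus_mx s).
Proof.
by move=> s2; exists 1%g, (fun=> false), s; rewrite spmx1 sec1 mulmx1.
Qed.

Lemma left_inverse_invmx (M N : 'M[C]_(d + d)) : N *m M = 1%:M -> invmx M = N.
Proof.
move=> NM; have [_ uM] := mulmx1_unit NM.
by rewrite -[LHS]mul1mx -NM mulmxK.
Qed.

Lemma twisted_sec_inv M : twisted_sec M -> twisted_sec (invmx M).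
Proof.
move=> [sigma [e [s [s2 ->]]]].
pose f k := e (sigma^-1 k)%g.
pose c := cd (spmx sigma^-1%g f) (spmx sigma e).
have E : sec (spmx sigma^-1%g f) *m sec (spmx sigma e) = torus_mx c.
  rewrite secM spmxM mulgV -/c (eq_spmx _ (f := fun=> false)) ?spmx1 ?sec1 ?mulmx1 //.
  by move=> k; rewrite /f permK addbb.
have c2 : (c * c = 1)%g by exact: cd_sqr.
rewrite (left_inverse_invmx (N := torus_mx c *m sec (spmx sigma^-1%g f) *m torus_mx s)).
  apply: twisted_sec_mul (twisted_sec_torus s2).
  by apply: twisted_sec_mul (twisted_sec_torus c2) _; exists sigma^-1%g, f, 1%g;
     rewrite mulg1 torus_mx1 mul1mx.
rewrite -!mulmxA [torus_mx s *m (_ *m _)]mulmxA -torus_mxM s2 torus_mx1 mul1mx E.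
by rewrite -torus_mxM c2 torus_mx1.
Qed.

Lemma tildeW_twisted_sec M : tildeW M -> twisted_sec M.
Proof.
elim=> [sigma|j||{}M N _ hM _ hN|{}M _ hM].
- exists sigma^-1%g, (fun=> false), 1%g; rewrite mulg1 torus_mx1 mul1mx; split=> //.
  by rewrite sec_perm invgK.
- exists 1%g, (pred1 j), 1%g; rewrite mulg1 torus_mx1 mul1mx; split=> //.
  by rewrite sec_rot.
- by rewrite -torus_mx1; apply: twisted_sec_torus; rewrite mulg1.
- exact: twisted_sec_mul.
- exact: twisted_sec_inv.
Qed.

Lemma sec_unit sigma e : sec (spmx sigma e) \in unitmx.
Proof.
pose f k := e (sigma^-1 k)%g; pose c := cd (spmx sigma^-1%g f) (spmx sigma e).
have E : (torus_mx c^-1%g *m sec (spmx sigma^-1%g f)) *m sec (spmx sigma e) = 1%:M.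
  rewrite -mulmxA secM -/c mulmxA -torus_mxM mulVg torus_mx1 mul1mx spmxM mulgV.
  rewrite (eq_spmx _ (f := fun=> false)) ?spmx1 ?sec1 //.
  by move=> k; rewrite /f permK addbb.
by have [] := mulmx1_unit E.
Qed.

Lemma torus_hom_inj (g h : 'M[int]_d) :
  (forall s, torus_hom g s = torus_hom h s) -> g = h.
Proof.
move=> E; apply/row_matrixP => j; apply/eqP; apply: contraT => ne.
have [s] := chi_separates C ne; move/eqP; case.
by rewrite -!torus_homE E.
Qed.

(** The torus factor commutes with the torus, so the map induced on the lattice depends on the
    section factor alone and determines it. *)
Lemma tildeW_over (M : 'M[C]_(d + d)) sigma e : tildeW M -> lies_over M (spmx sigma e) ->
  exists2 s, (s * s = 1)%g & M = torus_mx s *m sec (spmx sigma e).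
Proof.
move=> /tildeW_twisted_sec [tau [f [s [s2 EM]]]] over.
exists s => //; rewrite {1}EM; congr (_ *m sec _); apply: torus_hom_inj => t.
apply: torus_mx_inj; have uM : M \in unitmx.
  by rewrite EM unitmx_mul sec_unit torus_mx_unit.
apply: (can_inj (mulmxK uM)); rewrite -(over t) EM -[RHS]mulmxA sec_lies_over !mulmxA.
by rewrite -!torus_mxM torus_mulC.
Qed.

Lemma represents_cd_explicit : represents_cd (@cd).
Proof.
exists sec; split=> [g [sigma [e ->]]|g h [sigma [e ->]] [tau [f ->]]].
  by split; [exact: tildeW_sec | exact: sec_lies_over].
split; first exact: cd_sqr.
by rewrite secM spmxM mulmxK // sec_unit.
Qed.

(** Over signed permutations any section is the explicit one times a function b with values in the
    torus, and changing the section changes the cocycle by the coboundary of b. *)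
Lemma represents_cd_cohomologous c : represents_cd c -> exists b : 'M[int]_d -> torus C d,
  forall g h, signed_perm g -> signed_perm h ->
    c g h = (b g * torus_hom g (b h) * (b (g *m h))^-1 * cd g h)%g.
Proof.
case=> sec' [over coc].
have H (g : 'M[int]_d) : exists s, signed_perm g -> sec' g = torus_mx s *m sec g.
  have [gs|ng] := pselect (signed_perm g); last by exists 1%g.
  have [tg og] := over g gs; case: gs => sigma [e Eg]; rewrite Eg in tg og *.
  by have [s _ hs] := tildeW_over tg og; exists s.
have [b hb] := choice H; exists b => g h gs hs.
have ghs : signed_perm (g *m h).
  case: gs => sigma [e ->]; case: hs => tau [f ->].
  by exists (tau * sigma)%g, (fun k => e (tau k) (+) f k); exact: spmxM.
apply: torus_mx_inj; have [_ ->] := coc g h gs hs.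
have u' : sec' (g *m h) \in unitmx.
  rewrite hb //; case: ghs => sigma [e ->].
  by rewrite unitmx_mul sec_unit torus_mx_unit.
apply: (can_inj (mulmxK u')); apply: (etrans (mulmxKV u' _)).
rewrite (hb _ gs) (hb _ hs) (hb _ ghs).
have E1 : sec g *m torus_mx (b h) = torus_mx (torus_hom g (b h)) *m sec g.
  by case: gs => sigma [e ->]; exact: sec_lies_over.
have E2 : sec g *m sec h = torus_mx (cd g h) *m sec (g *m h).
  by case: gs => sigma [e ->]; case: hs => tau [f ->]; exact: secM.
have K (x y z w : torus C d) (S S' G : 'M[C]_(d + d)) :
    S *m torus_mx z = torus_mx y *m S -> S *m S' = torus_mx w *m G -> forall r,
    torus_mx x *m S *m (torus_mx z *m S') = torus_mx (x * y * r^-1 * w)%g *m (torus_mx r *m G).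
  move=> h1 h2 r; rewrite mulmxA -[_ *m S *m _]mulmxA h1 -!mulmxA h2 !mulmxA -!torus_mxM.
  by congr (torus_mx _ *m _); rewrite -[RHS]mulgA [(w * r)%g]torus_mulC !mulgA mulgVK.
exact: K E1 E2 _.
Qed.

End SignedPermutations.

(** * The obstruction class *)

Section Cohomologous.

Variables (G : finGroupType) (F : fieldType) (n : nat).
Variable M : G -> 'M[int]_n.
Local Notation act := (fun g => torus_hom (M g) : torus F n -> torus F n).
Implicit Types f : G -> G -> torus F n.

Lemma cohomologous_refl f : cohomologous act f f.
Proof.
by exists (fun=> 1%g) => x y; rewrite torus_hom1 invg1 !mulg1 mul1g.
Qed.

Lemma cohomologous_sym f f' : cohomologous act f f' -> cohomologous act f' f.
Proof.
case=> b h; exists (fun x => (b x)^-1%g) => x y; rewrite h torus_homV invgK.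
apply: chi_inj => xi; rewrite !chiM !chiV; field.
by rewrite !chi_neq0.
Qed.

Lemma cohomologous_trans f f' f'' :
  cohomologous act f f' -> cohomologous act f' f'' -> cohomologous act f f''.
Proof.
case=> b h [b' h']; exists (fun x => b x * b' x)%g => x y; rewrite h h' torus_homM.
apply: chi_inj => xi; rewrite !chiM !chiV !chiM; field.
by rewrite !chi_neq0.
Qed.

End Cohomologous.

Section Obstruction.

Variables (R : realType) (n : nat).
Local Notation C := R[i].
Variables (W : finGroupType) (rho : mx_representation int [set: W] n).
Variables (A : multiarrangement R n) (omega : 'I_(ma_size A) -> 'cV[int]_n).
Variable lam : 'I_(ma_size A) -> C.
Local Notation d := (ma_size A).
Hypothesis omega_primitive : forall j, primitive (omega j).
Hypothesis hypE : forall j, ma_hyp j = hyperplane (omega j) (lam j).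
Variables (sg : W -> 'I_d -> 'I_d) (ep : W -> 'I_d -> bool).
Hypothesis comp : compatible rho omega lam sg ep.
Local Notation alpha := (arr_alpha omega).
Local Notation ph := (phi rho omega).
Local Notation coh := (cohomologous (fun w => torus_hom (rho w) : torus C n -> torus C n)).

Lemma sg_inj w : injective (sg w).
Proof. exact: can_inj (sgK hypE comp w). Qed.

Lemma phi_spmx w : ph w = spmx (perm (@sg_inj w)) (ep w).
Proof.
rewrite (phiE omega_primitive hypE comp); apply/matrixP => j k.
by rewrite !mxE permE.
Qed.

Lemma phi_signed w : signed_perm (ph w).
Proof. by exists (perm (@sg_inj w)), (ep w); exact: phi_spmx. Qed.

Lemma phiM w w' : ph (w * w')%g = ph w *m ph w'.
Proof.
rewrite !phi_spmx spmxM; apply/matrixP => j k.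
by rewrite !mxE permM !permE (sgM hypE comp) (epM omega_primitive hypE comp).
Qed.

(** [cd] is indexed by target hyperplanes and [kappa] by source ones. The exponents 1 or -1 of the
    signed permutation do not affect signs. *)
Lemma kappa_cd w w' : torus_hom (ph (w * w')^-1%g) (cd R (ph w) (ph w')) = kappa sg ep w w'.
Proof.
apply: torus_eqP => k; rewrite (torus_hom_phi omega_primitive hypE comp).
rewrite (sgM hypE comp) !phi_spmx.
have := cd_spmx R (perm (@sg_inj w)) (perm (@sg_inj w')) (ep w) (ep w') k.
rewrite !permE => ->; rewrite ffunE; case: ifP => _; last by rewrite exp1rz.
rewrite gmE ?N1_neq0 //; case: (ep _ _); last by rewrite expr0 expr1z.
by rewrite expr1 exprN1 invrN invr1.
Qed.

Definition obstruction_cocycle w w' := torus_hom alpha (cd R (ph w) (ph w')).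

Lemma alpha_phi w (s : torus C d) :
  torus_hom (rho w) (torus_hom alpha s) = torus_hom alpha (torus_hom (ph w) s).
Proof. by rewrite !torus_hom_mul (rho_alpha omega_primitive hypE comp). Qed.

Lemma obstruction_kappa w w' :
  torus_hom (rho (w * w')^-1%g) (obstruction_cocycle w w') = torus_hom alpha (kappa sg ep w w').
Proof. by rewrite /obstruction_cocycle alpha_phi kappa_cd. Qed.

Lemma obstruction_sqr w w' : (obstruction_cocycle w w' * obstruction_cocycle w w')%g = 1%g.
Proof. by rewrite -torus_homM cd_sqr torus_hom1. Qed.

(** With b_w = w^-1 beta_w the splitting equation is the coboundary equation carried back by (w
    w')^-1. The cocycle has order two, so it may stand on either side. *)
Lemma splitting_cohomologous : coh obstruction_cocycle (fun _ _ => 1%g) <->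
  exists b : W -> torus C n, forall w w', b (w * w')%g
    = (b w' * torus_hom (rho w'^-1%g) (b w) * torus_hom alpha (kappa sg ep w w'))%g.
Proof.
split=> [[beta h]|[b h]].
  exists (fun w => torus_hom (rho w^-1%g) (beta w)) => w w'.
  have E : beta (w * w')%g
      = (beta w * torus_hom (rho w) (beta w') * obstruction_cocycle w w')%g.
    have := obstruction_sqr w w'; rewrite {1}h mulg1.
    move: (beta w) (torus_hom _ _) (beta (w * w')%g) (obstruction_cocycle w w') => x y z o.
    move=> E; rewrite -[z]mul1g -E; rewrite -mulgA -mulgA [(o * z)%g]torus_mulC.
    by rewrite !mulgA mulgVK.
  rewrite E !torus_homM obstruction_kappa !torus_hom_mul -!rhoM; congr (_ * _)%g.
  by rewrite torus_mulC invMg mulgVK.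
exists (fun w => torus_hom (rho w) (b w)) => w w'; rewrite mulg1 h !torus_homM.
have -> : torus_hom (rho (w * w')%g) (torus_hom alpha (kappa sg ep w w'))
    = obstruction_cocycle w w'.
  by rewrite -obstruction_kappa torus_hom_mul rhoKV torus_hom_id.
rewrite !torus_hom_mul -!rhoM mulgK.
have := obstruction_sqr w w'.
move: (torus_hom _ (b w)) (torus_hom _ (b w')) (obstruction_cocycle w w') => x y o oo.
apply: chi_inj => xi; have := congr1 (chi xi) oo; rewrite !(chiM, chiV) chi1 => E.
have o0 := chi_neq0 xi o; apply: (mulIf o0); rewrite E.
by field; rewrite !chi_neq0.
Qed.

(** The set collects the classes of all cocycles representing [c_d]. These classes coincide, so the
    set is trivial as soon as the explicit cocycle is a coboundary. *)
Lemma obstruction_trivial :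
  obstruction rho omega = trivial_class rho <-> coh obstruction_cocycle (fun _ _ => 1%g).
Proof.
have any c : represents_cd c ->
    coh (fun x y => torus_hom alpha (c (ph x) (ph y))) obstruction_cocycle.
  move=> /represents_cd_cohomologous [b hb].
  exists (fun w => torus_hom alpha (b (ph w))) => x y.
  rewrite hb; [|exact: phi_signed|exact: phi_signed].
  by rewrite !torus_homM torus_homV alpha_phi phiM.
split=> [E|h].
  have : obstruction rho omega obstruction_cocycle.
    by exists (@cd R d); [exact: represents_cd_explicit | exact: cohomologous_refl].
  by rewrite E.
apply/seteqP; split=> f.
  case=> c hc hf; apply: cohomologous_trans hf _.
  exact: cohomologous_trans (any c hc) h.
move=> hf; exists (@cd R d); first exact: represents_cd_explicit.
exact: cohomologous_trans hf (cohomologous_sym h).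
Qed.

End Obstruction.

Theorem corollary5p15 (R : realType) (W : finGroupType) (n : nat)
    (rho : mx_representation int [set: W] n)
    (HW : is_weyl_group R W) (Hrho : is_reflection_group R rho)
    (X : hypertoric_data R[i] n)
    (A : multiarrangement R n) (HA : is_multiarrangement_of X A)
    (omega : 'I_(ma_size A) -> 'cV[int]_n) (Homega : primitive_normals omega) :
  W_invariant X rho <->
  multiarrangement_invariant rho A /\
  obstruction rho omega = trivial_class rho.
Proof.
have omega_primitive j : primitive (omega j) by have [] := Homega j.
have [lam hypE] : exists lam : 'I_(ma_size A) -> R[i],
    forall j, ma_hyp j = hyperplane (omega j) (lam j).
  suff /choice [lam h] : forall j, exists c : R[i], ma_hyp j = hyperplane (omega j) c.
    by exists lam.
  by move=> j; have [_ [_]] := Homega j.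
have [ch _] := chart_exists omega_primitive hypE HA.
split=> [[hact [act_translate actM _ act_moment]]|[inv obs]].
  have /choice [bx bxE] := bx_exists ch.
  have [c [c0 cE]] := ph_scalar omega_primitive act_translate actM act_moment bxE.
  have [sg [ep comp]] := permuted_compatible omega_primitive hypE
    (arrangement_permuted omega_primitive hypE act_moment bxE c0 cE).
  split; first exact: (compatible_invariant hypE comp).
  apply/(obstruction_trivial omega_primitive hypE comp).
  apply/(splitting_cohomologous omega_primitive hypE comp).
  apply: (splitting_exists omega_primitive hypE comp c0).
    exact: (scalar_relation omega_primitive act_moment bxE cE).
  exact: (scalar_cocycle omega_primitive actM bxE cE).
have [sg [ep comp]] := invariant_compatible omega_primitive hypE inv.
have /(splitting_cohomologous omega_primitive hypE comp) [b hb] :=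
  (obstruction_trivial omega_primitive hypE comp).1 obs.
exact: (splitting_W_invariant omega_primitive hypE comp ch hb).
Qed.
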